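(* Suppose that a two-dimensional Lie invariance algebra $\mathfrak g$ of an equation $\mathcal L$: $u_t=A(t,x)u_{xx}+B(t,x)u_x+C(t,x)u$ (analytic $A,B,C$, $A\ne0$) induces the Lie invariance algebra $\mathfrak g_0$ of the corresponding determining equation ${\rm DE}_0(\mathcal L)$, and that $\mathfrak g_0$ is appropriate for Lie reduction of ${\rm DE}_0(\mathcal L)$. Then there is a one-to-one correspondence between $\mathfrak g_0$-invariant solutions of ${\rm DE}_0(\mathcal L)$ and one-parametric families of solutions of $\mathcal L$ associated with $\mathfrak g$. Namely, the reduction of $\mathcal L$ by an operator $\partial_x+\eta\partial_u$, where $\eta$ is a $\mathfrak g_0$-invariant solution of ${\rm DE}_0(\mathcal L)$, gives a one-parametric family of solutions of $\mathcal L$ associated with $\mathfrak g$. Conversely, each family of this kind consists of solutions invariant with respect to an operator $\partial_x+\eta\partial_u$, where $\eta$ is a $\mathfrak g_0$-invariant solution of ${\rm DE}_0(\mathcal L)$.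
   Context: All considerations are local, near nonsingular points of the operators involved. ${\rm DE}_0(\mathcal L)$ is the equation for $\eta=\eta(t,x,u)$: $$\eta_t=A(\eta_{xx}+2\eta\eta_{xu}+\eta^2\eta_{uu})+A_x(\eta_x+\eta\eta_u)+(B\eta)_x+C(\eta-u\eta_u)+C_xu.$$ It is the condition that $\partial_x+\eta\partial_u$ is a reduction operator of $\mathcal L$. Reducing $\mathcal L$ by $\partial_x+\eta\partial_u$ means finding the solutions of $\mathcal L$ invariant with respect to this operator, i.e. those satisfying $u_x=\eta(t,x,u)$; they form a one-parametric family. Every Lie symmetry operator of $\mathcal L$ has the form $Q=\tau(t)\partial_t+\xi(t,x)\partial_x+(\zeta^1(t,x)u+\zeta^0(t,x))\partial_u$, and it induces the Lie symmetry operator $Q_0=Q+\bigl((\zeta^1-\xi_x)\eta+\zeta^1_xu+\zeta^0_x\bigr)\partial_\eta$ of ${\rm DE}_0(\mathcal L)$; $\mathfrak g_0=\{Q_0: Q\in\mathfrak g\}$. That $\mathfrak g_0$ is appropriate for Lie reduction means that it satisfies the usual transversality condition for reducing ${\rm DE}_0(\mathcal L)$ to an ordinary differential equation: for basis operators of $\mathfrak g_0$, the $2\times3$ matrix of coefficients of $\partial_t,\partial_x,\partial_u$ and the $2\times 4$ matrix of coefficients of $\partial_t,\partial_x,\partial_u,\partial_\eta$ both have rank $2$. A one-parametric family of solutions is a family $u=f(t,x,\varkappa)$ of solutions of $\mathcal L$ with $f_\varkappa\ne0$; families differing only by a reparameterization of $\varkappa$ are identified. One-parametric solution families of $\mathcal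 L$ associated with $\mathfrak g$ are, by definition, of two kinds: singular ones, consisting of $\mathfrak g$-invariant solutions of $\mathcal L$; and regular ones, each obtained by acting on a fixed $Q^1$-invariant and non-$Q^2$-invariant solution of $\mathcal L$ by the one-parametric transformation group generated by $Q^2$, where $Q^1,Q^2$ are arbitrary linearly independent elements of $\mathfrak g$. *)

(* Defs.v *)
(* MathComp-Analysis.  A point of the (t, x)-plane is a pair [q : R * R], a point
   of (t, x, u)-space is [p : R * R * R] with [p.1] = (t, x) and [p.2] = u.
   Everything is local: functions are total, but only their germs at a base point
   matter, and "near" refers to some neighbourhood of that point. *)
From HB Require Import structures.
From mathcomp Require Import all_boot all_order all_algebra.
From mathcomp Require Import all_classical all_reals all_analysis.

Set Implicit Arguments.
Unset Strict Implicit.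
Unset Printing Implicit Defensive.

Import Order.TTheory GRing.Theory Num.Theory.
Import numFieldNormedType.Exports.

Local Open Scope classical_set_scope.
Local Open Scope ring_scope.

Section Regularity.
Context {R : realType}.

Fixpoint class_C {V : normedModType R} (n : nat) (U : set V) (f : V -> R)
    : Prop :=
  match n with
  | 0%N => forall p, U p -> {for p, continuous f}
  | m.+1 => (forall p, U p -> differentiable f p) /\
            (forall v : V, class_C m U ('D_v f))
  end.

Definition smooth_near {V : normedModType R} (f : V -> R) (p : V) : Prop :=
  exists2 U : set V, open_nbhs p U & forall n, class_C n U f.

Definition has_power_series (F : R * R -> R) (q : R * R) : Prop :=
  exists (a : nat -> nat -> R) (r M : R),
    [/\ 0 < r,
        (forall n, \sum_(i < n) \sum_(j < n) `|a i j| * r ^+ (i + j) <= M) &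
        (forall h : R * R, `|h| < r ->
          (fun n : nat => \sum_(i < n) \sum_(j < n)
                            a i j * h.1 ^+ i * h.2 ^+ j) @ \oo --> F (q + h))].

(* Smoothness follows from the power series expansions; it is listed because
   analyticity is commonly stated as a strengthening of smoothness. *)
Definition analytic_near (F : R * R -> R) (q0 : R * R) : Prop :=
  smooth_near F q0 /\ \forall q \near q0, has_power_series F q.

Definition pt (F : R * R -> R) : R * R -> R := 'D_((1, 0) : R * R) F.
Definition px (F : R * R -> R) : R * R -> R := 'D_((0, 1) : R * R) F.

(* [dt], [dx], [du]: partial derivatives of a function of (t, x, u), or of
   (t, x, kappa) for a family of functions of (t, x). *)
Definition dt (F : R * R * R -> R) : R * R * R -> R :=
  'D_((1, 0, 0) : R * R * R) F.
Definition dx (F : R * R * R -> R) : R * R * R -> R :=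
  'D_((0, 1, 0) : R * R * R) F.
Definition du (F : R * R * R -> R) : R * R * R -> R :=
  'D_((0, 0, 1) : R * R * R) F.

Definition rows_mx m n (s : seq (seq R)) : 'M[R]_(m, n) :=
  \matrix_(i < m, j < n) (nth [::] s i)`_j.

End Regularity.

(* u_t = A u_xx + B u_x + C u *)
Record evolution_eq (R : realType) := EvolutionEq {
  Acoef : R * R -> R;
  Bcoef : R * R -> R;
  Ccoef : R * R -> R }.

Definition solves_at (R : realType) (L : evolution_eq R) (v : R * R -> R)
    (q : R * R) : Prop :=
  pt v q = Acoef L q * px (px v) q + Bcoef L q * px v q + Ccoef L q * v q.

Definition solution_near (R : realType) (L : evolution_eq R) (q0 : R * R)
    (v : R * R -> R) : Prop :=
  smooth_near v q0 /\ \forall q \near q0, solves_at L v q.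

(* tau(t) d_t + xi(t,x) d_x + (zeta1(t,x) u + zeta0(t,x)) d_u *)
Record operator (R : realType) := Operator {
  tau : R -> R;
  xi : R * R -> R;
  zeta1 : R * R -> R;
  zeta0 : R * R -> R }.

Section Operators.
Context {R : realType}.
Implicit Types (L : evolution_eq R) (P Q : operator R) (g : set (operator R)).

Definition op_u Q (p : R * R * R) : R := zeta1 Q p.1 * p.2 + zeta0 Q p.1.

Definition vector_at Q (p : R * R * R) : R * R * R :=
  (tau Q p.1.1, xi Q p.1, op_u Q p).

Definition smooth_op (q0 : R * R) Q : Prop :=
  [/\ smooth_near (tau Q) q0.1, smooth_near (xi Q) q0,
      smooth_near (zeta1 Q) q0 & smooth_near (zeta0 Q) q0].

Definition op_eq_near (q0 : R * R) P Q : Prop :=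
  \forall q \near q0, [/\ tau P q.1 = tau Q q.1, xi P q = xi Q q,
                          zeta1 P q = zeta1 Q q & zeta0 P q = zeta0 Q q].

Definition op_zero : operator R :=
  Operator (fun=> 0) (fun=> 0) (fun=> 0) (fun=> 0).

Definition lincomb (a : R) P (b : R) Q : operator R :=
  Operator (fun t => a * tau P t + b * tau Q t)
           (fun q => a * xi P q + b * xi Q q)
           (fun q => a * zeta1 P q + b * zeta1 Q q)
           (fun q => a * zeta0 P q + b * zeta0 Q q).

(* The action of tau d_t + xi d_x on functions of (t, x). *)
Definition op_act Q (F : R * R -> R) (q : R * R) : R :=
  tau Q q.1 * pt F q + xi Q q * px F q.

Definition bracket P Q : operator R :=
  Operator
    (fun t => tau P t * derive1 (tau Q) t - tau Q t * derive1 (tau P) t)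
    (fun q => op_act P (xi Q) q - op_act Q (xi P) q)
    (fun q => op_act P (zeta1 Q) q - op_act Q (zeta1 P) q)
    (fun q => op_act P (zeta0 Q) q + zeta0 P q * zeta1 Q q
              - (op_act Q (zeta0 P) q + zeta0 Q q * zeta1 P q)).

Definition independent (q0 : R * R) P Q : Prop :=
  forall a b : R, op_eq_near q0 (lincomb a P b Q) op_zero -> a = 0 /\ b = 0.

Definition op_basis (q0 : R * R) g P Q : Prop :=
  independent q0 P Q /\
  g = [set S | exists a b : R, op_eq_near q0 S (lincomb a P b Q)].

Definition lie_algebra2 (q0 : R * R) g : Prop :=
  (exists P Q, op_basis q0 g P Q) /\
  (forall P Q, g P -> g Q -> g (bracket P Q)).

(* Coefficients of d_{u_t}, d_{u_x}, d_{u_xx} in the second prolongation of Q,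
   as functions of the jet coordinates; for instance
   pr_x = D_x (zeta1 u + zeta0) - u_t D_x tau - u_x D_x xi, where D_x tau = 0. *)
Definition pr_t Q (q : R * R) (u ux ut : R) : R :=
  pt (zeta1 Q) q * u + pt (zeta0 Q) q
  + (zeta1 Q q - derive1 (tau Q) q.1) * ut - pt (xi Q) q * ux.

Definition pr_x Q (q : R * R) (u ux : R) : R :=
  px (zeta1 Q) q * u + px (zeta0 Q) q + (zeta1 Q q - px (xi Q) q) * ux.

Definition pr_xx Q (q : R * R) (u ux uxx : R) : R :=
  px (px (zeta1 Q)) q * u + px (px (zeta0 Q)) q
  + (2 * px (zeta1 Q) q - px (px (xi Q)) q) * ux
  + (zeta1 Q q - 2 * px (xi Q) q) * uxx.

(* Infinitesimal invariance criterion: the second prolongation of Q annihilates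
   u_t - (A u_xx + B u_x + C u) wherever this expression vanishes. *)
Definition lie_symmetry L (q0 : R * R) Q : Prop :=
  \forall q \near q0, forall u ux uxx ut : R,
    ut = Acoef L q * uxx + Bcoef L q * ux + Ccoef L q * u ->
    pr_t Q q u ux ut
    = op_act Q (Acoef L) q * uxx + Acoef L q * pr_xx Q q u ux uxx
      + op_act Q (Bcoef L) q * ux + Bcoef L q * pr_x Q q u ux
      + op_act Q (Ccoef L) q * u + Ccoef L q * op_u Q (q, u).

Definition lie_invariance_algebra2 L (q0 : R * R) g : Prop :=
  lie_algebra2 q0 g /\
  (forall Q, g Q -> smooth_op q0 Q /\ lie_symmetry L q0 Q).

End Operators.

(* First-order operators on (t, x, u, eta)-space. *)
Record operator0 (R : realType) := Operator0 {
  c_t : R * R * R -> R -> R;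
  c_x : R * R * R -> R -> R;
  c_u : R * R * R -> R -> R;
  c_eta : R * R * R -> R -> R }.

Section DeterminingEquation.
Context {R : realType}.
Implicit Types (L : evolution_eq R) (Q : operator R) (g : set (operator R)).
Implicit Types (eta : R * R * R -> R).

Definition induced_op Q : operator0 R :=
  Operator0 (fun p _ => tau Q p.1.1) (fun p _ => xi Q p.1)
            (fun p _ => op_u Q p)
            (fun p e => (zeta1 Q p.1 - px (xi Q) p.1) * e
                        + px (zeta1 Q) p.1 * p.2 + px (zeta0 Q) p.1).

Definition induced_algebra g : set (operator0 R) := induced_op @` g.

Definition coefs3 (P : operator0 R) (p : R * R * R) (e : R) : seq R :=
  [:: c_t P p e; c_x P p e; c_u P p e].

Definition coefs4 (P : operator0 R) (p : R * R * R) (e : R) : seq R :=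
  [:: c_t P p e; c_x P p e; c_u P p e; c_eta P p e].

(* The second rank condition follows from the first one, so that the value [e]
   of eta is immaterial. *)
Definition appropriate_for_reduction g (p0 : R * R * R) : Prop :=
  forall Q1 Q2, op_basis p0.1 g Q1 Q2 -> forall e : R,
    let P1 := induced_op Q1 in let P2 := induced_op Q2 in
    \rank (rows_mx 2 3 [:: coefs3 P1 p0 e; coefs3 P2 p0 e]) = 2%N /\
    \rank (rows_mx 2 4 [:: coefs4 P1 p0 e; coefs4 P2 p0 e]) = 2%N.

Definition DE0_at L eta (p : R * R * R) : Prop :=
  let A := Acoef L p.1 in let C := Ccoef L p.1 in
  dt eta p
  = A * (dx (dx eta) p + 2 * eta p * du (dx eta) p
         + eta p ^+ 2 * du (du eta) p)
    + px (Acoef L) p.1 * (dx eta p + eta p * du eta p)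
    + dx (fun p' => Bcoef L p'.1 * eta p') p
    + C * (eta p - p.2 * du eta p) + px (Ccoef L) p.1 * p.2.

Definition invariant0_near (p0 : R * R * R) (P : operator0 R) eta : Prop :=
  \forall p \near p0,
    c_t P p (eta p) * dt eta p + c_x P p (eta p) * dx eta p
    + c_u P p (eta p) * du eta p = c_eta P p (eta p).

Definition invariant_solution_DE0 L g (p0 : R * R * R) eta : Prop :=
  [/\ smooth_near eta p0, \forall p \near p0, DE0_at L eta p &
      forall P, induced_algebra g P -> invariant0_near p0 P eta].

(* On solutions with u_x = eta, equation L gives
   u_t = A (eta_x + eta eta_u) + B eta + C u. *)
Definition ut_of L eta (p : R * R * R) : R :=
  Acoef L p.1 * (dx eta p + eta p * du eta p) + Bcoef L p.1 * eta p
  + Ccoef L p.1 * p.2.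

(* A point is nonsingular for a system of operators if the rank of the system is
   locally constant there.  The system consists of the operators of g and of
   d_x + eta d_u, d_t + ut_of d_u, the fields tangent to the graphs of the
   solutions with u_x = eta.  Such points form an open dense set.  At the other
   points no correspondence holds: for u_t = u_xx, g = <d_t, d_x>, eta = u, at
   u = 0, the family kappa exp(t + x), kappa near 0, has exactly one g-invariant
   member. *)
Definition nonsingular L g (p0 : R * R * R) eta : Prop :=
  forall Q1 Q2, op_basis p0.1 g Q1 Q2 ->
    let M p := rows_mx 4 3
      [:: coefs3 (induced_op Q1) p (eta p); coefs3 (induced_op Q2) p (eta p);
          [:: 0; 1; eta p]; [:: 1; 0; ut_of L eta p]] in
    \forall p \near p0, \rank (M p) = \rank (M p0).

End DeterminingEquation.

Section Families.
Context {R : realType}.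
Implicit Types (L : evolution_eq R) (Q : operator R) (g : set (operator R)).
Implicit Types (eta f : R * R * R -> R) (v : R * R -> R).

Definition invariant_at Q v (q : R * R) : Prop :=
  tau Q q.1 * pt v q + xi Q q * px v q = zeta1 Q q * v q + zeta0 Q q.

Definition invariant_near (q0 : R * R) Q v : Prop :=
  \forall q \near q0, invariant_at Q v q.

(* One-parametric families u = f (t, x, kappa), with (t, x) near q0 and kappa
   near k0. *)
Definition solution_family L (q0 : R * R) (k0 : R) f : Prop :=
  [/\ smooth_near f (q0, k0),
      \forall z \near (q0, k0), solves_at L (fun q => f (q, z.2)) z.1 &
      \forall z \near (q0, k0), du f z != 0].

Definition reparameterization (q0 : R * R) (k : R) f (k' : R) f' : Prop :=
  exists theta : R -> R,
    [/\ smooth_near theta k', theta k' = k, derive1 theta k' != 0 &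
        \forall z \near (q0, k'), f' z = f (z.1, theta z.2)].

Definition local_flow Q (p0 : R * R * R) (Psi : R -> R * R * R -> R * R * R)
    : Prop :=
  (\forall p \near p0, Psi 0 p = p) /\
  (\forall z \near ((0 : R), p0),
     is_derive z.1 (1 : R) (fun s => Psi s z.2) (vector_at Q (Psi z.1 z.2))).

(* The graph of f (., ., s) is the image of the graph of v under the
   transformation with group parameter s. *)
Definition group_orbit Q (q0 : R * R) v f : Prop :=
  exists Psi, local_flow Q (q0, v q0) Psi /\
    \forall z \near ((0 : R), q0),
      let p := Psi z.1 (z.2, v z.2) in f (p.1, z.1) = p.2.

Definition singular_family g (q0 : R * R) (k0 : R) f : Prop :=
  forall Q, g Q ->
    \forall z \near (q0, k0), invariant_at Q (fun q => f (q, z.2)) z.1.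

Definition regular_family L g (q0 : R * R) (k0 : R) f : Prop :=
  exists Q1 Q2, [/\ g Q1, g Q2, independent q0 Q1 Q2 &
    exists v f',
      [/\ solution_near L q0 v, invariant_near q0 Q1 v,
          ~ invariant_near q0 Q2 v, group_orbit Q2 q0 v f' &
          reparameterization q0 k0 f 0 f']].

Definition associated_family L g (q0 : R * R) (k0 : R) f : Prop :=
  solution_family L q0 k0 f /\
  (singular_family g q0 k0 f \/ regular_family L g q0 k0 f).

(* All members of the family are invariant with respect to d_x + eta d_u. *)
Definition family_invariant (q0 : R * R) (k0 : R) eta f : Prop :=
  \forall z \near (q0, k0), dx f z = eta (z.1, f z).

(* The reduction of L by d_x + eta d_u: the family consists of precisely the
   solutions with u_x = eta. *)
Definition reduction_family L (q0 : R * R) (k0 : R) eta f : Prop :=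
  [/\ solution_family L q0 k0 f, family_invariant q0 k0 eta f &
      forall K : set R, nbhs k0 K ->
        \forall y \near f (q0, k0), forall v,
          solution_near L q0 v ->
          (\forall q \near q0, px v q = eta (q, v q)) -> v q0 = y ->
          exists2 k, K k & \forall q \near q0, v q = f (q, k)].

End Families.

(* Main.v *)
Require Import Defs.
From HB Require Import structures.
From mathcomp Require Import all_boot all_order all_algebra.
From mathcomp Require Import all_classical all_reals all_analysis.
From mathcomp Require Import ring lra.

Set Implicit Arguments.
Unset Strict Implicit.
Unset Printing Implicit Defensive.

Import Order.TTheory GRing.Theory Num.Theory.
Import numFieldNormedType.Exports.

Local Open Scope classical_set_scope.
Local Open Scope ring_scope.

(* Write [H = ut_of L eta].  Expanding the determining equation shows that it is
   the compatibility condition of [f_t = H (t, x, f)], [f_x = eta (t, x, f)], so a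
   solution eta amounts to a foliation of (t, x, u)-space by graphs of solutions of
   L, and a one-parametric family of solutions determines eta by [f_x = eta] after
   solving [f = u] for the parameter.

   For an operator Q let [W = op_u - tau f_t - xi f_x] be its characteristic on the
   family f.  Then eta is invariant under the operator induced by Q exactly when
   [W_x = eta_u W].  If Q is a symmetry of L, then W solves L again, which gives
   [W_t = H_u W]; as [f_kappa] satisfies the same two equations, [W = c(kappa) f_kappa].
   For a basis P1, P2 of g with functions c1, c2, the rank condition says that c1, c2
   both vanish near the base value of kappa (all members are g-invariant), or one of
   them, say c1, does not vanish there.  In the latter case [Q1 = c2 P1 - c1 P2]
   leaves the central member invariant, and after the change of parameter
   [theta' = c1(theta)] the flow of [Q2 = P1] permutes the members.

   Conversely, on the orbit of a Q1-invariant solution under the flow of Q2 one has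
   [W2 = f_s].  If [[Q1, Q2] = a Q1 + b Q2], then [r = W1 / f_s] satisfies
   [r' = - a r - b] along the flow of [tau2 d_t + xi2 d_x + d_s], and it vanishes at
   [s = 0]; hence r depends on s alone, and [W_x = eta_u W] holds for W1 and W2. *)

(** * Calculus of smooth functions *)

(** Each surface [u = f (t, x, kappa)] is built by solving a scalar equation along the segments from
    the base point. Compatibility is spent on differentiability in all variables: it makes an
    explicit trial variation solve the displaced equation up to [o(|v|)]. Higher smoothness is a
    bootstrap, because the first derivatives of [f], including [f_kappa], are expressed through [f]
    itself; the implicit function and [theta] become smooth in the same way.

    A local flow is only required to be differentiable in the group parameter; its dependence on the
    point has to be recovered. A speed bound confines the curves, and integral curves are unique
    coordinate by coordinate, since [tau] depends on [t] alone and [xi] on [(t, x)] alone. So the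
    projected motion in the plane ignores [u], and flowing backwards shows that the moved graphs
    still cover a neighbourhood.

    Leaves are labelled by their value at [q0]. Two families with the same eta are then compared
    through values at [q0] only, which yields both the completeness of the reduction and the
    uniqueness up to reparameterization. *)

Section Differentials.
Context {R : realType}.
Implicit Types V W : normedModType R.

Lemma differentiable_epsilon V W (f : V -> W) (x : V) (e : R) :
  differentiable f x -> 0 < e ->
  \forall h \near 0, `|f (h + x) - f x - 'D_h f x| <= e * `|h|.
Proof.
move=> df e0; have /eqaddoP/(_ e e0) := diff_locally df.
apply: filterS => h /=; rewrite deriveE//.
by rewrite !fctE /= opprD addrA.
Qed.

(** The route to differentiability for functions that are not given by a formula: solutions of
    equations, implicit functions and integrals with a parameter all get a guessed differential and
    an estimate. *)
Lemma epsilon_differentiable V W (f : V -> W) (x : V) (df : {linear V -> W}) :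
  continuous df ->
  (forall e : R, 0 < e -> \forall h \near 0, `|f (h + x) - f x - df h| <= e * `|h|) ->
  differentiable f x /\ forall v, 'D_v f x = df v.
Proof.
move=> cdf h.
have E : f \o shift x = cst (f x) + df +o_ 0 id.
  apply/eqaddoP => e e0; near=> k; rewrite !fctE /= opprD addrA.
  by near: k; exact: h.
have dE := diff_unique cdf E.
have df' : differentiable f x by apply/diff_locallyP; rewrite dE; split.
by split => // v; rewrite deriveE// dE.
Unshelve. all: by end_near. Qed.

Lemma near_eq_differentiable V W (f g : V -> W) p :
  (\near p, f p = g p) -> differentiable f p -> differentiable g p.
Proof.
move=> fg df; have [] // := @epsilon_differentiable _ _ g p ('d f p).
  exact: diff_continuous.
move=> e e0; have := differentiable_epsilon df e0.
have /nbhs0P := fg; apply: filterS2 => h gE.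
by rewrite deriveE// (nbhs_singleton fg) [h + p]addrC gE.
Qed.

Lemma deriveDv V W (f : V -> W) p v w : differentiable f p ->
  'D_(v + w) f p = 'D_v f p + 'D_w f p.
Proof. by move=> df; rewrite !deriveE// linearD. Qed.

Lemma deriveZv V W (f : V -> W) p a v : differentiable f p ->
  'D_(a *: v) f p = a *: 'D_v f p.
Proof. by move=> df; rewrite !deriveE// linearZ. Qed.

Lemma derive_comp V W (F : W -> R) (G : V -> W) p v :
  differentiable G p -> differentiable F (G p) ->
  'D_v (F \o G) p = 'D_('D_v G p) F (G p).
Proof.
move=> dG dF; rewrite !deriveE//; last exact: differentiable_comp.
by rewrite diff_comp.
Qed.

Lemma is_derive_curve V (f : V -> R) (c : R -> V) (t : R) (c' : V) :
  is_derive t 1 c c' -> differentiable f (c t) ->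
  is_derive t 1 (f \o c) ('D_c' f (c t)).
Proof.
move=> [dc c'E] df; have dct : differentiable c t by apply/derivable1_diffP.
split; last by rewrite derive_comp// c'E.
by apply: diff_derivable; exact: differentiable_comp.
Qed.

Lemma is_derive_line V (x v : V) (t : R) :
  is_derive t 1 (fun s : R => x + s *: v) v.
Proof.
have dl : is_diff t (fun s : R => s *: v) (fun s : R => s *: v).
  exact: is_diff_scalel.
have dif : differentiable (fun s : R => x + s *: v) t.
  by apply: differentiableD.
split; first exact: diff_derivable.
rewrite deriveE// diffD// diff_cst diff_val /=.
by rewrite [LHS]add0r scale1r.
Qed.

Lemma MVT_line V (f : V -> R) (x v : V) :
  (forall t : R, 0 <= t <= 1 -> differentiable f (x + t *: v)) ->
  exists2 t : R, 0 <= t <= 1 & f (x + v) - f x = 'D_v f (x + t *: v).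
Proof.
move=> df.
have dl (t : R) : 0 <= t <= 1 ->
    is_derive t 1 (f \o (fun s : R => x + s *: v)) ('D_v f (x + t *: v)).
  by move=> t01; apply: is_derive_curve; [exact: is_derive_line|exact: df].
have [|||c c01 cE] := @MVT R (f \o (fun s : R => x + s *: v))
    (fun t => 'D_v f (x + t *: v)) 0 1 _ _ _.
- exact: ltr01.
- by move=> t; rewrite in_itv /= => /andP[/ltW t0 /ltW t1]; apply: dl; rewrite t0.
- apply: derivable_within_continuous => t; rewrite in_itv /= => t01.
  by have [] := dl t t01.
exists c; first by move: c01; rewrite in_itv /= => /andP[/ltW -> /ltW].
by move: cE; rewrite /= scale1r scale0r addr0 subr0 mulr1.
Qed.

End Differentials.

Lemma triple_basis (R : realType) (a b c : R) : ((a, b, c) : R * R * R) =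
  a *: ((1, 0, 0) : R * R * R) + b *: ((0, 1, 0) : R * R * R)
  + c *: ((0, 0, 1) : R * R * R).
Proof.
rewrite [RHS]surjective_pairing [X in (X, _)]surjective_pairing /=.
by congr (_, _, _); rewrite /= /GRing.scale /= !mulr0 mulr1 ?addr0 ?add0r.
Qed.

(** * Closure properties of the classes C^n *)

Section ClassC.
Context {R : realType}.
Implicit Types V W : normedModType R.

Lemma class_CS V n (U : set V) (f : V -> R) :
  class_C n.+1 U f -> class_C n U f.
Proof.
elim: n f => [|n IH] f /= [df Df].
  by move=> p /df; exact: differentiable_continuous.
by split => // v; exact: IH.
Qed.

Lemma class_C_continuous V n (U : set V) (f : V -> R) :
  class_C n U f -> forall p, U p -> {for p, continuous f}.
Proof. by elim: n => // n IH /class_CS. Qed.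

Lemma class_C_subset V n (U U' : set V) (f : V -> R) :
  U `<=` U' -> class_C n U' f -> class_C n U f.
Proof.
move=> UU'; elim: n f => [|n IH] f /=; first by move=> h p /UU'; exact: h.
by move=> [df Df]; split=> [p /UU'/df//|v]; exact: IH.
Qed.

Lemma eq_class_C V n (U : set V) (f g : V -> R) :
  open U -> (forall p, U p -> f p = g p) -> class_C n U f -> class_C n U g.
Proof.
move=> oU; elim: n f g => [|n IH] f g /= fg.
  move=> cf p Up; apply: cvg_trans (_ : f @ p --> g p); last first.
    by rewrite -fg//; exact: cf.
  by apply: near_eq_cvg; near do apply: fg; exact: open_nbhs_nbhs.
have nfg p : U p -> \near p, f p = g p.
  by move=> Up; apply: filterS fg _; exact: open_nbhs_nbhs.
move=> [df Df]; split => [p Up|v].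
  by apply: near_eq_differentiable (df p Up); exact: nfg.
apply: IH (Df v) => p Up; exact: near_eq_derive (nfg p Up).
Unshelve. all: by end_near. Qed.

Lemma class_C_cst V n (U : set V) (a : R) : class_C n U (fun=> a).
Proof.
elim: n a => [|n IH] a /=; first by move=> p _; exact: cvg_cst.
split=> [p _|v]; first exact: differentiable_cst.
by rewrite (_ : 'D_v _ = fun=> 0)//; apply/funext => p; rewrite derive_cst.
Qed.

Lemma class_CD V n (U : set V) (f g : V -> R) :
  open U -> class_C n U f -> class_C n U g -> class_C n U (f + g).
Proof.
move=> oU; elim: n f g => [|n IH] f g /=.
  by move=> cf cg p Up; apply: continuousD; [exact: cf|exact: cg].
move=> [df Df] [dg Dg]; split=> [p Up|v].
  by apply: differentiableD; [exact: df|exact: dg].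
apply: eq_class_C (IH _ _ (Df v) (Dg v)) => // p Up.
by rewrite deriveD//; apply: diff_derivable; [exact: df|exact: dg].
Qed.

Lemma class_CN V n (U : set V) (f : V -> R) :
  open U -> class_C n U f -> class_C n U (- f).
Proof.
move=> oU; elim: n f => [|n IH] f /=.
  by move=> cf p Up; apply: continuousN; exact: cf.
move=> [df Df]; split=> [p Up|v].
  by apply: differentiableN; exact: df.
apply: eq_class_C (IH _ (Df v)) => // p Up.
by rewrite deriveN//; apply: diff_derivable; exact: df.
Qed.

Lemma class_CM V n (U : set V) (f g : V -> R) :
  open U -> class_C n U f -> class_C n U g -> class_C n U (f * g).
Proof.
move=> oU; elim: n f g => [|n IH] f g.
  by move=> cf cg p Up; apply: continuousM; [exact: cf|exact: cg].
move=> Cf Cg; move: (Cf) (Cg) => [df Df] [dg Dg]; split=> [p Up|v].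
  by apply: differentiableM; [exact: df|exact: dg].
apply: eq_class_C (class_CD oU (IH _ _ (class_CS Cf) (Dg v))
  (IH _ _ (class_CS Cg) (Df v))) => // p Up.
by rewrite deriveM//; apply: diff_derivable; [exact: df|exact: dg].
Qed.

Lemma class_CV V n (U : set V) (f : V -> R) : open U ->
  (forall p, U p -> f p != 0) -> class_C n U f -> class_C n U (fun p => (f p)^-1).
Proof.
move=> oU; elim: n f => [|n IH] f f0.
  by move=> cf p Up; apply: cvgV; [exact: f0|exact: cf].
move=> Cf; move: (Cf) => [df Df]; split=> [p Up|v].
  by apply: differentiableV; [exact: df|exact: f0].
have CV := IH _ f0 (class_CS Cf).
apply: eq_class_C (class_CN oU (class_CM oU (class_CM oU CV CV) (Df v))) => //.
move=> p Up; rewrite deriveV//; [|exact: f0|by apply: diff_derivable; exact: df].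
by rewrite !fctE -exprVn expr2 scaleNr.
Qed.

(** The differential [l] of [G] is the same at all points, so the derivative of [F \o G] along [v]
    is ['D_(l v) F \o G], again of the same shape; this is what the induction needs. *)
Lemma class_C_affine V W n (U : set V) (U' : set W) (F : W -> R)
    (G : V -> W) (l : V -> W) : (forall p, is_diff p G l) ->
  (forall p, U p -> U' (G p)) -> open U ->
  class_C n U' F -> class_C n U (F \o G).
Proof.
move=> dG UU' oU; have dG' p : differentiable G p by have [] := dG p.
elim: n F => [|n IH] F /=.
  move=> cF p Up; have cF' : {for G p, continuous F} by apply: cF; exact: UU'.
  have cG : {for p, continuous G} by exact: differentiable_continuous.
  exact: (continuous_comp cG cF').
move=> [dF DF]; split=> [p Up|v].
  by apply: differentiable_comp => //; apply: dF; exact: UU'.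
apply: eq_class_C (IH _ (DF (l v))) => // p Up.
have E : 'D_v G p = l v by rewrite deriveE// diff_val.
by rewrite (@derive_comp _ _ _ F G)//; [rewrite E|apply: dF; exact: UU'].
Qed.

(** [class_C] concerns scalar functions, so the inner map is given by its three components. By the
    chain rule a derivative of the composite is a sum of products of derivatives of [a], [b], [c]
    with composites of the same form, to which the induction hypothesis applies. *)
Lemma class_C_triple V n (U : set V) (U' : set (R * R * R)) (F : R * R * R -> R)
    (a b c : V -> R) : open U ->
  (forall p, U p -> U' (a p, b p, c p)) ->
  class_C n U a -> class_C n U b -> class_C n U c -> class_C n U' F ->
  class_C n U (fun p => F (a p, b p, c p)).
Proof.
move=> oU UU'; elim: n F => [|n IH] F /=.
  move=> ca cb cc cF p Up.
  have cF' : {for (a p, b p, c p), continuous F} by apply: cF; exact: UU'.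
  have cG : {for p, continuous (fun p => (a p, b p, c p))}.
    exact: (cvg_pair (cvg_pair (ca p Up) (cb p Up)) (cc p Up)).
  exact: (continuous_comp cG cF').
move=> Ca Cb Cc CF; move: (Ca) (Cb) (Cc) (CF) => [da Da] [db Db] [dc Dc] [dF DF].
have dG p : U p -> is_diff p (fun p => (a p, b p, c p))
    (fun v => ('D_v a p, 'D_v b p, 'D_v c p)).
  move=> Up; have dab : is_diff p (fun p => (a p, b p)) (fun v => ('D_v a p, 'D_v b p)).
    apply: DiffDef; first by apply: differentiable_pair; [exact: da|exact: db].
    rewrite diff_pair; [|exact: da|exact: db].
    by apply/funext => v; rewrite !deriveE//; [exact: db|exact: da].
  apply: DiffDef.
    by apply: (@differentiable_pair _ _ _ _ (fun p => (a p, b p)) c) => //; exact: dc.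
  rewrite (@diff_pair _ _ _ _ (fun p => (a p, b p)) c)//; last exact: dc.
  by apply/funext => v; rewrite diff_val (deriveE _ (dc _ Up)).
split=> [p Up|v].
  apply: (@differentiable_comp _ _ _ _ (fun q => (a q, b q, c q)) F).
    by have [] := dG p Up.
  by apply: dF; exact: UU'.
have H e : class_C n U (fun p => 'D_e F (a p, b p, c p)).
  by apply: (IH ('D_e F)); [exact: class_CS|exact: class_CS|exact: class_CS|exact: DF].
apply: eq_class_C (class_CD oU (class_CD oU (class_CM oU (Da v) (H (1, 0, 0)))
  (class_CM oU (Db v) (H (0, 1, 0)))) (class_CM oU (Dc v) (H (0, 0, 1)))) => // p Up.
have dFp : differentiable F (a p, b p, c p) by apply: dF; exact: UU'.
have := dG p Up; case=> dGp dGE.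
have E : 'D_v (fun p => (a p, b p, c p)) p = ('D_v a p, 'D_v b p, 'D_v c p).
  by rewrite deriveE// dGE.
rewrite (@derive_comp _ _ _ F (fun p => (a p, b p, c p)))// E.
by rewrite (triple_basis ('D_v a p)) !deriveDv// !deriveZv.
Qed.

End ClassC.

Section Nbhs.
Context {R : realType}.
Implicit Types V W : normedModType R.

Lemma nbhs_normlP V (p : V) (P : V -> Prop) :
  (\forall x \near p, P x) <->
  exists2 r : R, 0 < r & forall x, `|x - p| < r -> P x.
Proof.
split=> [/nbhs_normP[r r0 rP]|[r r0 rP]].
  by exists r => // x xp; apply: rP; rewrite /ball_/= distrC.
by apply/nbhs_normP; exists r => // x /=; rewrite /ball_/= distrC; exact: rP.
Qed.

Lemma open_normlP V (U : set V) (p : V) : open U -> U p ->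
  exists2 r : R, 0 < r & forall x, `|x - p| < r -> U x.
Proof. by move=> oU Up; apply/nbhs_normlP; exact: open_nbhs_nbhs. Qed.

Lemma normr_pairE V W (a : V) (b : W) : `|(a, b)| = Num.max `|a| `|b|.
Proof. by rewrite prod_normE. Qed.

Lemma normr_pair_lt V W (a : V) (b : W) (r : R) :
  (`|(a, b)| < r) = (`|a| < r) && (`|b| < r).
Proof. by rewrite normr_pairE gt_max. Qed.

Lemma normr_pair_le V W (a : V) (b : W) (r : R) :
  (`|(a, b)| <= r) = (`|a| <= r) && (`|b| <= r).
Proof. by rewrite normr_pairE ge_max. Qed.

Lemma ler_norm_fst V W (z : V * W) : `|z.1| <= `|z|.
Proof. by case: z => a b; rewrite normr_pairE le_max lexx. Qed.

Lemma ler_norm_snd V W (z : V * W) : `|z.2| <= `|z|.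
Proof. by case: z => a b; rewrite normr_pairE le_max lexx orbT. Qed.

Lemma open_norm_lt V (p : V) (r : R) : open [set x | `|x - p| < r].
Proof.
rewrite (_ : [set x | _] = ball_ Num.norm p r); last first.
  by apply/seteqP; split => x; rewrite /ball_/= distrC.
rewrite ball_normE; exact: ball_open.
Qed.

End Nbhs.

Lemma ler_dist_half (R : realFieldType) (x y z e : R) :
  `|x - y| < e / 2 -> `|z - y| < e / 2 -> `|x - z| <= e.
Proof.
rewrite !ltr_norml ler_norml => /andP[? ?] /andP[? ?].
by apply/andP; split; lra.
Qed.

(** * Symmetry of second derivatives *)

Section Schwarz.
Context {R : realType} {V : normedModType R}.
Implicit Types (U : set V) (f : V -> R).

Lemma is_derive_addr (p v w : V) : is_derive p v (fun x => x + w) v.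
Proof.
have -> : (fun x => x + w) = id + cst w by [].
exact: is_derive_eq (is_deriveD (is_derive_id p v) (is_derive_cst w p v)) (addr0 v).
Qed.

Lemma derive_addr f (p v w : V) : differentiable f (p + w) ->
  is_derive p v (fun x => f (x + w)) ('D_v f (p + w)).
Proof.
move=> df.
have dw : differentiable (fun x : V => x + w) p by apply: differentiableD.
split.
  apply: diff_derivable.
  by apply: (@differentiable_comp _ _ _ _ (fun x => x + w) f).
rewrite (@derive_comp _ _ _ f (fun x => x + w))//.
by have [_ ->] := is_derive_addr p v w.
Qed.

(** The mean value theorem is used twice: along [v] for [x |-> f (x + w) - f x], then along [w] for
    ['D_v f]. *)
Lemma second_difference U f (p v w : V) : class_C 2 U f ->
  (forall s t : R, 0 <= s <= 1 -> 0 <= t <= 1 -> U (p + s *: v + t *: w)) ->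
  exists s t : R, [/\ 0 <= s <= 1, 0 <= t <= 1 &
    f (p + v + w) - f (p + v) - (f (p + w) - f p) =
    'D_w ('D_v f) (p + s *: v + t *: w)].
Proof.
move=> [df Df] Upvw.
have U0 (s : R) : 0 <= s <= 1 -> U (p + s *: v).
  by move=> s01; have := Upvw s 0 s01; rewrite scale0r addr0 lexx ler01; exact.
have U1 (s : R) : 0 <= s <= 1 -> U (p + s *: v + w).
  by move=> s01; have := Upvw s 1 s01; rewrite scale1r lexx ler01; exact.
pose g x := f (x + w) - f x.
have dg (s : R) : 0 <= s <= 1 -> differentiable g (p + s *: v).
  move=> s01; apply: differentiableB; last exact/df/U0.
  apply: (@differentiable_comp _ _ _ _ (fun x => x + w) f).
    by apply: differentiableD.
  exact/df/U1.
have Dg (s : R) : 0 <= s <= 1 ->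
    'D_v g (p + s *: v) = 'D_v f (p + s *: v + w) - 'D_v f (p + s *: v).
  move=> s01; have [d1 E1] := derive_addr v (df _ (U1 s s01)).
  have d2 : derivable f (p + s *: v) v by apply: diff_derivable; exact/df/U0.
  by rewrite (deriveB d1 d2) E1.
have [s s01 sE] := MVT_line dg.
have [t t01 tE] : exists2 t : R, 0 <= t <= 1 &
    'D_v f (p + s *: v + w) - 'D_v f (p + s *: v)
      = 'D_w ('D_v f) (p + s *: v + t *: w).
  have [d _] := Df v.
  by have := @MVT_line _ _ ('D_v f) (p + s *: v) w (fun t t01 => d _ (Upvw s t s01 t01)).
by exists s, t; split => //; rewrite -tE -Dg// -sE.
Qed.

(** The second difference with increments [h v] and [h w] is symmetric in them. It equals [h * h]
    times either mixed derivative, each at its own intermediate point, and both points approach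
    [p]. *)
Lemma class_C_schwarz U f (p v w : V) : open U -> U p -> class_C 2 U f ->
  'D_w ('D_v f) p = 'D_v ('D_w f) p.
Proof.
move=> oU Up C2; have [df Df] := C2.
apply/eqP; rewrite -subr_eq0 -normr_le0; apply/ler_addgt0Pr => e e0.
rewrite add0r.
have cont (a b : V) : \forall x \near p,
    U x /\ `|'D_a ('D_b f) p - 'D_a ('D_b f) x| < e / 2.
  have [d D] := Df b; have c := D a p Up.
  have e2 : 0 < e / 2 by rewrite divr_gt0.
  have /(@cvgrPdist_lt _ _ _ (nbhs p)) /(_ _ e2) := c.
  by apply: filterS2 (open_nbhs_nbhs (conj oU Up)) => x.
have /nbhs_normlP[r1 r10 h1] := cont w v.
have /nbhs_normlP[r2 r20 h2] := cont v w.
pose r := Num.min r1 r2; have r0 : 0 < r by rewrite lt_min r10.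
(* With this [h] every point [p + s h v + t h w] of the unit parallelogram stays in the ball where
   both mixed derivatives vary by less than [e / 2]. *)
have [h h0 hr] : exists2 h : R, 0 < h & h * (`|v| + `|w|) < r.
  have d0 : 0 < `|v| + `|w| + 1 by rewrite ltr_wpDl// addr_ge0.
  exists (r / (`|v| + `|w| + 1)); first by rewrite divr_gt0.
  by rewrite -mulrA gtr_pMr// ltr_pdivrMl// mulr1 ltrDl.
have near_pt (s t : R) a b : [\/ a = v /\ b = w | a = w /\ b = v] ->
    0 <= s <= 1 -> 0 <= t <= 1 ->
    `|p + s *: (h *: a) + t *: (h *: b) - p| < r.
  move=> ab /andP[s0 s1] /andP[t0 t1]; rewrite addrAC [p + _]addrC addrK.
  have : `|s *: (h *: a) + t *: (h *: b)| <= h * (`|v| + `|w|).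
    rewrite (le_trans (ler_normD _ _))// !normrZ.
    rewrite (ger0_norm s0) (ger0_norm t0) (gtr0_norm h0).
    have sE x : s * (h * `|x : V|) <= h * `|x| by rewrite ler_piMl// mulr_ge0// ltW.
    have tE x : t * (h * `|x : V|) <= h * `|x| by rewrite ler_piMl// mulr_ge0// ltW.
    have E : h * (`|v| + `|w|) = h * `|a| + h * `|b|.
      by case: ab => -[-> ->]; rewrite mulrDr// addrC.
    by rewrite E lerD.
  by move=> /le_lt_trans; apply.
have dist1 (s t : R) : 0 <= s <= 1 -> 0 <= t <= 1 ->
    `|p + s *: (h *: v) + t *: (h *: w) - p| < r1 /\
    `|p + s *: (h *: w) + t *: (h *: v) - p| < r2.
  move=> s01 t01; split.
    by rewrite (lt_le_trans (near_pt s t v w _ _ _))//; [left|rewrite ge_min lexx].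
  by rewrite (lt_le_trans (near_pt s t w v _ _ _))//; [right|rewrite ge_min lexx orbT].
have scal (a b : V) q : U q ->
    'D_(h *: b) ('D_(h *: a) f) q = h * h * 'D_b ('D_a f) q.
  move=> Uq; have [d D] := Df a.
  have -> : 'D_(h *: b) ('D_(h *: a) f) q = 'D_(h *: b) (h *: 'D_a f) q.
    apply: near_eq_derive; apply: filterS (open_nbhs_nbhs (conj oU Uq)) => x Ux.
    by rewrite deriveZv//; exact: df.
  rewrite deriveZ; last by apply: diff_derivable; exact: d.
  by rewrite deriveZv; [rewrite /GRing.scale /= mulrA|exact: d].
have [|s [t [s01 t01 stE]]] := @second_difference U f p (h *: v) (h *: w) C2.
  by move=> s t s01 t01; have [/h1[]] := dist1 s t s01 t01.
have [|s' [t' [s01' t01' stE']]] := @second_difference U f p (h *: w) (h *: v) C2.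
  by move=> s' t' s01' t01'; have [_ /h2[]] := dist1 s' t' s01' t01'.
have [/h1[U1 H1] _] := dist1 s t s01 t01.
have [_ /h2[U2 H2]] := dist1 s' t' s01' t01'.
set a := p + s *: _ + _ in stE U1 H1; set b := p + s' *: _ + _ in stE' U2 H2.
have ab : 'D_w ('D_v f) a = 'D_v ('D_w f) b.
  have hh : h * h != 0 by rewrite mulf_neq0// gt_eqF.
  have E1 := etrans stE (scal v w a U1); have E2 := etrans stE' (scal w v b U2).
  apply: (mulfI hh); refine (etrans (esym E1) (etrans _ E2)).
  have -> : p + h *: w + h *: v = p + h *: v + h *: w by rewrite addrAC.
  by move: (f _) (f _) (f _) (f _) => x1 x2 x3 x4; ring.
by rewrite -ab in H2; exact: ler_dist_half H1 H2.
Qed.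

End Schwarz.

(** * Germs of smooth functions and rules of differentiation *)

Section Smooth.
Context {R : realType}.
Implicit Types V W : normedModType R.

Global Instance is_diff_fst V W (p : V * W) : is_diff p fst fst.
Proof.
have c : continuous (fst : V * W -> V) by move=> q; exact: cvg_fst.
apply: DiffDef; first exact: (linear_differentiable (f := fst)).
exact: (diff_lin (f := fst)).
Qed.

Global Instance is_diff_snd V W (p : V * W) : is_diff p snd snd.
Proof.
have c : continuous (snd : V * W -> W) by move=> q; exact: cvg_snd.
apply: DiffDef; first exact: (linear_differentiable (f := snd)).
exact: (diff_lin (f := snd)).
Qed.

Lemma smooth_nearW V (f : V -> R) p :
  smooth_near f p -> \forall q \near p, smooth_near f q.
Proof.
move=> [U [oU Up] CU]; apply: filterS (open_nbhs_nbhs (conj oU Up)) => q Uq.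
by exists U.
Qed.

Lemma smooth_differentiable V (f : V -> R) p :
  smooth_near f p -> differentiable f p.
Proof. by move=> [U [oU Up] /(_ 1%N)[df _]]; exact: df. Qed.

Lemma smooth_continuous V (f : V -> R) p :
  smooth_near f p -> {for p, continuous f}.
Proof. by move=> /smooth_differentiable/differentiable_continuous. Qed.

Lemma smooth_is_derive V (f : V -> R) p v :
  smooth_near f p -> is_derive p v f ('D_v f p).
Proof. by move=> /smooth_differentiable df; apply/derivableP/diff_derivable. Qed.

Lemma smooth_derive V (f : V -> R) p v :
  smooth_near f p -> smooth_near ('D_v f) p.
Proof. by move=> [U oU CU]; exists U => // n; have [_] := CU n.+1; exact. Qed.

Lemma smooth_schwarz V (f : V -> R) p v w :
  smooth_near f p -> 'D_w ('D_v f) p = 'D_v ('D_w f) p.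
Proof. by move=> [U [oU Up] CU]; exact: (class_C_schwarz v w oU Up (CU 2)). Qed.

Lemma smooth_near_eq V (f g : V -> R) p :
  (\forall q \near p, f q = g q) -> smooth_near f p -> smooth_near g p.
Proof.
move=> fg [U oU CU].
have : nbhs p (U `&` [set q | f q = g q]) by apply: filterI => //; exact: open_nbhs_nbhs.
rewrite nbhsE => -[U' [oU' U'p] U'U].
exists U' => // n; apply: (@eq_class_C _ _ _ _ f) => //.
  by move=> q /U'U[].
by apply: class_C_subset (CU n) => q /U'U[].
Qed.

Lemma smooth_cst V (a : R) (p : V) : smooth_near (fun=> a) p.
Proof. by exists setT => [|n]; [split => //; exact: openT|exact: class_C_cst]. Qed.

Lemma smooth_op2 V (op : (V -> R) -> (V -> R) -> V -> R) :
  (forall n (U : set V) f g, open U -> class_C n U f -> class_C n U g ->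
     class_C n U (op f g)) ->
  forall f g p, smooth_near f p -> smooth_near g p -> smooth_near (op f g) p.
Proof.
move=> H f g p [U [oU Up] CU] [U' [oU' U'p] CU'].
exists (U `&` U'); first by split => //; exact: openI.
move=> n; apply: H; first exact: openI.
  by apply: class_C_subset (CU n) => q [].
by apply: class_C_subset (CU' n) => q [].
Qed.

Lemma smoothD V (f g : V -> R) p :
  smooth_near f p -> smooth_near g p -> smooth_near (fun q => f q + g q) p.
Proof. by apply: (@smooth_op2 _ (fun f g => f + g)) => *; exact: class_CD. Qed.

Lemma smoothM V (f g : V -> R) p :
  smooth_near f p -> smooth_near g p -> smooth_near (fun q => f q * g q) p.
Proof. by apply: (@smooth_op2 _ (fun f g => f * g)) => *; exact: class_CM. Qed.

Lemma smoothN V (f : V -> R) p :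
  smooth_near f p -> smooth_near (fun q => - f q) p.
Proof. by move=> [U [oU Up] CU]; exists U => // n; exact: class_CN. Qed.

Lemma smoothB V (f g : V -> R) p :
  smooth_near f p -> smooth_near g p -> smooth_near (fun q => f q - g q) p.
Proof. by move=> sf sg; apply: smoothD => //; exact: smoothN. Qed.

Lemma smoothV V (f : V -> R) p :
  f p != 0 -> smooth_near f p -> smooth_near (fun q => (f q)^-1) p.
Proof.
move=> f0 sf; have [U [oU Up] CU] := sf.
have : nbhs p (U `&` [set q | f q != 0]).
  apply: filterI; first exact: open_nbhs_nbhs.
  exact: (cvgr_neq0 _ (smooth_continuous sf)).
rewrite nbhsE => -[U' [oU' U'p] U'U].
exists U' => // n; apply: class_CV => //; first by move=> q /U'U[].
by apply: class_C_subset (CU n) => q /U'U[].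
Qed.

Lemma smooth_affine V W (F : W -> R) (G l : V -> W) p :
  (forall p, is_diff p G l) -> smooth_near F (G p) -> smooth_near (F \o G) p.
Proof.
move=> dG [U [oU Up] CU]; have cG : continuous G.
  by move=> q; apply: differentiable_continuous; have [] := dG q.
have oGU : open (G @^-1` U) by apply: open_comp => // q _; exact: cG.
by exists (G @^-1` U) => // n; apply: class_C_affine (CU n).
Qed.

Lemma class_C_id n (U : set R) : class_C n U (@id R).
Proof.
case: n => [|n]; first by move=> p _.
split=> [p _|v]; first by [].
rewrite (_ : 'D_v id = fun=> v); first exact: class_C_cst.
by apply/funext => p; rewrite derive_id.
Qed.

Lemma class_C_linear V n (U : set V) (l : V -> R) : open U ->
  (forall p, is_diff p l l) -> class_C n U l.
Proof.
move=> oU dl; have := @class_C_affine _ V R n U setT id l l dl _ oU (class_C_id n setT).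
exact.
Qed.

(** Two dummy coordinates equal to 0 turn the composition of scalar functions into an instance of
    [class_C_triple]. *)
Lemma class_C_comp V n (U : set V) (F : R -> R) (a : V -> R) : open U ->
  class_C n U a -> class_C n setT F -> class_C n U (fun p => F (a p)).
Proof.
move=> oU Ca CF; have CF' : class_C n setT (F \o snd : R * R * R -> R).
  by apply: (class_C_affine (l := snd) (U' := setT)) => //; exact: openT.
exact: (class_C_triple (U' := setT) oU _ (class_C_cst n U 0) (class_C_cst n U 0) Ca CF').
Qed.

Lemma class_C_expR n : class_C n setT (@expR R).
Proof.
have dE (x : R) : differentiable expR x.
  by apply/derivable1_diffP; have [] := is_derive_expR x.
elim: n => [|n IH]; first by move=> p _; exact: differentiable_continuous.
split=> [p _|v]; first exact: dE.
apply: eq_class_C (class_CM openT (class_C_cst n setT v) IH) => [|x _]; first exact: openT.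
have -> : 'D_v expR x = 'D_(v *: (1 : R)) expR x by rewrite /GRing.scale /= mulr1.
by rewrite deriveZv//; have [_ ->] := is_derive_expR x.
Qed.

Lemma smooth_triple V (F : R * R * R -> R) (a b c : V -> R) p :
  smooth_near a p -> smooth_near b p -> smooth_near c p ->
  smooth_near F (a p, b p, c p) ->
  smooth_near (fun q => F (a q, b q, c q)) p.
Proof.
move=> sa sb sc sF.
have [Ua [oUa Uap] CUa] := sa; have [Ub [oUb Ubp] CUb] := sb.
have [Uc [oUc Ucp] CUc] := sc; have [U [oU Up] CU] := sF.
have : nbhs p (Ua `&` Ub `&` Uc `&` [set q | U (a q, b q, c q)]).
  apply: filterI; first apply: filterI; first apply: filterI.
  - exact: open_nbhs_nbhs.
  - exact: open_nbhs_nbhs.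
  - exact: open_nbhs_nbhs.
  have cG : (a q, b q, c q) @[q --> p] --> (a p, b p, c p).
    exact: (cvg_pair (cvg_pair (smooth_continuous sa) (smooth_continuous sb))
      (smooth_continuous sc)).
  by apply: cG; exact: open_nbhs_nbhs (conj oU Up).
rewrite nbhsE => -[U' [oU' U'p] U'U].
exists U' => // n; apply: (@class_C_triple _ _ _ _ U) => //.
- by move=> q /U'U[[[]]].
- by apply: class_C_subset (CUa n) => q /U'U[[[]]].
- by apply: class_C_subset (CUb n) => q /U'U[[[]]].
- by apply: class_C_subset (CUc n) => q /U'U[[[]]].
Qed.

Lemma smooth_comp V (F : R -> R) (a : V -> R) p :
  smooth_near a p -> smooth_near F (a p) -> smooth_near (F \o a) p.
Proof.
move=> sa sF; have sF' : smooth_near (F \o snd : R * R * R -> R) (0, 0, a p).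
  exact: smooth_affine.
exact: (smooth_triple (smooth_cst 0 p) (smooth_cst 0 p) sa sF').
Qed.

Lemma smooth_fst V W (F : V -> R) (z : V * W) :
  smooth_near F z.1 -> smooth_near (fun z => F z.1) z.
Proof. exact: (smooth_affine (G := fst)). Qed.

Lemma smooth_snd V W (F : W -> R) (z : V * W) :
  smooth_near F z.2 -> smooth_near (fun z => F z.2) z.
Proof. exact: (smooth_affine (G := snd)). Qed.

Lemma is_diff_pairl V W (w : W) (p : V) : is_diff p (fun q => (q, w)) (fun q => (q, 0)).
Proof. exact: (is_diff_pair (f := id) (g := fun=> w)). Qed.

Lemma is_diff_pairr V W (v : V) (p : W) : is_diff p (fun q => (v, q)) (fun q => (0, q)).
Proof. exact: (is_diff_pair (f := fun=> v) (g := id)). Qed.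

Lemma smooth_slicel V W (F : V * W -> R) (v : V) (w : W) :
  smooth_near F (v, w) -> smooth_near (fun q => F (q, w)) v.
Proof. by apply: (smooth_affine (G := fun q => (q, w))) => p; exact: is_diff_pairl. Qed.

Lemma smooth_slicer V W (F : V * W -> R) (v : V) (w : W) :
  smooth_near F (v, w) -> smooth_near (fun q => F (v, q)) w.
Proof. by apply: (smooth_affine (G := fun q => (v, q))) => p; exact: is_diff_pairr. Qed.

Lemma derive_affine V W (F : W -> R) (G l : V -> W) p v :
  (forall p, is_diff p G l) -> differentiable F (G p) ->
  'D_v (fun q => F (G q)) p = 'D_(l v) F (G p).
Proof.
move=> dG dF; have [dGp GE] := dG p.
by rewrite (@derive_comp _ _ _ F G)// (deriveE v dGp) GE.
Qed.

Lemma is_derive_pair V W (f : R -> V) (g : R -> W) (t : R) df dg :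
  is_derive t 1 f df -> is_derive t 1 g dg ->
  is_derive t 1 (fun s => (f s, g s)) (df, dg).
Proof.
move=> [f1 <-] [g1 <-]; have f2 := iffLR (derivable1_diffP _ _) f1.
have g2 := iffLR (derivable1_diffP _ _) g1.
have h2 : differentiable (fun s => (f s, g s)) t by exact: differentiable_pair.
split; first exact/derivable1_diffP.
by rewrite deriveE// diff_pair// -!deriveE.
Qed.

Lemma is_derive_triple V (F : R * R * R -> R) (a b c : V -> R) p v da db dc :
  smooth_near a p -> smooth_near b p -> smooth_near c p ->
  smooth_near F (a p, b p, c p) ->
  is_derive p v a da -> is_derive p v b db -> is_derive p v c dc ->
  is_derive p v (fun q => F (a q, b q, c q))
    (da * dt F (a p, b p, c p) + db * dx F (a p, b p, c p)
     + dc * du F (a p, b p, c p)).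
Proof.
move=> sa sb sc sF [_ <-] [_ <-] [_ <-].
have da1 := smooth_differentiable sa; have db1 := smooth_differentiable sb.
have dc1 := smooth_differentiable sc; have dF := smooth_differentiable sF.
have dab := differentiable_pair da1 db1.
have dabc := differentiable_pair dab dc1.
apply: is_derive_eq (_ : is_derive p v _ ('D_v (F \o (fun q => (a q, b q, c q))) p)) _.
  by apply/derivableP/diff_derivable/differentiable_comp.
rewrite derive_comp// (deriveE _ dabc) (diff_pair dab dc1) (diff_pair da1 db1).
rewrite -!deriveE// (triple_basis ('D_v a p)) !deriveDv// !deriveZv//.
Qed.

(* The library's rules are about [f + g], which does not unify with [fun q => f q + g q]. *)
Lemma is_derive_addf V (f g : V -> R) p v a b :
  is_derive p v f a -> is_derive p v g b ->
  is_derive p v (fun q => f q + g q) (a + b).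
Proof. exact: is_deriveD. Qed.

Lemma is_derive_subf V (f g : V -> R) p v a b :
  is_derive p v f a -> is_derive p v g b ->
  is_derive p v (fun q => f q - g q) (a - b).
Proof. exact: is_deriveB. Qed.

Lemma is_derive_oppf V (f : V -> R) p v a :
  is_derive p v f a -> is_derive p v (fun q => - f q) (- a).
Proof. exact: is_deriveN. Qed.

Lemma is_derive_mulf V (f g : V -> R) p v a b :
  is_derive p v f a -> is_derive p v g b ->
  is_derive p v (fun q => f q * g q) (f p * b + g p * a).
Proof. exact: is_deriveM. Qed.

Lemma is_derive_invf V (f : V -> R) p v a : f p != 0 ->
  is_derive p v f a ->
  is_derive p v (fun q => (f q)^-1) (- a / f p ^+ 2).
Proof.
move=> f0 [df fE]; split; first exact: derivableV.
by rewrite deriveV// fE scaleNr mulNr -exprVn mulrC.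
Qed.

End Smooth.

(** * Scalar ordinary differential equations *)

Section Gronwall.
Context {R : realType}.
Implicit Types (f g : R -> R) (a b c e s t : R).

Lemma is_derive_continuous f s a : is_derive s 1 f a -> {for s, continuous f}.
Proof. by move=> [/derivable1_diffP/differentiable_continuous]. Qed.

Lemma MVT_is_derive f (f' : R -> R) a b : a <= b ->
  (forall t, a <= t <= b -> is_derive t 1 f (f' t)) ->
  exists2 t, a <= t <= b & f b - f a = f' t * (b - a).
Proof.
move=> ab df; have [||t tab tE] := @MVT_segment R f f' a b ab.
- by move=> t /subset_itv_oo_cc; rewrite in_itv; exact: df.
- apply: derivable_within_continuous => t; rewrite in_itv => tab.
  by have [] := df t tab.
by exists t => //; move: tab; rewrite in_itv.
Qed.

Lemma ler_dist_derive f (f' : R -> R) a b c : a <= b ->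
  (forall t, a <= t <= b -> is_derive t 1 f (f' t)) ->
  (forall t, a <= t <= b -> `|f' t| <= c) -> `|f b - f a| <= c * (b - a).
Proof.
move=> ab df fc; have [t tab ->] := MVT_is_derive ab df.
by rewrite normrM [`|b - a|]ger0_norm ?subr_ge0// ler_wpM2r ?subr_ge0// fc.
Qed.

Lemma is_derive_comp1 f g s a b : is_derive (g s) 1 f a -> is_derive s 1 g b ->
  is_derive s 1 (fun s => f (g s)) (b * a).
Proof.
move=> [/derivable1_diffP df fE] dg; apply: is_derive_eq (is_derive_curve dg df) _.
have -> : 'D_b f (g s) = 'D_(b *: (1 : R)) f (g s) by rewrite /GRing.scale /= mulr1.
by rewrite deriveZv// fE.
Qed.

Lemma is_derive_expR_comp f s a : is_derive s 1 f a ->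
  is_derive s 1 (fun s => expR (f s)) (a * expR (f s)).
Proof. by move=> df; apply: is_derive_comp1 df; exact: is_derive_expR. Qed.

(** The product of [f] with [exp (- c t)] has nonpositive derivative; the mean value theorem
    replaces integration. *)
Lemma gronwall f (f' : R -> R) c b : 0 <= b ->
  (forall t, 0 <= t <= b -> is_derive t 1 f (f' t)) ->
  (forall t, 0 <= t <= b -> f' t <= c * f t) -> f b <= f 0 * expR (c * b).
Proof.
move=> b0 df fc.
pose E t := expR (- (c * t)).
have dE t : is_derive t 1 E (- c * E t).
  apply: is_derive_expR_comp.
  apply: is_derive_eq (is_derive_oppf (is_derive_mulf (is_derive_cst c t 1) (is_derive_id t 1))) _.
  by rewrite /= mulr0 addr0 mulr1.
have [t t0b] := MVT_is_derive b0 (fun t t0b => is_derive_mulf (df t t0b) (dE t)).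
move=> H; have {H} : f b * E b - f 0 * E 0 <= 0.
  rewrite H mulr_le0_ge0 ?subr0// mulNr mulrN addrC subr_le0 mulrCA mulrC.
  rewrite [leLHS]mulrC [leRHS]mulrA [leRHS]mulrC ler_wpM2l ?expR_ge0// mulrC.
  by rewrite mulrC fc.
rewrite subr_le0 /E mulr0 oppr0 expR0 mulr1 => H.
by rewrite -ler_pdivrMr ?expR_gt0// -expRN.
Qed.

Lemma gronwall_affine f (f' : R -> R) c e b : 0 <= b -> 0 <= c -> 0 <= e ->
  (forall t, 0 <= t <= b -> is_derive t 1 f (f' t)) ->
  (forall t, 0 <= t <= b -> `|f' t| <= c * `|f t| + e) ->
  `|f b| <= (`|f 0| + e) * expR ((2 * c + 1) * b).
Proof.
move=> b0 c0 e0 df fc.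
(* [f ^+ 2 + e ^+ 2] is differentiable, unlike [`|f|]. *)
have dm t : 0 <= t <= b ->
    is_derive t 1 (fun t => f t * f t + e * e) (2 * (f t * f' t)).
  move=> /df dft; apply: is_derive_eq (is_derive_addf (is_derive_mulf dft dft) (is_derive_cst _ _ _)) _.
  by rewrite addr0; ring.
have H : f b * f b + e * e <= (f 0 * f 0 + e * e) * expR ((2 * c + 1) * b).
  apply: (gronwall b0 dm) => t /fc H.
  have : f t * f' t <= `|f t| * (c * `|f t| + e).
    by rewrite (le_trans (ler_norm _))// normrM ler_wpM2l.
  rewrite -[f t * f t]expr2 -[f t ^+ 2]real_normK ?num_real//.
  (* The mixed term satisfies [2 * x * e <= x ^+ 2 + e ^+ 2], which is where the rate [2 * c + 1]
     comes from. *)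
  move: `|f t| => x; have := sqr_ge0 (x - e); nra.
have X1 : 1 <= expR ((2 * c + 1) * b).
  by rewrite -expR0 ler_expR mulr_ge0// addr_ge0// mulr_ge0.
move: (expR _) H X1 => X H X1.
rewrite -(@ler_pXn2r _ 2)// ?nnegrE ?mulr_ge0 ?addr_ge0//; last by rewrite (le_trans ler01).
have f0 := normr_ge0 (f 0).
rewrite real_normK ?num_real//.
have : f 0 * f 0 = `|f 0| ^+ 2 by rewrite real_normK ?num_real.
move: `|f 0| f0 => x x0 xE; rewrite xE in H.
(* The two sides are compared after squaring; [1 <= X] gives [X <= X ^+ 2], so no square root of the
   exponential is taken. *)
apply: (@le_trans _ _ ((x + e) ^+ 2 * X)); last first.
  by rewrite exprMn ler_wpM2l ?sqr_ge0// expr2 ler_peMl// (le_trans ler01).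
apply: (@le_trans _ _ ((x ^+ 2 + e * e) * X)); first by nra.
by rewrite ler_wpM2r ?(le_trans ler01)//; nra.
Qed.

(** The Lipschitz bound is asked along the two curves only, so that no common domain for [F] has to
    be described. *)
Lemma ode_unique (F : R -> R -> R) (y1 y2 : R -> R) c b : 0 <= b -> 0 <= c ->
  (forall t, 0 <= t <= b -> is_derive t 1 y1 (F t (y1 t))) ->
  (forall t, 0 <= t <= b -> is_derive t 1 y2 (F t (y2 t))) ->
  (forall t, 0 <= t <= b -> `|F t (y1 t) - F t (y2 t)| <= c * `|y1 t - y2 t|) ->
  y1 0 = y2 0 -> y1 b = y2 b.
Proof.
move=> b0 c0 d1 d2 lF y0.
have := @gronwall_affine (fun t => y1 t - y2 t) (fun t => F t (y1 t) - F t (y2 t)) c 0 b b0 c0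
  (lexx 0) (fun t tb => is_derive_subf (d1 t tb) (d2 t tb)).
rewrite y0 subrr normr0 addr0 mul0r => H; apply/eqP; rewrite -subr_eq0 -normr_le0.
by apply: H => t tb; rewrite addr0; exact: lF.
Qed.

End Gronwall.

(** * Primitives and the fixed point theorem *)

Section Picard.
Context {R : realType}.
Implicit Types (f g G : R -> R) (a b c e s t : R).

Lemma primitive_uniq G1 G2 g c s : G1 0 = G2 0 -> `|s| < c ->
  (forall t, `|t| < c -> is_derive t 1 G1 (g t)) ->
  (forall t, `|t| < c -> is_derive t 1 G2 (g t)) -> G1 s = G2 s.
Proof.
move=> G0 sc d1 d2.
have d t : `|t| < c -> is_derive t 1 (fun t => G1 t - G2 t) 0.
  by move=> tc; apply: is_derive_eq (is_derive_subf (d1 t tc) (d2 t tc)) _; rewrite subrr.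
have [s0|s0] := leP 0 s.
  have [t|t _] := @MVT_is_derive R (fun t => G1 t - G2 t) (fun=> 0) 0 s s0.
    move=> /andP[t0 ts]; apply: d; rewrite ger0_norm//.
    by rewrite (le_lt_trans ts)// -(ger0_norm s0).
  by rewrite mul0r G0 subrr subr0 => /subr0_eq.
have [t|t _] := @MVT_is_derive R (fun t => G1 t - G2 t) (fun=> 0) s 0 (ltW s0).
  move=> /andP[st t0]; apply: d; rewrite ler0_norm//.
  by rewrite (le_lt_trans _ sc)// ltr0_norm// lerN2.
by rewrite mul0r G0 subrr sub0r => /eqP; rewrite oppr_eq0 subr_eq0 => /eqP.
Qed.

(** The fundamental theorem provides primitives on bounded intervals. Normalised to vanish at 0 they
    agree on overlaps, and at [s] the one numbered by the integer part of [|s|] is taken. *)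
Lemma primitive_exists g : continuous g ->
  exists2 G, G 0 = 0 & forall s, is_derive s 1 G (g s).
Proof.
move=> cg.
have H (n : nat) : exists G, G 0 = 0 /\ forall s, `|s| < n.+1%:R -> is_derive s 1 G (g s).
  pose F x := \int[lebesgue_measure]_(t in `[- n.+1%:R, x]) (g t : R).
  exists (fun x => F x - F 0); split; first by rewrite subrr.
  move=> s; rewrite ltr_norml => /andP[sn ns].
  have [|d dE] := @continuous_FTC1_closed R g (- n.+1%:R) s n.+1%:R ns _ sn (cg s).
    apply: continuous_compact_integrable; first exact: segment_compact.
    exact: continuous_subspaceT.
  apply: is_derive_eq (is_derive_subf _ (is_derive_cst (F 0) s 1)) (subr0 _).
  by split; [exact: d|rewrite -derive1E; exact: dE].
pose G n := sval (cid (H n)).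
have G0 n : G n 0 = 0 by rewrite /G; case: cid => ? [].
have dG n s : `|s| < n.+1%:R -> is_derive s 1 (G n) (g s).
  by move: s; rewrite /G; case: cid => ? [].
have GE m n s : (m <= n)%N -> `|s| < m.+1%:R -> G m s = G n s.
  move=> mn sm; apply: (@primitive_uniq _ _ g m.+1%:R) => //; first by rewrite !G0.
  by move=> t tm; apply: (dG n t); rewrite (lt_le_trans tm)// ler_nat.
pose N s := Num.trunc `|s|.
have sN s : `|s| < (N s).+1%:R by exact: truncnS_gt.
exists (fun s => G (N s) s) => [|s]; first exact: G0.
apply: near_eq_is_derive (dG (N s) s (sN s)).
have : \forall t \near s, `|t| < (N s).+1%:R.
  have c : {for s, continuous (fun t : R => `|t|)} by exact: norm_continuous.
  exact: (cvgr_lt _ c _ (sN s)).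
apply: filterS => t tN.
have [Nst|/ltnW Nst] := leqP (N s) (N t); first exact: GE.
by rewrite -(GE (N t) (N s)).
Qed.

(** The projection of the line onto [[c - e, c + e]]. Composing with it extends data given on an
    interval to the whole line without changing bounds or Lipschitz constants. *)
Definition clamp c e s := Num.max (c - e) (Num.min (c + e) s).

Lemma clamp_id c e s : `|s - c| <= e -> clamp c e s = s.
Proof.
rewrite ler_norml => /andP[h1 h2]; rewrite /clamp.
have -> : Num.min (c + e) s = s by apply/min_idPr; lra.
by apply/max_idPr; lra.
Qed.

Lemma clamp_bound c e s : 0 <= e -> `|clamp c e s - c| <= e.
Proof.
move=> e0; rewrite /clamp ler_norml; apply/andP.
have [h1|h1] := leP (c + e) s; last have [h2|h2] := leP (c - e) s.
- by rewrite (max_idPr _); lra.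
- by lra.
- by lra.
Qed.

Lemma clamp_lip c e s t : `|clamp c e s - clamp c e t| <= `|s - t|.
Proof.
rewrite /clamp ler_norml.
have [h1|h1] := leP (c + e) s; have [h2|h2] := leP (c + e) t;
have := ler_norm (s - t); have := ler_norm (t - s); rewrite distrC => h3 h4;
repeat match goal with |- context [Num.max ?a ?b] => have [?|?] := leP a b end; lra.
Qed.

Lemma clamp_continuous c e : continuous (clamp c e).
Proof.
move=> s; apply/cvgrPdist_lt => d d0.
apply: (iffRL (nbhs_normlP (s : R) _)); exists d => // t; rewrite distrC.
exact: le_lt_trans (clamp_lip _ _ _ _).
Qed.

Lemma exists_half_pow_lt (D e : R) : 0 < e -> exists n, D / 2 ^+ n < e.
Proof.
move=> e0; exists (Num.trunc (D / e)).+1.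
rewrite ltr_pdivrMr ?exprn_gt0// -ltr_pdivrMl// mulrC.
apply: (lt_trans (truncnS_gt _)).
by rewrite -natrX ltr_nat ltn_expl.
Qed.

(** Banach's theorem for the uniform distance, expressed by pointwise bounds: the limit is formed at
    each point separately and is continuous as a uniform limit. *)
Lemma contraction_fixpoint (T : (R -> R) -> R -> R) (y0 : R -> R) c :
  0 <= c -> continuous y0 -> (forall y : R -> R, continuous y -> continuous (T y)) ->
  (forall s, `|T y0 s - y0 s| <= c) ->
  (forall (y z : R -> R) d, continuous y -> continuous z -> (forall s, `|y s - z s| <= d) ->
     forall s, `|T y s - T z s| <= d / 2) ->
  exists2 y, continuous y & T y = y.
Proof.
move=> c0 cy0 cT Tc Tcontr.
pose u n := iter n T y0.
have cu n : continuous (u n) by elim: n => [|n IH] //=; exact: cT.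
have du n s : `|u n.+1 s - u n s| <= c / 2 ^+ n.
  elim: n s => [|n IH] s; first by rewrite expr0 divr1 Tc.
  have := Tcontr _ _ _ (cu n.+1) (cu n) IH s.
  by rewrite -mulrA -invfM -exprSr.
(* The tail of the geometric series of the steps [c / 2 ^+ k], [k >= n]. Hence the intervals of
   radius [e n] around [u n s] are nested. *)
pose e n := 2 * c / 2 ^+ n.
have eS n : e n = e n.+1 + c / 2 ^+ n.
  have h : (2 : R) ^+ n != 0 by rewrite expf_neq0// pnatr_eq0.
  by rewrite /e exprS; field.
have e_ge0 n : 0 <= e n by rewrite /e divr_ge0 ?mulr_ge0 ?exprn_ge0.
have mono s n k : u n s - e n <= u (n + k)%N s - e (n + k)%N /\
                  u (n + k)%N s + e (n + k)%N <= u n s + e n.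
  elim: k => [|k [IH1 IH2]]; first by rewrite addn0.
  rewrite addnS; have := du (n + k)%N s; rewrite ler_norml => /andP[h1 h2].
  by have := eS (n + k)%N; split; lra.
have ab s n m : u n s - e n <= u m s + e m.
  have [h1 _] := mono s n m; have [_ h2] := mono s m n; rewrite addnC in h2.
  by have := e_ge0 (n + m)%N; lra.
(* The common point of the nested intervals, taken as the supremum of their left ends. *)
pose y s := sup [set u n s - e n | n in [set: nat]].
have yu s n : `|y s - u n s| <= e n.
  have hs : has_sup [set u n s - e n | n in [set: nat]].
    split; first by exists (u 0%N s - e 0%N); exists 0%N.
    by exists (u 0%N s + e 0%N) => _ [m _ <-].
  have h1 : u n s - e n <= y s.
    by apply: (ub_le_sup (proj2 hs)); exists n.
  have h2 : y s <= u n s + e n.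
    by apply: (sup_le_ub (proj1 hs)) => _ [m _ <-].
  by rewrite ler_norml; apply/andP; lra.
have cy : continuous y.
  move=> s; apply/cvgrPdist_lt => d d0.
  have [n nd] : exists n, e n < d / 3 by apply: exists_half_pow_lt; rewrite divr_gt0.
  have d3 : 0 < d / 3 by rewrite divr_gt0.
  have /cvgrPdist_lt/(_ _ d3) := cu n s; apply: filterS => t.
  have := yu s n; have := yu t n; rewrite !ler_norml !ltr_norml.
  by move=> /andP[? ?] /andP[? ?] /andP[? ?]; apply/andP; lra.
exists y => //; apply/funext => s; apply/eqP; rewrite -subr_eq0 -normr_le0.
apply/ler_addgt0Pr => d d0; rewrite add0r.
have [n nd] : exists n, e n < d / 2 by apply: exists_half_pow_lt; rewrite divr_gt0.
have := Tcontr _ _ _ cy (cu n) (fun s => yu s n) s.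
have := yu s n.+1; rewrite -/(u n.+1) /=; have := eS n; have := e_ge0 n.
have : 0 <= c / 2 ^+ n by rewrite divr_ge0 ?exprn_ge0.
rewrite !ler_norml; move: (c / _) (T y s) (T (u n) s) => ? ? ?.
by move=> ? ? ? /andP[? ?] /andP[? ?]; apply/andP; lra.
Unshelve. all: by end_near. Qed.

End Picard.

(** * Existence for scalar equations and integrals over the unit interval *)

Section ScalarODE.
Context {R : realType}.
Implicit Types (f g G : R -> R) (a b c e s t : R).

Definition prim g : R -> R :=
  xget (fun=> 0) [set G | G 0 = 0 /\ forall s, is_derive s 1 G (g s)].

Lemma primP g : continuous g ->
  prim g 0 = 0 /\ forall s, is_derive s 1 (prim g) (g s).
Proof.
move=> /primitive_exists[G G0 dG]; rewrite /prim; case: xgetP => [F -> //|].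
by move=> /(_ G); case.
Qed.

Lemma prim_bound g c s : continuous g -> (forall t, `|g t| <= c) ->
  `|prim g s| <= c * `|s|.
Proof.
move=> /primP[p0 dp] gc; have [s0|s0] := leP 0 s.
  have := ler_dist_derive s0 (fun t _ => dp t) (fun t _ => gc t).
  by rewrite p0 !subr0 (ger0_norm s0).
have := ler_dist_derive (ltW s0) (fun t _ => dp t) (fun t _ => gc t).
by rewrite p0 !sub0r normrN (ltr0_norm s0).
Qed.

Lemma prim_dist f g c s : continuous f -> continuous g ->
  (forall t, `|f t - g t| <= c) -> `|prim f s - prim g s| <= c * `|s|.
Proof.
move=> /primP[p0 dp] /primP[q0 dq] fgc.
have d t : is_derive t 1 (fun t => prim f t - prim g t) (f t - g t) by exact: is_derive_subf.
have [s0|s0] := leP 0 s.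
  have := ler_dist_derive s0 (fun t _ => d t) (fun t _ => fgc t).
  by rewrite p0 q0 !subr0 (ger0_norm s0).
have := ler_dist_derive (ltW s0) (fun t _ => d t) (fun t _ => fgc t).
by rewrite p0 q0 subrr !sub0r normrN (ltr0_norm s0).
Qed.

(** The box is centred at [c] and not at the initial value, so one box and one time [e] serve all
    initial values near [c]. *)
Lemma picard (F : R -> R -> R) c y0 r K M e :
  0 < e -> 0 <= r -> 0 <= K -> 0 <= M -> e * K <= 2^-1 -> `|y0 - c| + M * e <= r ->
  (forall s y, `|s| <= e -> `|y - c| <= r -> {for s, continuous (F^~ y)}) ->
  (forall s y, `|s| <= e -> `|y - c| <= r -> `|F s y| <= M) ->
  (forall s y z, `|s| <= e -> `|y - c| <= r -> `|z - c| <= r ->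
     `|F s y - F s z| <= K * `|y - z|) ->
  exists y : R -> R, [/\ y 0 = y0,
    forall s, `|s| < e -> is_derive s 1 y (F s (y s)) &
    forall s, `|s| < e -> `|y s - c| <= r /\ `|y s - y0| <= M * `|s|].
Proof.
move=> e0 r0 K0 M0 eK y0r cF bF lF.
(* Clamped in both arguments the field is bounded and Lipschitz everywhere, and it agrees with [F]
   on the box, which the solution turns out not to leave. *)
pose Fc s y := F (clamp 0 e s) (clamp c r y).
have cle s : `|clamp 0 e s| <= e by have := clamp_bound 0 s (ltW e0); rewrite subr0.
have clr y : `|clamp c r y - c| <= r by exact: clamp_bound.
have bFc s y : `|Fc s y| <= M by exact: bF.
have lFc s y z : `|Fc s y - Fc s z| <= K * `|y - z|.
  apply: (le_trans (lF _ _ _ (cle s) (clr y) (clr z))).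
  by rewrite ler_wpM2l// clamp_lip.
have cFc y : continuous (Fc^~ y).
  move=> s; apply: (@continuous_comp _ _ _ (clamp 0 e) (F^~ (clamp c r y))).
    exact: clamp_continuous.
  exact: cF.
have cFy (y : R -> R) : continuous y -> continuous (fun s => Fc s (y s)).
  move=> cy s; apply/cvgrPdist_lt => d d0.
  have K1 : 0 < K + 1 by rewrite ltr_wpDl.
  have d2 : 0 < d / 2 / (K + 1) by rewrite !divr_gt0.
  have d3 : 0 < d / 2 by rewrite !divr_gt0.
  have /cvgrPdist_lt/(_ _ d2) := cy s; have /cvgrPdist_lt/(_ _ d3) := cFc (y s) s.
  apply: filterS2 => t h1 h2; have h3 := lFc t (y s) (y t).
  have h4 : K * `|y s - y t| <= d / 2.
    apply: (@le_trans _ _ ((K + 1) * `|y s - y t|)).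
      by rewrite ler_wpM2r// lerDl.
    by rewrite mulrC -ler_pdivlMr// ltW.
  rewrite -(subrKA (Fc t (y s))); apply: le_lt_trans (ler_normD _ _) _.
  by rewrite [d]splitr ltr_leD// (le_trans h3).
(* Time is clamped outside the integral too: the fixed point theorem asks for bounds on the whole
   line, and [|clamp 0 e s| <= e] turns the Lipschitz constant [K] into the contraction factor
   [e * K <= 1/2]. *)
pose T (y : R -> R) s := y0 + prim (fun s => Fc s (y s)) (clamp 0 e s).
have [|||||y cy yE] := @contraction_fixpoint R T (fun=> y0) (M * e).
- by rewrite mulr_ge0// ltW.
- by move=> s; exact: cvg_cst.
- move=> y cy s; apply: cvgD; first exact: cvg_cst.
  apply: (@continuous_comp _ _ _ (clamp 0 e)); first exact: clamp_continuous.
  by have [_ dp] := primP (cFy y cy); exact: is_derive_continuous (dp _).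
- move=> s; rewrite /T addrAC subrr add0r.
  apply: le_trans (prim_bound _ _ (fun t => bFc t y0)) _.
    by apply: cFy => t; exact: cvg_cst.
  by rewrite ler_wpM2l.
- move=> y z d cy cz yz s; rewrite /T opprD addrACA subrr add0r.
  have d0 : 0 <= d by rewrite (le_trans _ (yz 0)).
  apply: (le_trans (prim_dist (c := K * d) _ (cFy y cy) (cFy z cz) _)).
    by move=> t; rewrite (le_trans (lFc _ _ _))// ler_wpM2l.
  rewrite mulrAC mulrC ler_wpM2l//.
  by rewrite (le_trans _ eK)// mulrC ler_wpM2r.
have [p0 dp] := primP (cFy y cy).
have yT s : y s = y0 + prim (fun s => Fc s (y s)) (clamp 0 e s) by rewrite -[in LHS]yE.
have clid s : `|s| < e -> clamp 0 e s = s.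
  by move=> /ltW se; rewrite clamp_id// subr0.
have bound s : `|s| < e -> `|y s - c| <= r /\ `|y s - y0| <= M * `|s|.
  move=> se; have h : `|y s - y0| <= M * `|s|.
    rewrite yT addrAC subrr add0r clid//.
    exact: (prim_bound _ (cFy y cy) (fun t => bFc t (y t))).
  split=> //; rewrite -(subrKA y0) (le_trans (ler_normD _ _))// (le_trans _ y0r)//.
  by rewrite addrC lerD2l (le_trans h)// ler_wpM2l// ltW.
exists y; split => //.
  by rewrite yT clid ?normr0// p0 addr0.
move=> s se; have -> : F s (y s) = 0 + Fc s (y s).
  rewrite add0r /Fc clid// clamp_id//; by have [] := bound s se.
apply: near_eq_is_derive (is_derive_addf (is_derive_cst y0 s 1) (dp s)).
have c0 : {for s, continuous (fun t : R => `|t|)} by exact: norm_continuous.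
have : \forall t \near s, `|t| < e by exact: (cvgr_lt _ c0 _ se).
apply: filterS => t te.
by rewrite [RHS]yT clid.
Qed.

(** The integral of [g] over [[0, 1]]. Clamping onto [[0, 1]] makes it depend on the values there
    only, so continuity at these points suffices to compute with it. *)
Definition I01 g : R := prim (g \o clamp 2^-1 2^-1) 1.

Lemma clamp01 s : 0 <= s <= 1 -> clamp 2^-1 2^-1 s = s.
Proof. by move=> /andP[h1 h2]; rewrite clamp_id// ler_norml; apply/andP; lra. Qed.

Lemma clamp01_bound s : 0 <= clamp 2^-1 2^-1 s <= 1.
Proof.
have := @clamp_bound R 2^-1 2^-1 s; rewrite invr_ge0 ler0n ler_norml => /(_ isT).
by move=> /andP[? ?]; apply/andP; lra.
Qed.

Lemma I01P g : (forall s, 0 <= s <= 1 -> {for s, continuous g}) ->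
  exists G, [/\ G 0 = 0, G 1 = I01 g & forall s, 0 <= s <= 1 -> is_derive s 1 G (g s)].
Proof.
move=> cg; have [|p0 dp] := @primP (g \o clamp 2^-1 2^-1).
  move=> s; apply: continuous_comp; first exact: clamp_continuous.
  by apply: cg; exact: clamp01_bound.
exists (prim (g \o clamp 2^-1 2^-1)); split => // s s01.
by have := dp s; rewrite /= clamp01.
Qed.

Lemma I01_bound g c : (forall s, 0 <= s <= 1 -> {for s, continuous g}) ->
  (forall s, 0 <= s <= 1 -> `|g s| <= c) -> `|I01 g| <= c.
Proof.
move=> /I01P[G [G0 <- dG]] gc.
by have := ler_dist_derive ler01 dG gc; rewrite G0 !subr0 mulr1.
Qed.

Lemma I01_uniq g G : (forall s, 0 <= s <= 1 -> {for s, continuous g}) ->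
  (forall s, 0 <= s <= 1 -> is_derive s 1 G (g s)) -> G 1 - G 0 = I01 g.
Proof.
move=> /I01P[H [H0 <- dH]] dG.
have d t : 0 <= t <= 1 -> is_derive t 1 (fun t => G t - H t) 0.
  by move=> t01; apply: is_derive_eq (is_derive_subf (dG t t01) (dH t t01)) _; rewrite subrr.
have [t _] := MVT_is_derive ler01 d.
by rewrite mul0r H0 subr0 => /eqP; rewrite subr_eq0 => /eqP <-; rewrite opprB addrC subrK.
Qed.

Lemma I01D f g : (forall s, 0 <= s <= 1 -> {for s, continuous f}) ->
  (forall s, 0 <= s <= 1 -> {for s, continuous g}) ->
  I01 (fun s => f s + g s) = I01 f + I01 g.
Proof.
move=> cf cg; have [F [F0 <- dF]] := I01P cf; have [G [G0 <- dG]] := I01P cg.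
have cfg s : 0 <= s <= 1 -> {for s, continuous (fun s => f s + g s)}.
  by move=> s01; apply: cvgD; [exact: cf|exact: cg].
by rewrite -(I01_uniq cfg (fun s s01 => is_derive_addf (dF s s01) (dG s s01))) F0 G0 addr0 subr0.
Qed.

Lemma I01Z a f : (forall s, 0 <= s <= 1 -> {for s, continuous f}) ->
  I01 (fun s => a * f s) = a * I01 f.
Proof.
move=> cf; have [F [F0 <- dF]] := I01P cf.
have caf s : 0 <= s <= 1 -> {for s, continuous (fun s => a * f s)}.
  by move=> s01; apply: cvgM; [exact: cvg_cst|exact: cf].
have daF s : 0 <= s <= 1 -> is_derive s 1 (fun s => a * F s) (a * f s).
  move=> s01; apply: is_derive_eq (is_derive_mulf (is_derive_cst a s 1) (dF s s01)) _.
  by rewrite mulr0 addr0.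
by rewrite -(I01_uniq caf daF) F0 mulr0 subr0.
Qed.

End ScalarODE.

(** * Integral surfaces of compatible first-order systems *)

Section Linear3.
Context {R : realType}.

(** The differential with partial derivatives [a], [b], [c]; its registered linear structure lets it
    serve as the candidate in [epsilon_differentiable]. *)
Definition lin3 (a b c : R) (h : R * R * R) : R := h.1.1 * a + h.1.2 * b + h.2 * c.

Lemma lin3_is_linear a b c : linear (lin3 a b c).
Proof.
move=> k x y; rewrite /lin3 /= /GRing.scale /=; ring.
Qed.

HB.instance Definition _ a b c :=
  GRing.isLinear.Build R (R * R * R)%type R *:%R (lin3 a b c) (lin3_is_linear a b c).

Lemma lin3_continuous a b c : continuous (lin3 a b c).
Proof.
move=> x; apply: differentiable_continuous; rewrite /lin3.
apply: differentiableD; first apply: differentiableD;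
  by apply: differentiableM.
Qed.

Lemma differentiable3 (f : R * R * R -> R) x (a b c : R) :
  (forall e : R, 0 < e ->
     \forall h \near (0 : R * R * R), `|f (h + x) - f x - lin3 a b c h| <= e * `|h|) ->
  differentiable f x /\ forall v, 'D_v f x = lin3 a b c v.
Proof. exact: (epsilon_differentiable (@lin3_continuous a b c)). Qed.

Lemma norm3_le (h : R * R * R) : [/\ `|h.1.1| <= `|h|, `|h.1.2| <= `|h| & `|h.2| <= `|h|].
Proof.
split; last exact: ler_norm_snd.
  exact: le_trans (ler_norm_fst _) (ler_norm_fst _).
exact: le_trans (ler_norm_snd _) (ler_norm_fst _).
Qed.

Lemma derive3E (f : R * R * R -> R) x v : differentiable f x ->
  'D_v f x = lin3 (dt f x) (dx f x) (du f x) v.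
Proof.
move=> df; by case: v => -[a b] c; rewrite [X in 'D_X _ _]triple_basis !deriveDv// !deriveZv.
Qed.

End Linear3.

(** * Uniformity over compact sets and differentiation under the integral sign *)

Section Uniform.
Context {R : realType}.
Implicit Types V W : normedModType R.

Lemma compact_near (T : topologicalType) V (K : set T) (y : V) (P : T -> V -> Prop) :
  compact K -> (forall x, K x -> \forall z \near (x, y), P z.1 z.2) ->
  exists2 r : R, 0 < r & forall x y', K x -> `|y' - y| < r -> P x y'.
Proof.
move=> /compact_near_coveringP/(_ V (nbhs y) (fun y' x => P x y')) cK H.
have [r r0 rP] := iffLR (nbhs_normlP _ _) (cK _ H).
by exists r => // x y' Kx y'r; exact: rP.
Qed.

(** By the mean value theorem the remainder is made of increments of the three directional
    derivatives, and continuity on the compact set [K] makes these uniformly small. The space is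
    arbitrary because the parameter integrals need it with one more coordinate. *)
Lemma uniform_differentiable V (K U : set V) (G : V -> R) (e1 e2 e3 : V) (e : R) :
  compact K -> open U -> K `<=` U -> class_C 1 U G -> 0 < e ->
  exists2 d : R, 0 < d & forall p a b c, K p -> `|a| < d -> `|b| < d -> `|c| < d ->
    let v := a *: e1 + b *: e2 + c *: e3 in
    U (p + v) /\
    `|G (p + v) - G p - (a * 'D_e1 G p + b * 'D_e2 G p + c * 'D_e3 G p)|
      <= e * (`|a| + `|b| + `|c|).
Proof.
move=> cK oU KU [dG DG] e0.
have [|r r0 rP] := @compact_near V V K 0
  (fun p d => [/\ U (p + d), `|'D_e1 G (p + d) - 'D_e1 G p| <= e,
     `|'D_e2 G (p + d) - 'D_e2 G p| <= e & `|'D_e3 G (p + d) - 'D_e3 G p| <= e]) cK.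
  move=> x /KU Ux.
  have cD : forall w, \forall z \near (x, 0 : V), `|'D_w G (z.1 + z.2) - 'D_w G z.1| <= e.
    move=> w; have he : 0 < e / 2 by rewrite divr_gt0.
    have /cvgrPdist_lt/(_ _ he) h := DG w x Ux.
    have cs : z.1 + z.2 @[z --> (x, 0 : V)] --> x.
      by rewrite -[X in _ --> X]addr0; apply: cvgD; [exact: cvg_fst|exact: cvg_snd].
    have cf : z.1 @[z --> (x, 0 : V)] --> x by exact: cvg_fst.
    have h1 : \forall z \near (x, 0 : V), `|'D_w G x - 'D_w G (z.1 + z.2)| < e / 2 := cs _ h.
    have h2 : \forall z \near (x, 0 : V), `|'D_w G x - 'D_w G z.1| < e / 2 := cf _ h.
    apply: filterS2 h1 h2 => z /=; set A := 'D_w G x; set B := 'D_w G _.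
    by rewrite distrC => h1 h2; apply: ltW; rewrite -(subrKA A) [e]splitr (le_lt_trans (ler_normD _ _))// ltrD.
  have cs : z.1 + z.2 @[z --> (x, 0 : V)] --> x.
    by rewrite -[X in _ --> X]addr0; apply: cvgD; [exact: cvg_fst|exact: cvg_snd].
  have hU : \forall z \near (x, 0 : V), U (z.1 + z.2) := cs _ (open_nbhs_nbhs (conj oU Ux)).
  apply: filterS (filterI (filterI hU (cD e1)) (filterI (cD e2) (cD e3))).
  by move=> z [[k1 k2] [k3 k4]]; exact: (And4 k1 k2 k3 k4).
pose N := `|e1| + `|e2| + `|e3| + 1.
have N0 : 0 < N by rewrite ltr_wpDl// !addr_ge0.
exists (r / N); first by rewrite divr_gt0.
move=> p a b c Kp ad bd cd v.
have vr : `|v| < r.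
  have h x y : `|x| < r / N -> `|x *: y| <= r / N * `|y : V|.
    by move=> xd; rewrite normrZ ler_wpM2r// ltW.
  apply: (@le_lt_trans _ _ (r / N * (`|e1| + `|e2| + `|e3|))).
    rewrite !mulrDr; apply: le_trans (ler_normD _ _) _; apply: lerD; last exact: h.
    by apply: le_trans (ler_normD _ _) _; apply: lerD; exact: h.
  by rewrite -mulrA gtr_pMr// ltr_pdivrMl// mulr1 ltrDl.
have vP (t : R) : 0 <= t <= 1 -> `|t *: v - 0| < r.
  move=> /andP[t0 t1]; rewrite subr0 normrZ ger0_norm// (le_lt_trans _ vr)//.
  by rewrite ler_piMl.
have [|t t01 ->] := @MVT_line _ _ G p v.
  by move=> t /vP/(rP _ _ Kp)[Ut _ _ _]; exact: dG.
have [Ut h1 h2 h3] := rP _ _ Kp (vP t t01).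
have [|Uv _ _ _] := rP p v Kp; first by rewrite subr0.
split => //; rewrite /v !deriveDv ?deriveZv; [|exact: dG..].
rewrite -/v; move: ('D_e1 G _) ('D_e1 G _) ('D_e2 G _) ('D_e2 G _) ('D_e3 G _) ('D_e3 G _) h1 h2 h3.
move=> y1 x1 y2 x2 y3 x3 h1 h2 h3.
have -> : a *: x1 + b *: x2 + c *: x3 - (a * y1 + b * y2 + c * y3) =
  a * (x1 - y1) + b * (x2 - y2) + c * (x3 - y3) by rewrite /GRing.scale /=; ring.
rewrite [leRHS]mulrDr [X in _ <= X + _]mulrDr.
apply: le_trans (ler_normD _ _) _; apply: lerD; last first.
  by rewrite normrM mulrC ler_wpM2r.
apply: le_trans (ler_normD _ _) _; apply: lerD.
  by rewrite normrM mulrC ler_wpM2r.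
by rewrite normrM mulrC ler_wpM2r.
Qed.

Lemma continuous_I01 V (O : set (R * V)) (U : set V) (j : R * V -> R) :
  open O -> (forall l s, U l -> 0 <= s <= 1 -> O (s, l)) ->
  (forall z, O z -> {for z, continuous j}) ->
  forall l, U l -> {for l, continuous (fun l => I01 (fun s => j (s, l)))}.
Proof.
move=> oO OU cj l Ul; apply/cvgrPdist_le => e e0.
have e2 : 0 < e / 2 by rewrite divr_gt0.
have cs l' s : O (s, l') -> {for s, continuous (fun s => j (s, l'))}.
  move=> /cj c; apply: (@continuous_comp _ _ _ (fun s => (s, l')) j) => //.
  by apply: differentiable_continuous; have [] := is_diff_pairl l' s.
have [|r r0 rP] := @compact_near R V `[0, 1] l
  (fun s l' => [/\ O (s, l'), O (s, l) & `|j (s, l) - j (s, l')| <= e]) (@segment_compact _ _ _).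
  move=> s; rewrite /= in_itv /= => s01; have Os := OU _ _ Ul s01.
  have /cvgrPdist_lt/(_ _ e2) h := cj _ Os.
  have hO := open_nbhs_nbhs (conj oO Os).
  have cf : (z.1, l) @[z --> (s, l)] --> (s, l).
    exact: (cvg_pair (f := fst) (g := fun=> l) cvg_fst (cvg_cst l)).
  have hO' : \forall z \near (s, l), O (z.1, l) := cf _ hO.
  have h' : \forall z \near (s, l), `|j (s, l) - j (z.1, l)| < e / 2 := cf _ h.
  apply: filterS (filterI (filterI hO hO') (filterI h h')).
  move=> [s' l'] [] /= [k1 k2] [h1 h2]; split => //.
  rewrite -(subrKA (j (s, l))) [e]splitr ltW// (le_lt_trans (ler_normD _ _))// ltrD//.
  by rewrite distrC.
apply: (iffRL (nbhs_normlP (l : V) _)); exists r => // l' l'r.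
have rP' s : 0 <= s <= 1 -> [/\ O (s, l'), O (s, l) & `|j (s, l) - j (s, l')| <= e].
  by move=> s01; apply: rP => //=; rewrite in_itv.
have c1 s : 0 <= s <= 1 -> {for s, continuous (fun s => j (s, l))}.
  by move=> /rP'[_ /cs].
have c2 s : 0 <= s <= 1 -> {for s, continuous (fun s => -1 * j (s, l'))}.
  by move=> /rP'[/cs c _ _]; apply: cvgM; [exact: cvg_cst|exact: c].
have c3 s : 0 <= s <= 1 -> {for s, continuous (fun s => j (s, l'))}.
  by move=> /rP'[/cs].
rewrite -mulN1r -(I01Z (-1) c3) -(I01D c1 c2).
apply: I01_bound => s s01; first by apply: cvgD; [exact: c1|exact: c2].
by rewrite mulN1r; have [] := rP' s s01.
Qed.

(** Derivatives with respect to the parameter are integrals of the same kind, with integrand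
    ['D_b j], so the induction on [n] applies to them. *)
Lemma class_C_I01 n (O : set (R * (R * R * R))) (U : set (R * R * R))
    (j : R * (R * R * R) -> R) : open O -> open U ->
  (forall l s, U l -> 0 <= s <= 1 -> O (s, l)) -> class_C n O j ->
  class_C n U (fun l => I01 (fun s => j (s, l))).
Proof.
move=> oO oU OU; elim: n j => [|n IH] j.
  by move=> cj l Ul; exact: (continuous_I01 oO OU cj).
move=> Cj; have [dj Dj] := Cj.
pose b1 : R * (R * R * R) := (0, (1, 0, 0)).
pose b2 : R * (R * R * R) := (0, (0, 1, 0)).
pose b3 : R * (R * R * R) := (0, (0, 0, 1)).
pose J l := I01 (fun s => j (s, l)).
pose c b l := I01 (fun s => 'D_b j (s, l)).
have cs (g : R * (R * R * R) -> R) l s : {for (s, l), continuous g} ->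
    {for s, continuous (fun s => g (s, l))}.
  move=> cg; apply: (@continuous_comp _ _ _ (fun s => (s, l)) g) => //.
  by apply: differentiable_continuous; have [] := is_diff_pairl l s.
have cj l : U l -> forall s, 0 <= s <= 1 -> {for s, continuous (fun s => j (s, l))}.
  by move=> Ul s s01; apply: (cs j); apply: differentiable_continuous; apply: dj; exact: OU.
have cD b l : U l -> forall s, 0 <= s <= 1 -> {for s, continuous (fun s => 'D_b j (s, l))}.
  by move=> Ul s s01; apply: (cs ('D_b j)); apply: (class_C_continuous (Dj b)); exact: OU.
have C01Z (a : R) (g : R -> R) : (forall s, 0 <= s <= 1 -> {for s, continuous g}) ->
    forall s : R, 0 <= s <= 1 -> {for s, continuous (fun s => a * g s : R)}.
  by move=> cg s s01; apply: cvgM; [exact: cvg_cst|exact: cg].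
have C01D (f g : R -> R) : (forall s, 0 <= s <= 1 -> {for s, continuous f}) ->
    (forall s, 0 <= s <= 1 -> {for s, continuous g}) ->
    forall s : R, 0 <= s <= 1 -> {for s, continuous (fun s => f s + g s : R)}.
  by move=> cf cg s s01; apply: cvgD; [exact: cf|exact: cg].
have key l : U l -> differentiable J l /\
    forall v, 'D_v J l = lin3 (c b1 l) (c b2 l) (c b3 l) v.
  move=> Ul; apply: differentiable3 => e e0.
  have e3 : 0 < e / 3 by rewrite divr_gt0.
  (* The segment [[0, 1] x {l}] is a compact part of [O], so one radius [d] serves the expansions of
     [j] at all [(s, l)]. *)
  have cK : compact ([set` `[0, 1]] `*` [set l] : set (R * (R * R * R))).
    by apply: compact_setX; [exact: segment_compact|exact: compact_set1].
  have KO : [set` `[0, 1]] `*` [set l] `<=` O.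
    by move=> [s l'] [/= + ->]; rewrite in_itv /= => s01; exact: OU.
  have Cj1 : class_C 1 O j by split => // v; exact: (class_C_continuous (Dj v)).
  have [d d0 dP] := uniform_differentiable b1 b2 b3 cK oO KO Cj1 e3.
  apply: (iffRL (nbhs_normlP (0 : R * R * R) _)); exists d => // h; rewrite subr0 => hd.
  have [n1 n2 n3] := norm3_le h.
  have hP s : 0 <= s <= 1 -> O (s, h + l) /\
      `|j (s, h + l) - j (s, l) - (h.1.1 * 'D_b1 j (s, l) + h.1.2 * 'D_b2 j (s, l)
         + h.2 * 'D_b3 j (s, l))| <= e * `|h|.
    move=> s01.
    have [||||] := dP (s, l) h.1.1 h.1.2 h.2.
    - by split => //=; rewrite in_itv.
    - exact: le_lt_trans hd.
    - exact: le_lt_trans hd.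
    - exact: le_lt_trans hd.
    have -> : (s, l) + (h.1.1 *: b1 + h.1.2 *: b2 + h.2 *: b3) = (s, h + l).
      case: (h) => -[x y] z /=; rewrite [LHS]surjective_pairing.
      congr (_, _); first by rewrite /= /GRing.scale /= !mulr0 !addr0.
      by rewrite [RHS]addrC (triple_basis x).
    move=> Oh Bh; split => //; apply: le_trans Bh _.
    rewrite -mulrA ler_wpM2l ?(ltW e0)//.
    by move: n1 n2 n3; move: `|h| `|_| `|_| `|_| => *; lra.
  have cjh s : 0 <= s <= 1 -> {for s, continuous (fun s => j (s, h + l))}.
    by move=> /hP[Oh _]; apply: (cs j); apply: differentiable_continuous; exact: dj.
  have -> : J (h + l) - J l - lin3 (c b1 l) (c b2 l) (c b3 l) h =
    I01 (fun s => j (s, h + l) + -1 * j (s, l) + (- h.1.1 * 'D_b1 j (s, l)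
       + - h.1.2 * 'D_b2 j (s, l) + - h.2 * 'D_b3 j (s, l))).
    have E1 := C01Z (-1) _ (cj l Ul); have E2 := C01D _ _ cjh E1.
    have D1 := C01Z (- h.1.1) _ (cD b1 l Ul); have D2 := C01Z (- h.1.2) _ (cD b2 l Ul).
    have D3 := C01Z (- h.2) _ (cD b3 l Ul).
    have D12 := C01D _ _ D1 D2.
    rewrite (I01D E2 (C01D _ _ D12 D3)) (I01D cjh E1) (I01D D12 D3) (I01D D1 D2).
    have Z0 := esym (I01Z (-1) (cj l Ul)); have Z1 := esym (I01Z (- h.1.1) (cD b1 l Ul)).
    have Z2 := esym (I01Z (- h.1.2) (cD b2 l Ul)).
    have Z3 := esym (I01Z (- h.2) (cD b3 l Ul)).
    transitivity (J (h + l) + -1 * J l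
        + (- h.1.1 * c b1 l + - h.1.2 * c b2 l + - h.2 * c b3 l)).
      rewrite /lin3; move: (J _) (J _) (c _ _) (c _ _) (c _ _) => x1 x2 x3 x4 x5.
      by ring.
    exact: (congr2 +%R (congr2 +%R erefl Z0) (congr2 +%R (congr2 +%R Z1 Z2) Z3)).
  apply: I01_bound.
    have D12 := C01D _ _ (C01Z (- h.1.1) _ (cD b1 l Ul)) (C01Z (- h.1.2) _ (cD b2 l Ul)).
    exact: (C01D _ _ (C01D _ _ cjh (C01Z (-1) _ (cj l Ul)))
      (C01D _ _ D12 (C01Z (- h.2) _ (cD b3 l Ul)))).
  move=> s /hP[_]; apply: le_trans; rewrite le_eqVlt; apply/orP; left; apply/eqP.
  congr (`| _ |).
  move: (j _) (j _) ('D_b1 j _) ('D_b2 j _) ('D_b3 j _) => x1 x2 x3 x4 x5.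
  by ring.
split=> [l /key[]//|v].
have Cc b : class_C n U (c b) := IH _ (Dj b).
apply: eq_class_C (class_CD oU (class_CD oU (class_CM oU (class_C_cst n U v.1.1) (Cc b1))
  (class_CM oU (class_C_cst n U v.1.2) (Cc b2))) (class_CM oU (class_C_cst n U v.2) (Cc b3))) => //.
by move=> l /key[_ ->].
Qed.

End Uniform.

Lemma convex_norm_lt (R : realFieldType) (a b r s : R) : `|a| < r -> `|b| < r ->
  0 <= s <= 1 -> `|s * a + (1 - s) * b| < r.
Proof.
move=> ar br /andP[s0 s1].
have mr : Num.max `|a| `|b| < r by rewrite gt_max ar.
have am : `|a| <= Num.max `|a| `|b| by rewrite le_max lexx.
have bm : `|b| <= Num.max `|a| `|b| by rewrite le_max lexx orbT.
apply: le_lt_trans mr; apply: le_trans (ler_normD _ _) _.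
rewrite !normrM (ger0_norm s0) (@ger0_norm _ (1 - s)) ?subr_ge0//.
apply: le_trans (lerD (ler_wpM2l s0 am) (ler_wpM2l _ bm)) _; first by rewrite subr_ge0.
by rewrite -mulrDl addrC subrK mul1r.
Qed.

(** Here [h] is the direction of the segment, [k] the displacement of its end, and [Hp], [ep] resp.
    [H2], [e2] are the values of the two fields before and after. The terms linear in [k] cancel
    exactly because of the compatibility condition; two Taylor remainders and a quadratic term are
    left. *)
Lemma leaf_defect_bound (R : realFieldType)
    (h1 h2 k1 k2 s D E Hp Ht Hx Hu ep et ex eu H2 e2 a b N : R) :
  let dd := s * (k1 * Hp + k2 * ep) + D * E in
  let linH := s * k1 * Ht + s * k2 * Hx + dd * Hu in
  let line := s * k1 * et + s * k2 * ex + dd * eu in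
  et + Hp * eu = Hx + ep * Hu ->
  `|h1| <= 1 -> `|h2| <= 1 -> `|k1| <= N -> `|k2| <= N -> N <= 1 ->
  `|H2 - Hp - linH| <= a -> `|e2 - ep - line| <= a -> `|linH| <= b -> `|line| <= b ->
  `|(h1 + k1) * H2 + (h2 + k2) * e2
    - (h1 * Hp + h2 * ep + (k1 * Hp + k2 * ep)
       + s * (k1 * (h1 * Ht + h2 * Hx + (h1 * Hp + h2 * ep) * Hu)
              + k2 * (h1 * et + h2 * ex + (h1 * Hp + h2 * ep) * eu))
       + D * ((h1 * Hu + h2 * eu) * E))| <= 4 * a + 2 * N * b.
Proof.
move=> dd linH line comp h11 h21 k1N k2N N1 ra rb lb1 lb2.
have etE : et = Hx + ep * Hu - Hp * eu by rewrite -comp addrK.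
rewrite [X in `|X|](_ : _ = (h1 + k1) * (H2 - Hp - linH) + (h2 + k2) * (e2 - ep - line)
  + (k1 * linH + k2 * line)); last by rewrite /line /linH /dd etE; ring.
have hk (h k : R) : `|h| <= 1 -> `|k| <= N -> `|h + k| <= 2.
  move=> h1' kN; apply: le_trans (ler_normD _ _) _.
  by rewrite -[2]/(1 + 1); apply: lerD => //; exact: le_trans N1.
have m1 : `|(h1 + k1) * (H2 - Hp - linH)| <= 2 * a by rewrite normrM ler_pM// hk.
have m2 : `|(h2 + k2) * (e2 - ep - line)| <= 2 * a by rewrite normrM ler_pM// hk.
have m3 : `|k1 * linH| <= N * b by rewrite normrM ler_pM.
have m4 : `|k2 * line| <= N * b by rewrite normrM ler_pM.
have -> : 4 * a + 2 * N * b = 2 * a + 2 * a + (N * b + N * b) by ring.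
apply: le_trans (ler_normD _ _) _; apply: lerD.
  by apply: le_trans (ler_normD _ _) _; exact: lerD.
by apply: le_trans (ler_normD _ _) _; exact: lerD.
Qed.

Lemma quarter_half_le (R : realFieldType) (x y : R) :
  x <= y / 4 -> 4 * (y / 8) + 2 * x <= y.
Proof. by lra. Qed.

Lemma unit_lt2 (R : realFieldType) (s : R) : 0 <= s <= 1 -> `|s| < 2.
Proof. by move=> /andP[s0 s1]; rewrite ger0_norm//; lra. Qed.

(** * The integral surface obtained by integrating along segments *)

Section Leaf.
Context {R : realType} (t0 x0 u0 : R) (H eta : R * R * R -> R) (r M d : R).
Implicit Types (s y : R) (p z v : R * R * R).

Let U : set (R * R * R) := [set p | `|p - (t0, x0, u0)| < r].
Let W : set (R * R * R) := [set p | `|p - (t0, x0, u0)| < d].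

Context (M1 : 1 <= M) (d0 : 0 < d) (d1 : d <= 1) (dr : d <= r / 4)
  (dM : 8 * M * d <= 1) (dMr : 16 * M * d <= r).
Context (CH : forall n, class_C n U H) (Ceta : forall n, class_C n U eta).
Context (bH : forall p, U p -> [/\ `|H p| <= M, `|dt H p| <= M, `|dx H p| <= M & `|du H p| <= M]).
Context (beta : forall p, U p ->
  [/\ `|eta p| <= M, `|dt eta p| <= M, `|dx eta p| <= M & `|du eta p| <= M]).
Context (compat : forall p, U p ->
  dt eta p + H p * du eta p = dx H p + eta p * du H p).

Lemma ball3E (e : R) p : `|p - (t0, x0, u0)| < e <->
  [/\ `|p.1.1 - t0| < e, `|p.1.2 - x0| < e & `|p.2 - u0| < e].
Proof.
case: p => -[t x] u.
rewrite (_ : (t, x, u) - (t0, x0, u0) = (t - t0, x - x0, u - u0))// !normr_pair_lt /=.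
by split=> [/andP[/andP[]]//|[-> -> ->]].
Qed.

Let inU p : U p <-> [/\ `|p.1.1 - t0| < r, `|p.1.2 - x0| < r & `|p.2 - u0| < r].
Proof. exact: ball3E. Qed.

Let inW p : W p <-> [/\ `|p.1.1 - t0| < d, `|p.1.2 - x0| < d & `|p.2 - u0| < d].
Proof. exact: ball3E. Qed.

(** Points at height [y] above the segment from [(t0, x0)] to [z.1]. On this segment the system
    becomes the scalar equation [y' = F z s y]. *)
Let path z s y : R * R * R := (t0 + s * (z.1.1 - t0), x0 + s * (z.1.2 - x0), y).

Let F z s y : R := (z.1.1 - t0) * H (path z s y) + (z.1.2 - x0) * eta (path z s y).

Let oU : open U. Proof. exact: open_norm_lt. Qed.
Let oW : open W. Proof. exact: open_norm_lt. Qed.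

Lemma leaf_path_in z s y : W z -> `|s| <= 2 -> `|y - u0| < r -> U (path z s y).
Proof.
move=> /inW[h1 h2 _] s2 yr; have dr2 : 2 * d < r by move: dr d0; lra.
have sm a : `|a| < d -> `|s * a| < r.
  by move=> ad; rewrite normrM (le_lt_trans _ dr2)// ler_pM// ltW.
by apply/inU; split => //=; rewrite addrAC subrr add0r; exact: sm.
Qed.

Lemma leaf_lip (G : R * R * R -> R) t x y y' : (forall n, class_C n U G) ->
  (forall p, U p -> `|du G p| <= M) -> U (t, x, y) -> U (t, x, y') ->
  `|G (t, x, y) - G (t, x, y')| <= M * `|y - y'|.
Proof.
move=> CG bG U1 U2.
have e1 : (t, x, y') + (0, 0, y - y') = (t, x, y).
  by rewrite -[LHS]/(t + 0, x + 0, y' + (y - y')) !addr0 addrCA subrr addr0.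
have Us (s : R) : 0 <= s <= 1 -> U ((t, x, y') + s *: ((0, 0, y - y') : R * R * R)).
  move=> /andP[s0 s1]; move: U1 U2 => /inU[/= h1 h2 h3] /inU[/= h4 h5 h6].
  rewrite -[_ + _]/(t + s * 0, x + s * 0, y' + s * (y - y')) !mulr0 !addr0.
  apply/inU; split; [exact: h1|exact: h2|rewrite /=].
  have -> : y' + s * (y - y') - u0 = s * (y - u0) + (1 - s) * (y' - u0) by ring.
  apply: convex_norm_lt; [exact: h3|exact: h6|].
  by apply/andP; split.
have [dG _] := CG 1%N.
have [|s s01] := @MVT_line _ _ G (t, x, y') (0, 0, y - y').
  by move=> s /Us; exact: dG.
rewrite e1 => ->.
have -> : ((0, 0, y - y') : R * R * R) = (y - y') *: ((0, 0, 1) : R * R * R).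
  by rewrite -[RHS]/((y - y') * 0, (y - y') * 0, (y - y') * 1) !mulr0 mulr1.
have Up := Us s s01.
have -> : 'D_((y - y') *: ((0, 0, 1) : R * R * R)) G
   ((t, x, y') + s *: ((y - y') *: ((0, 0, 1) : R * R * R))) =
   (y - y') * du G ((t, x, y') + s *: ((0, 0, y - y') : R * R * R)).
  have e2 : ((y - y') *: ((0, 0, 1) : R * R * R)) = (0, 0, y - y').
    by rewrite -[LHS]/((y - y') * 0, (y - y') * 0, (y - y') * 1) !mulr0 mulr1.
  by rewrite deriveZv e2//; exact: dG.
by rewrite normrM mulrC ler_wpM2r// bG.
Qed.

Lemma leaf_field_lip z s y y' : W z -> `|s| <= 2 -> `|y - u0| < r -> `|y' - u0| < r ->
  `|F z s y - F z s y'| <= 2 * M * d * `|y - y'|.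
Proof.
move=> Wz s2 yr y'r; have U1 := leaf_path_in Wz s2 yr; have U2 := leaf_path_in Wz s2 y'r.
have h1 : `|H (path z s y) - H (path z s y')| <= M * `|y - y'|.
  by apply: leaf_lip => // p /bH[].
have h2 : `|eta (path z s y) - eta (path z s y')| <= M * `|y - y'|.
  by apply: leaf_lip => // p /beta[].
have /inW[k1 k2 _] := Wz; rewrite /F.
have m1 : `|(z.1.1 - t0) * (H (path z s y) - H (path z s y'))| <= d * (M * `|y - y'|).
  by rewrite normrM ler_pM// ltW.
have m2 : `|(z.1.2 - x0) * (eta (path z s y) - eta (path z s y'))| <= d * (M * `|y - y'|).
  by rewrite normrM ler_pM// ltW.
have -> : 2 * M * d * `|y - y'| = d * (M * `|y - y'|) + d * (M * `|y - y'|) by ring.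
apply: le_trans (lerD m1 m2); apply: le_trans (ler_normD _ _).
by rewrite le_eqVlt; apply/orP; left; apply/eqP; congr (`| _ |); rewrite !mulrBr; ring.
Qed.

Lemma leaf_field_bound z s y : W z -> `|s| <= 2 -> `|y - u0| < r ->
  `|F z s y| <= 2 * M * d.
Proof.
move=> Wz s2 yr; have U1 := leaf_path_in Wz s2 yr.
have [h1 _ _ _] := bH U1; have [h2 _ _ _] := beta U1.
have /inW[k1 k2 _] := Wz.
have m1 : `|(z.1.1 - t0) * H (path z s y)| <= d * M by rewrite normrM ler_pM// ltW.
have m2 : `|(z.1.2 - x0) * eta (path z s y)| <= d * M by rewrite normrM ler_pM// ltW.
apply: le_trans (ler_normD _ _) _; have := lerD m1 m2.
by move/le_trans; apply; rewrite le_eqVlt; apply/orP; left; apply/eqP; ring.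
Qed.

Lemma is_derive_affine_path (a b s : R) : is_derive s 1 (fun s : R => a + s * b) b.
Proof.
apply: is_derive_eq (is_derive_addf (is_derive_cst a s 1) (is_derive_mulf (is_derive_id s 1) (is_derive_cst b s 1))) _.
by rewrite mulr0 add0r add0r mulr1.
Qed.

Lemma leaf_path_derive z s (y : R -> R) y' : is_derive s 1 y y' ->
  is_derive s 1 (fun s => path z s (y s)) (z.1.1 - t0, z.1.2 - x0, y').
Proof.
by move=> dy; apply: is_derive_pair => //; apply: is_derive_pair; exact: is_derive_affine_path.
Qed.

Let solves z (y : R -> R) := [/\ y 0 = z.2,
  forall s, `|s| < 2 -> is_derive s 1 y (F z s (y s)) &
  forall s, `|s| < 2 -> `|y s - u0| <= r / 2].

Lemma leaf_ode z : W z -> exists y : R -> R, solves z y.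
Proof.
move=> Wz; have /inW[k1 k2 k3] := Wz.
have r0 : 0 < r by move: dr d0; lra.
have rr : r / 2 < r by move: r0; lra.
have Md : 0 <= M * d by rewrite mulr_ge0// ltW// (lt_le_trans ltr01).
(* Time radius 2 keeps [[0, 1]] inside the open interval of existence. The contraction condition is
   [2 * (2 * M * d) <= 1/2], from [dM]; [dr] and [dMr] give [d + 4 * M * d <= r / 2]. *)
have [|||||||||y [y0 dy yb]] := @picard R (F z) u0 z.2 (r / 2) (2 * M * d) (2 * M * d) 2.
- by [].
- by rewrite divr_ge0// ltW.
- by rewrite -mulrA mulr_ge0.
- by rewrite -mulrA mulr_ge0.
- have h2 : 8 * (M * d) <= 1 by rewrite mulrA.
  by rewrite -mulrA; move: h2; lra.
- have h1 : 2 * M * d * 2 = 4 * (M * d) by ring.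
  have h2 : 16 * (M * d) <= r by rewrite mulrA.
  by rewrite h1; move: dr k3 h2; lra.
- move=> s y s2 yr; have Up := leaf_path_in Wz s2 (le_lt_trans yr rr).
  have cp : {for s, continuous (fun s => path z s y)}.
    have [/derivable1_diffP dp _] := @leaf_path_derive z s (cst y) 0 (is_derive_cst y s 1).
    exact: differentiable_continuous dp.
  apply: cvgD; apply: cvgM; try exact: cvg_cst.
    apply: (@continuous_comp _ _ _ (fun s => path z s y) H) => //.
    exact: (class_C_continuous (CH 0)).
  apply: (@continuous_comp _ _ _ (fun s => path z s y) eta) => //.
  exact: (class_C_continuous (Ceta 0)).
- by move=> s y s2 yr; apply: leaf_field_bound => //; exact: le_lt_trans rr.
- move=> s y y' s2 yr y'r; apply: leaf_field_lip => //; exact: le_lt_trans rr.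
by exists y; split => // s /yb[].
Qed.

Definition leaf_solution z : R -> R := xget (fun=> 0) (solves z).
Let Y := leaf_solution.

Lemma leaf_solutionP z : W z -> solves z (Y z).
Proof. by move=> /leaf_ode[y yP]; rewrite /Y /leaf_solution; case: xgetP => // /(_ y). Qed.

(* The time-one value of the solution along the segment from [(t0, x0)] to [z.1] starting at [z.2]. *)
Definition leaf z : R := leaf_solution z 1.
Let f := leaf.

(** The coefficient of the equation linearised along [Y z], that is, the derivative of [F z s] in
    [y]. A variation of the initial value is multiplied by the exponential of its integral. *)
Let b z s : R := (z.1.1 - t0) * du H (path z s (Y z s))
  + (z.1.2 - x0) * du eta (path z s (Y z s)).

Let r0 : 0 < r. Proof. by move: dr d0; lra. Qed.
Let rr : r / 2 < r. Proof. by move: r0; lra. Qed.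

Lemma leaf_curve_in z s : W z -> 0 <= s <= 1 -> U (path z s (Y z s)).
Proof.
move=> Wz /andP[s0 s1]; have [_ _ yb] := leaf_solutionP Wz.
have s2 : `|s| < 2 by rewrite ger0_norm//; move: s1; lra.
by apply: leaf_path_in => //; [exact: ltW|exact: le_lt_trans (yb s s2) rr].
Qed.

Lemma leaf_solution_derive z s : W z -> 0 <= s <= 1 ->
  is_derive s 1 (Y z) (F z s (Y z s)).
Proof.
move=> Wz /andP[s0 s1]; have [_ dy _] := leaf_solutionP Wz.
by apply: dy; rewrite ger0_norm//; move: s1; lra.
Qed.

Let unit_bound z : W z -> `|z.1.1 - t0| <= 1 /\ `|z.1.2 - x0| <= 1.
Proof.
by move=> /inW[h1 h2 _]; split; apply: le_trans d1; exact: ltW.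
Qed.

Let Md1 : 2 * M * d <= 1.
Proof. by move: dM M1 d0 => h1 h2 h3; have := mulr_gt0 (lt_le_trans ltr01 h2) h3; move: h1; rewrite -!mulrA; move: (M * d) => x; lra. Qed.

Lemma leaf_slope_bound z s : W z -> 0 <= s <= 1 -> `|b z s| <= 1.
Proof.
move=> Wz s01; have Up := leaf_curve_in Wz s01.
have [_ _ _ h1] := bH Up; have [_ _ _ h2] := beta Up; have /inW[k1 k2 _] := Wz.
have m1 : `|(z.1.1 - t0) * du H (path z s (Y z s))| <= d * M by rewrite normrM ler_pM// ltW.
have m2 : `|(z.1.2 - x0) * du eta (path z s (Y z s))| <= d * M by rewrite normrM ler_pM// ltW.
apply: le_trans (ler_normD _ _) _; apply: le_trans (lerD m1 m2) _.
by apply: le_trans Md1; rewrite le_eqVlt; apply/orP; left; apply/eqP; ring.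
Qed.

Lemma leaf_curve_continuous z s : W z -> 0 <= s <= 1 ->
  {for s, continuous (fun s => path z s (Y z s))}.
Proof.
move=> Wz s01.
have [/derivable1_diffP dp _] := leaf_path_derive z (leaf_solution_derive Wz s01).
exact: differentiable_continuous dp.
Qed.

Lemma leaf_slope_continuous z s : W z -> 0 <= s <= 1 -> {for s, continuous (b z)}.
Proof.
move=> Wz s01; have Up := leaf_curve_in Wz s01; have cp := leaf_curve_continuous Wz s01.
apply: cvgD; apply: cvgM; try exact: cvg_cst.
  apply: (@continuous_comp _ _ _ (fun s => path z s (Y z s)) (du H)) => //.
  by have [_ /(_ (0, 0, 1)) c] := CH 1; exact: c.
apply: (@continuous_comp _ _ _ (fun s => path z s (Y z s)) (du eta)) => //.
by have [_ /(_ (0, 0, 1)) c] := Ceta 1; exact: c.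
Qed.

Lemma path1 z y : path z 1 y = (z.1, y).
Proof.
rewrite /path !mul1r; congr (_, _); rewrite [z.1]surjective_pairing /=.
by congr (_, _); rewrite addrC subrK.
Qed.

Lemma leaf_composite_derive (G : R * R * R -> R) z s : (forall n, class_C n U G) ->
  W z -> 0 <= s <= 1 -> is_derive s 1 (fun s => G (path z s (Y z s)))
    ((z.1.1 - t0) * dt G (path z s (Y z s)) + (z.1.2 - x0) * dx G (path z s (Y z s))
     + F z s (Y z s) * du G (path z s (Y z s))).
Proof.
move=> CG Wz s01; have dG : differentiable G (path z s (Y z s)).
  by have [dG _] := CG 1%N; apply: dG; exact: leaf_curve_in.
apply: is_derive_eq (is_derive_curve (leaf_path_derive z (leaf_solution_derive Wz s01)) dG) _.
by rewrite derive3E.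
Qed.

(** The solution belonging to [v + z] is compared with the trial curve [Y z + g], where [g] is
    linear in [v]. The trial curve satisfies the displaced equation up to a small multiple of [|v|]
    and has the right initial value, so the Gronwall estimate bounds the difference at time one. *)
Lemma leaf_differentiable z : W z -> differentiable f z /\
  forall v, 'D_v f z = lin3 (H (z.1, f z)) (eta (z.1, f z)) (expR (I01 (b z))) v.
Proof.
move=> Wz; apply: differentiable3 => e0 e00.
have [a [a0 a1 da]] := I01P (fun s s01 => leaf_slope_continuous Wz s01).
pose p s := path z s (Y z s); pose E s := expR (a s).
have dE s : 0 <= s <= 1 -> is_derive s 1 E (b z s * E s).
  by move=> s01; apply: is_derive_expR_comp; exact: da.
have E01 s : 0 <= s <= 1 -> `|E s| <= expR 1.
  move=> /andP[s0 s1]; rewrite ger0_norm ?expR_ge0// ler_expR.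
  have sub t : 0 <= t <= s -> 0 <= t <= 1.
    by move=> /andP[-> ts]; rewrite (le_trans ts).
  have := ler_dist_derive s0 (fun t ts => da t (sub t ts))
    (fun t ts => leaf_slope_bound Wz (sub t ts)).
  by rewrite a0 !subr0 mul1r => /(le_trans (ler_norm _))/le_trans; apply.
(* [C * N] bounds the variation [g], [C1 * N] the sum of the three increments, and [X] is the
   Gronwall factor over unit time. The choices of [e] and [t] make the Taylor remainders and the
   quadratic term contribute at most [e1 * N / 2] each. *)
pose C := 2 * M + expR 1; pose C1 := 2 + C.
have C0 : 0 < C by rewrite addr_gt0 ?expR_gt0// mulr_gt0// (lt_le_trans ltr01).
have C10 : 0 < C1 by rewrite addr_gt0.
pose X := expR ((2 * (2 * M * d) + 1) * 1 : R).
have X0 : 0 < X by exact: expR_gt0.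
pose e1 := e0 / X; have e10 : 0 < e1 by rewrite divr_gt0.
pose e := e1 / (8 * C1); have e_gt0 : 0 < e by rewrite divr_gt0// mulr_gt0.
have M0 : 0 < M by exact: lt_le_trans M1.
have cK : compact (p @` `[0, 1]).
  apply: continuous_compact; last exact: segment_compact.
  apply: continuous_in_subspaceT => s; rewrite inE /= in_itv /=.
  exact: leaf_curve_continuous.
have KU : p @` `[0, 1] `<=` U.
  by move=> _ [s + <-]; rewrite /= in_itv /=; exact: leaf_curve_in.
pose b1 : R * R * R := (1, 0, 0); pose b2 : R * R * R := (0, 1, 0).
pose b3 : R * R * R := (0, 0, 1).
have [dH dH0 dHP] := uniform_differentiable b1 b2 b3 cK oU KU (CH 1) e_gt0.
have [de de0 deP] := uniform_differentiable b1 b2 b3 cK oU KU (Ceta 1) e_gt0.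
have [w w0 wP] := open_normlP oW Wz.
pose dd := Num.min dH de.
have dd0 : 0 < dd by rewrite lt_min dH0.
pose t := Num.min (Num.min 1 w) (Num.min (dd / C1) (e1 / (4 * M * C1))).
have t_gt0 : 0 < t by rewrite !lt_min ltr01 w0 !divr_gt0// !mulr_gt0.
apply: (iffRL (nbhs_normlP (0 : R * R * R) _)); exists t => // v; rewrite subr0.
rewrite !lt_min => /andP[/andP[v1 vw] /andP[vd ve]].
have [n1 n2 n3] := norm3_le v.
pose N := `|v|; rewrite -/N in v1 vw vd ve n1 n2 n3.
have N0 : 0 <= N by exact: normr_ge0.
pose k1 := v.1.1; pose k2 := v.1.2; pose D := v.2.
rewrite -/k1 -/k2 -/D in n1 n2 n3.
have Wz2 : W (v + z) by apply: wP; rewrite addrK.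
pose h1 := z.1.1 - t0; pose h2 := z.1.2 - x0.
have [h11 h21] := unit_bound Wz; rewrite -/h1 -/h2 in h11 h21.
(* The trial variation: at parameter [s] the path is displaced by [(s * k1, s * k2)] and the height
   follows the leaf to first order, while the change [D] of the initial value is transported by the
   linearised equation. *)
pose g s := s * (k1 * H (p s) + k2 * eta (p s)) + D * E s.
pose Z s := Y z s + g s.
pose Z' s := h1 * H (p s) + h2 * eta (p s) + (k1 * H (p s) + k2 * eta (p s))
   + s * (k1 * (h1 * dt H (p s) + h2 * dx H (p s) + (h1 * H (p s) + h2 * eta (p s)) * du H (p s))
      + k2 * (h1 * dt eta (p s) + h2 * dx eta (p s) + (h1 * H (p s) + h2 * eta (p s)) * du eta (p s)))
   + D * ((h1 * du H (p s) + h2 * du eta (p s)) * E s).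
have dZ s : 0 <= s <= 1 -> is_derive s 1 Z (Z' s).
  move=> s01; have dy := leaf_solution_derive Wz s01.
  have dHp := leaf_composite_derive CH Wz s01.
  have dep := leaf_composite_derive Ceta Wz s01.
  have dk1 := is_derive_mulf (is_derive_cst k1 s 1) dHp; have dk2 := is_derive_mulf (is_derive_cst k2 s 1) dep.
  have dDE := is_derive_mulf (is_derive_cst D s 1) (dE s s01).
  apply: is_derive_eq (is_derive_addf dy (is_derive_addf (is_derive_mulf (is_derive_id s 1) (is_derive_addf dk1 dk2)) dDE)) _.
  rewrite /Z' /F /cst /b -/(p s) -/h1 -/h2 /=.
  move: (H _) (eta _) (dt H _) (dx H _) (du H _) (dt eta _) (dx eta _) (du eta _) (E s).
  by move=> *; ring.
have gC s : 0 <= s <= 1 -> `|g s| <= C * N.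
  move=> s01; have [bh _ _ _] := bH (leaf_curve_in Wz s01).
  have [be _ _ _] := beta (leaf_curve_in Wz s01).
  have m1 : `|k1 * H (p s)| <= N * M by rewrite normrM ler_pM.
  have m2 : `|k2 * eta (p s)| <= N * M by rewrite normrM ler_pM.
  have m3 : `|D * E s| <= N * expR 1 by rewrite normrM ler_pM// E01.
  have -> : C * N = (N * M + N * M) + N * expR 1 by rewrite /C; ring.
  apply: le_trans (ler_normD _ _) _; apply: lerD => //.
  rewrite normrM; apply: le_trans (_ : `|k1 * H (p s) + k2 * eta (p s)| <= _).
    by apply: ler_piMl => //; have /andP[s0 s1] := s01; rewrite ger0_norm.
  by apply: le_trans (ler_normD _ _) _; exact: lerD.
have sk s k : 0 <= s <= 1 -> `|k| <= N -> `|s * k| <= N.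
  move=> /andP[s0 s1] kN; rewrite normrM ger0_norm//; apply: le_trans kN.
  exact: ler_piMl.
have Ndd (x : R) : `|x| <= C1 * N -> `|x| < dd.
  by move=> /le_lt_trans; apply; rewrite mulrC -ltr_pdivlMr.
have NC1 (x : R) : `|x| <= N -> `|x| <= C1 * N.
  move=> /le_trans; apply; rewrite ler_peMl// /C1; move: C0; move: (C) => c; lra.
have NC (x : R) : `|x| <= C * N -> `|x| <= C1 * N.
  by move=> /le_trans; apply; rewrite ler_wpM2r// /C1 lerDr.
have pE s : p s + (s * k1 *: b1 + s * k2 *: b2 + g s *: b3) = path (v + z) s (Z s).
  rewrite -[LHS]/(t0 + s * h1 + (s * k1 * 1 + s * k2 * 0 + g s * 0),
    x0 + s * h2 + (s * k1 * 0 + s * k2 * 1 + g s * 0),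
    Y z s + (s * k1 * 0 + s * k2 * 0 + g s * 1)).
  rewrite /path /Z -[(v + z).1.1]/(k1 + z.1.1) -[(v + z).1.2]/(k2 + z.1.2).
  rewrite /h1 /h2 !(mulr0, mulr1, add0r, addr0).
  by congr (_, _, _); ring.
have step s : 0 <= s <= 1 -> U (path (v + z) s (Z s)) /\
    `|F (v + z) s (Z s) - Z' s| <= e1 * N.
  move=> s01; have Up := leaf_curve_in Wz s01.
  have Kp : (p @` `[0, 1]) (p s) by exists s => //; rewrite /= in_itv.
  have g1 := gC s s01; have sk1 := sk s k1 s01 n1; have sk2 := sk s k2 s01 n2.
  have bnd (x : R) : `|x| < dd -> `|x| < dH /\ `|x| < de.
    by rewrite /dd lt_min => /andP[].
  have [sk1H sk1e] := bnd _ (Ndd _ (NC1 _ sk1)).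
  have [sk2H sk2e] := bnd _ (Ndd _ (NC1 _ sk2)).
  have [gH ge] := bnd _ (Ndd _ (NC _ g1)).
  have [U2 rH] := dHP (p s) (s * k1) (s * k2) (g s) Kp sk1H sk2H gH.
  have [_ re] := deP (p s) (s * k1) (s * k2) (g s) Kp sk1e sk2e ge.
  rewrite pE in U2 rH re; split => //.
  have sum3 : `|s * k1| + `|s * k2| + `|g s| <= C1 * N.
    have -> : C1 * N = N + N + C * N by rewrite /C1; ring.
    by apply: lerD => //; exact: lerD.
  have rH' := le_trans rH (ler_wpM2l (ltW e_gt0) sum3).
  have re' := le_trans re (ler_wpM2l (ltW e_gt0) sum3).
  have lin (x1 x2 x3 : R) : `|x1| <= M -> `|x2| <= M -> `|x3| <= M ->
      `|s * k1 * x1 + s * k2 * x2 + g s * x3| <= M * (C1 * N).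
    move=> l1 l2 l3; apply: le_trans (ler_wpM2l (ltW M0) sum3).
    rewrite !mulrDr; apply: le_trans (ler_normD _ _) _; apply: lerD.
      apply: le_trans (ler_normD _ _) _; apply: lerD.
        by rewrite normrM mulrC ler_wpM2r.
      by rewrite normrM mulrC ler_wpM2r.
    by rewrite normrM mulrC ler_wpM2r.
  have [_ lH1 lH2 lH3] := bH Up; have [_ le1 le2 le3] := beta Up.
  have := leaf_defect_bound (compat Up) h11 h21 n1 n2 (ltW v1) rH' re'
    (lin _ _ _ lH1 lH2 lH3) (lin _ _ _ le1 le2 le3).
  have -> : F (v + z) s (Z s) = (h1 + k1) * H (path (v + z) s (Z s))
      + (h2 + k2) * eta (path (v + z) s (Z s)).
    rewrite /F -[(v + z).1.1]/(k1 + z.1.1) -[(v + z).1.2]/(k2 + z.1.2) /h1 /h2.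
    by move: (H _) (eta _) => *; ring.
  rewrite -/(Z' s) => /le_trans; apply.
  have -> : 4 * (e * (C1 * N)) + 2 * N * (M * (C1 * N)) =
      (4 * (e * C1) + 2 * (N * (M * C1))) * N by ring.
  apply: ler_wpM2r => //.
  have -> : e * C1 = e1 / 8.
    have C1n : C1 != 0 by rewrite gt_eqF.
    by rewrite /e; field.
  apply: quarter_half_le.
  have M4 : 0 < 4 * M * C1 by rewrite !mulr_gt0.
  have h : N * (4 * M * C1) <= e1 by rewrite -ler_pdivlMr// ltW.
  rewrite ler_pdivlMr//; apply: le_trans h.
  by rewrite le_eqVlt; apply/orP; left; apply/eqP; ring.
pose Df s := Y (v + z) s - Z s.
have dDf s : 0 <= s <= 1 -> is_derive s 1 Df (F (v + z) s (Y (v + z) s) - Z' s).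
  by move=> s01; apply: is_derive_subf; [exact: leaf_solution_derive|exact: dZ].
have bDf s : 0 <= s <= 1 ->
    `|F (v + z) s (Y (v + z) s) - Z' s| <= 2 * M * d * `|Df s| + e1 * N.
  move=> s01; have [U2 F2] := step s s01; rewrite -(subrKA (F (v + z) s (Z s))).
  apply: le_trans (ler_normD _ _) _; apply: lerD => //.
  have s2 := unit_lt2 s01.
  have [_ _ yb] := leaf_solutionP Wz2.
  apply: leaf_field_lip => //; first exact: ltW.
    exact: le_lt_trans (yb s s2) rr.
  by move/inU: U2 => [].
have K0 : 0 <= 2 * M * d by rewrite !mulr_ge0// ltW.
have := gronwall_affine ler01 K0 (mulr_ge0 (ltW e10) N0) dDf bDf.
have -> : Df 0 = 0.
  have [y10 _ _] := leaf_solutionP Wz2; have [y20 _ _] := leaf_solutionP Wz.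
  rewrite /Df /Z /g /E a0 expR0 mul0r add0r mulr1 -/Y y10 y20 -[(v + z).2]/(D + z.2).
  by rewrite [D + _]addrC subrr.
rewrite normr0 add0r -/X.
have -> : e1 * N * X = e0 * N by rewrite /e1 mulrAC divfK ?gt_eqF.
apply: le_trans; rewrite le_eqVlt; apply/orP; left; apply/eqP; congr (`| _ |).
rewrite /Df /Z /g /f /leaf -/Y /p path1 /E a1 /lin3 -/k1 -/k2 -/D mul1r.
by move: (Y _ 1) (Y _ 1) (H _) (eta _) (expR _) => *; ring.
Qed.

Let sz z s : R * R * R := path z s z.2.

Lemma leaf_scaled_in z s : W z -> 0 <= s <= 1 -> W (sz z s).
Proof.
move=> /inW[h1 h2 h3] /andP[s0 s1].
have sm x : `|x| < d -> `|s * x| < d.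
  by rewrite normrM ger0_norm//; apply: le_lt_trans; exact: ler_piMl.
by apply/inW; split; [rewrite /= addrAC subrr add0r; exact: sm..|exact: h3].
Qed.

(* Makes the exponent [I01 (b z)] of [du f] an integral of [f] itself, so that [class_C n] bootstraps. *)
Lemma leaf_scaling z s : W z -> 0 <= s <= 1 -> Y z s = f (sz z s).
Proof.
move=> Wz s01; have Wz' := leaf_scaled_in Wz s01.
have ms (t : R) : 0 <= t <= 1 -> 0 <= t * s <= 1.
  move=> /andP[t0' t1]; have /andP[s0 s1] := s01.
  by rewrite mulr_ge0//= mulr_ile1.
have FE t y : F (sz z s) t y = s * F z (t * s) y.
  rewrite /F (_ : path (sz z s) t y = path z (t * s) y).
    by rewrite /sz /path /=; ring.
  by rewrite /sz /path /=; congr (_, _, _); ring.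
have d1' (t : R) : 0 <= t <= 1 -> is_derive t 1 (fun t => Y z (t * s)) (F (sz z s) t (Y z (t * s))).
  move=> /ms t01; rewrite FE.
  apply: is_derive_comp1; first exact: leaf_solution_derive.
  apply: is_derive_eq (is_derive_mulf (is_derive_id t 1) (is_derive_cst s t 1)) _.
  by rewrite mulr0 add0r mulr1.
have K0 : 0 <= 2 * M * d by rewrite !mulr_ge0// ltW// (lt_le_trans ltr01).
have := ode_unique ler01 K0 d1' (fun t t01 => leaf_solution_derive Wz' t01).
rewrite mul1r; apply.
  move=> t t01; have [_ _ yb] := leaf_solutionP Wz; have [_ _ yb'] := leaf_solutionP Wz'.
  apply: leaf_field_lip => //; first exact/ltW/unit_lt2.
    exact: le_lt_trans (yb _ (unit_lt2 (ms _ t01))) rr.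
  exact: le_lt_trans (yb' _ (unit_lt2 t01)) rr.
have [y10 _ _] := leaf_solutionP Wz; have [y20 _ _] := leaf_solutionP Wz'.
by rewrite mul0r y10 y20.
Qed.

Lemma leaf_graph_in z : W z -> U (z.1, f z).
Proof.
by move=> Wz; have := @leaf_curve_in z 1 Wz; rewrite path1 ler01 lexx; apply.
Qed.

Lemma class_C_leaf_graph n (G : R * R * R -> R) : class_C n W f -> class_C n U G ->
  class_C n W (fun z => G (z.1, f z)).
Proof.
move=> Cf CG.
have C1 : class_C n W (fun z => z.1.1) by apply: class_C_linear => // p; exact: is_diff_comp.
have C2 : class_C n W (fun z => z.1.2) by apply: class_C_linear => // p; exact: is_diff_comp.
apply: eq_class_C (class_C_triple oW _ C1 C2 Cf CG) => //.
  by move=> z _; rewrite -surjective_pairing.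
by move=> z /leaf_graph_in; rewrite [X in U (X, _)]surjective_pairing.
Qed.

Lemma class_C_leaf n : class_C n W f.
Proof.
have df z : W z -> differentiable f z by move=> /leaf_differentiable[].
elim: n => [|n IH]; first by move=> z /df; exact: differentiable_continuous.
split => // v.
have duH : class_C n U (du H) by have [_ /(_ (0, 0, 1))] := CH n.+1.
have dueta : class_C n U (du eta) by have [_ /(_ (0, 0, 1))] := Ceta n.+1.
(* An open set of pairs [(s, z)] containing [[0, 1] x W], on which the integrand [j] is defined
   through [f] at the scaled point. *)
pose O : set (R * (R * R * R)) := [set w | W (sz w.2 w.1)].
pose j (w : R * (R * R * R)) := (w.2.1.1 - t0) * du H ((sz w.2 w.1).1, f (sz w.2 w.1))
  + (w.2.1.2 - x0) * du eta ((sz w.2 w.1).1, f (sz w.2 w.1)).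
have Cs (X : set (R * (R * R * R))) : open X -> class_C n X (fun w => w.1).
  by move=> oX; apply: class_C_linear.
have Ca (X : set (R * (R * R * R))) : open X -> class_C n X (fun w => w.2.1.1).
  by move=> oX; apply: class_C_linear => // p; apply: is_diff_comp.
have Cb (X : set (R * (R * R * R))) : open X -> class_C n X (fun w => w.2.1.2).
  by move=> oX; apply: class_C_linear => // p; apply: is_diff_comp.
have Cc (X : set (R * (R * R * R))) : open X -> class_C n X (fun w => w.2.2).
  by move=> oX; apply: class_C_linear => // p; apply: is_diff_comp.
have Cat (X : set (R * (R * R * R))) : open X -> class_C n X (fun w => w.2.1.1 - t0).
  by move=> oX; apply: class_CD oX (Ca X oX) (class_C_cst n X (- t0)).
have Cbt (X : set (R * (R * R * R))) : open X -> class_C n X (fun w => w.2.1.2 - x0).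
  by move=> oX; apply: class_CD oX (Cb X oX) (class_C_cst n X (- x0)).
have C1 (X : set (R * (R * R * R))) : open X ->
    class_C n X (fun w => t0 + w.1 * (w.2.1.1 - t0)).
  by move=> oX; apply: class_CD oX (class_C_cst n X t0) (class_CM oX (Cs X oX) (Cat X oX)).
have C2 (X : set (R * (R * R * R))) : open X ->
    class_C n X (fun w => x0 + w.1 * (w.2.1.2 - x0)).
  by move=> oX; apply: class_CD oX (class_C_cst n X x0) (class_CM oX (Cs X oX) (Cbt X oX)).
have oO : open O.
  have cont (g : R * (R * R * R) -> R) : class_C n setT g -> continuous g.
    by move=> Cg w; exact: (class_C_continuous Cg).
  have cs : continuous (fun w : R * (R * R * R) => sz w.2 w.1).
    move=> w; exact: (cvg_pair (cvg_pair (cont _ (C1 _ openT) w) (cont _ (C2 _ openT) w))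
      (cont _ (Cc _ openT) w)).
  by apply: open_comp oW => w _; exact: cs.
have CO (G : R * R * R -> R) : class_C n U G ->
    class_C n O (fun w => G ((sz w.2 w.1).1, f (sz w.2 w.1))).
  move=> CG; have := class_C_triple oO _ (C1 O oO) (C2 O oO) (Cc O oO) (class_C_leaf_graph IH CG).
  exact.
have Cj : class_C n O j.
  exact: class_CD oO (class_CM oO (Cat O oO) (CO _ duH)) (class_CM oO (Cbt O oO) (CO _ dueta)).
have OW z s : W z -> 0 <= s <= 1 -> O (s, z) by move=> Wz s01; exact: leaf_scaled_in.
have CJ := class_C_I01 oO oW OW Cj.
have CE := class_C_comp oW CJ (class_C_expR n).
apply: eq_class_C (class_CD oW (class_CD oW
  (class_CM oW (class_C_cst n W v.1.1) (class_C_leaf_graph IH (CH n)))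
  (class_CM oW (class_C_cst n W v.1.2) (class_C_leaf_graph IH (Ceta n))))
  (class_CM oW (class_C_cst n W v.2) CE)) => //.
move=> z Wz; have [_ ->] := leaf_differentiable Wz.
suff E : I01 (b z) = I01 (fun s => j (s, z)) by rewrite E.
(* [I01] clamps its argument, so the integrands have to agree on [[0, 1]] only, where [leaf_scaling]
   applies. *)
congr (prim _ _); apply/funext => s; rewrite [LHS]/= [RHS]/=.
have s01 := clamp01_bound s; rewrite /b /j (leaf_scaling Wz s01) /=.
by [].
Qed.

Lemma leaf_center k : `|k - u0| < d -> f (t0, x0, k) = k.
Proof.
move=> kd; have Wz : W (t0, x0, k) by apply/inW; split; rewrite //= subrr normr0.
have [y0 _ _] := leaf_solutionP Wz; rewrite -[RHS]/((t0, x0, k).2) -y0.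
have [|s _] := @MVT_is_derive R (Y (t0, x0, k)) (fun=> 0) 0 1 ler01.
  move=> s s01; apply: is_derive_eq (leaf_solution_derive Wz s01) _.
  by rewrite /F /= !subrr !mul0r addr0.
by rewrite mul0r => /eqP; rewrite subr_eq0 => /eqP.
Qed.

End Leaf.

Lemma smooth_bounded (R : realType) (V : normedModType R) (f : V -> R) p :
  smooth_near f p -> \forall q \near p, `|f q| <= `|f p| + 1.
Proof.
move=> /smooth_continuous c; have : `|f p| < `|f p| + 1 by rewrite ltrDl.
have cn : {for p, continuous (fun q => `|f q|)}.
  exact: (continuous_comp c (@norm_continuous _ _ (f p))).
by move=> h; apply: filterS (cvgr_lt _ cn _ h) => q /ltW.
Qed.

Lemma exists_max4 (R : realType) (a b c d : R) :
  exists m, [/\ a <= m, b <= m, c <= m & d <= m].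
Proof.
exists (Num.max (Num.max a b) (Num.max c d)).
by split; rewrite !le_max lexx ?orbT.
Qed.

Lemma smooth_jet_bounded (R : realType) (f : R * R * R -> R) p : smooth_near f p ->
  exists2 M : R, 1 <= M & \forall q \near p,
    [/\ `|f q| <= M, `|dt f q| <= M, `|dx f q| <= M & `|du f q| <= M].
Proof.
move=> sf; have H v := smooth_bounded (smooth_derive v sf).
have [M [m1 m2 m3 m4]] := exists_max4 (`|f p| + 1) (`|dt f p| + 1) (`|dx f p| + 1) (`|du f p| + 1).
exists M; first by apply: le_trans m1; rewrite lerDr normr_ge0.
apply: filterS (filterI (filterI (smooth_bounded sf) (H (1, 0, 0)))
  (filterI (H (0, 1, 0)) (H (0, 0, 1)))).
move=> q [] [] h1 h2 [] h3 h4.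
exact: (And4 (le_trans h1 m1) (le_trans h2 m2) (le_trans h3 m3) (le_trans h4 m4)).
Qed.

(** The Frobenius theorem for the fields [d_t + H d_u] and [d_x + eta d_u], with leaves labelled by
    their value at [q0]. Positivity of [du f] is that of an exponential. *)
Lemma integral_leaf (R : realType) (q0 : R * R) (u0 : R) (H eta : R * R * R -> R) :
  smooth_near H (q0, u0) -> smooth_near eta (q0, u0) ->
  (\forall p \near (q0, u0), dt eta p + H p * du eta p = dx H p + eta p * du H p) ->
  exists f : R * R * R -> R, [/\ smooth_near f (q0, u0),
    \forall k \near u0, f (q0, k) = k &
    \forall z \near (q0, u0), [/\ dt f z = H (z.1, f z), dx f z = eta (z.1, f z) &
      0 < du f z]].
Proof.
case: q0 => t0 x0 sH se comp.
have [MH MH1 bH] := smooth_jet_bounded sH; have [Me Me1 be] := smooth_jet_bounded se.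
have [UH [oUH UHp] CH] := sH; have [Ue [oUe Uep] Ce] := se.
have [r r0 rP] := iffLR (nbhs_normlP _ _) (filterI (filterI comp (filterI bH be))
  (filterI (open_nbhs_nbhs (conj oUH UHp)) (open_nbhs_nbhs (conj oUe Uep)))).
pose M := MH + Me.
have M1 : 1 <= M by rewrite /M; move: MH1 Me1; lra.
have M0 : 0 < M by exact: lt_le_trans M1.
pose d := Num.min (Num.min 1 (r / 4)) (Num.min (1 / (8 * M)) (r / (16 * M))).
have d0 : 0 < d by rewrite !lt_min ltr01 !divr_gt0// !mulr_gt0.
have d1 : d <= 1 by rewrite /d !ge_min lexx.
have dr : d <= r / 4 by rewrite /d !ge_min lexx orbT.
have dM : 8 * M * d <= 1.
  by rewrite mulrC -ler_pdivlMr ?mulr_gt0// /d !ge_min lexx !orbT.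
have dMr : 16 * M * d <= r.
  by rewrite mulrC -ler_pdivlMr ?mulr_gt0// /d !ge_min lexx !orbT.
pose U := [set p : R * R * R | `|p - (t0, x0, u0)| < r].
have CHU n : class_C n U H by apply: class_C_subset (CH n) => p /rP[_ []].
have CeU n : class_C n U eta by apply: class_C_subset (Ce n) => p /rP[_ []].
have MH0 : MH <= M by rewrite /M; move: Me1; lra.
have Me0 : Me <= M by rewrite /M; move: MH1; lra.
have bHU p : U p -> [/\ `|H p| <= M, `|dt H p| <= M, `|dx H p| <= M & `|du H p| <= M].
  by move=> /rP[] [] _ [] [] a1 a2 a3 a4 _ _;
  exact: (And4 (le_trans a1 MH0) (le_trans a2 MH0) (le_trans a3 MH0) (le_trans a4 MH0)).
have beU p : U p -> [/\ `|eta p| <= M, `|dt eta p| <= M, `|dx eta p| <= M & `|du eta p| <= M].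
  by move=> /rP[] [] _ [] _ [] a1 a2 a3 a4 _;
  exact: (And4 (le_trans a1 Me0) (le_trans a2 Me0) (le_trans a3 Me0) (le_trans a4 Me0)).
have cU p : U p -> dt eta p + H p * du eta p = dx H p + eta p * du H p.
  by move=> /rP[] [] c _ _; exact: c.
pose f := leaf t0 x0 u0 H eta r.
pose W := [set p : R * R * R | `|p - (t0, x0, u0)| < d].
have oW : open W by exact: open_norm_lt.
have Wp : W (t0, x0, u0) by rewrite /W /= subrr normr0.
exists f; split.
- exists W; first by split.
  exact: (class_C_leaf M1 d0 d1 dr dM dMr CHU CeU bHU beU cU).
- by apply: (iffRL (nbhs_normlP _ _)); exists d => // k kd;
  exact: (leaf_center M1 d0 dr dM dMr CHU CeU bHU beU kd).
- apply: filterS (open_nbhs_nbhs (conj oW Wp)) => z Wz.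
  have [_ fE] := leaf_differentiable M1 d0 d1 dr dM dMr CHU CeU bHU beU cU Wz.
  rewrite /dt /dx /du !fE /lin3 /= !(mul1r, mul0r, add0r, addr0); split => //.
  exact: expR_gt0.
Qed.

(** * Implicit functions *)

Lemma smooth_linear (R : realType) (V : normedModType R) (l : V -> R) (p : V) :
  (forall p, is_diff p l l) -> smooth_near l p.
Proof.
move=> dl; exists setT; first by split => //; exact: openT.
by move=> n; apply: class_C_linear => //; exact: openT.
Qed.

Lemma smooth_t (R : realType) (p : R * R * R) : smooth_near (fun p : R * R * R => p.1.1) p.
Proof. by apply: smooth_linear => q; exact: is_diff_comp. Qed.

Lemma smooth_x (R : realType) (p : R * R * R) : smooth_near (fun p : R * R * R => p.1.2) p.
Proof. by apply: smooth_linear => q; exact: is_diff_comp. Qed.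

Lemma smooth_u (R : realType) (p : R * R * R) : smooth_near (fun p : R * R * R => p.2) p.
Proof. exact: smooth_linear. Qed.

(** The remainder is small relative to [N + |D|], where [D] is itself the increment to be estimated.
    The bound [e' <= 1/4] allows [|D|] to be absorbed, giving [|D| <= (2 L + 1) N]; then [e'] is
    small enough for the final estimate. *)
Lemma implicit_increment_bound (R : realFieldType) (a b c h1 h2 h3 D e e' N L : R) :
  2^-1 <= c -> `|h1| <= N -> `|h2| <= N -> `|h3| <= N ->
  L = 2 * (1 + `|a| + `|b|) -> 0 < e' -> e' <= 1 / 4 -> e' * (4 * L + 4) <= e ->
  `|h3 - (h1 * a + h2 * b + D * c)| <= e' * (N + `|D|) ->
  `|D - (h1 * (- a / c) + h2 * (- b / c) + h3 * c^-1)| <= e * N.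
Proof.
move=> c2 h1N h2N h3N LE e'0 e'4 e'e H.
have c0 : 0 < c by apply: lt_le_trans c2; rewrite invr_gt0.
have cn : c != 0 by rewrite gt_eqF.
have N0 : 0 <= N by exact: le_trans (normr_ge0 h1) h1N.
pose X := h1 * (- a / c) + h2 * (- b / c) + h3 * c^-1.
have E : h3 - (h1 * a + h2 * b + D * c) = - c * (D - X) by rewrite /X; field.
rewrite -/X; move: H; rewrite E normrM normrN (gtr0_norm c0) => H.
have X1 : `|D - X| <= 2 * (e' * (N + `|D|)).
  apply: le_trans (ler_wpM2l _ H) => //.
  rewrite mulrA ler_peMl// -(ler_pM2l (_ : 0 < 2^-1 :> R)) ?invr_gt0//.
  by rewrite mulrA mulVf ?pnatr_eq0// mul1r mulr1.
have XL : `|X| <= L * N.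
  have cX : c * X = h3 - h1 * a - h2 * b by rewrite /X; field.
  have : c * `|X| <= N * (1 + `|a| + `|b|).
    rewrite -{1}(gtr0_norm c0) -normrM cX !mulrDr mulr1.
    apply: le_trans (ler_normB _ _) _; apply: lerD.
      by apply: le_trans (ler_normB _ _) _; rewrite lerD// normrM ler_wpM2r.
    by rewrite normrM ler_wpM2r.
  have := ler_wpM2r (normr_ge0 X) c2 => m1 m2; have m := le_trans m1 m2.
  have -> : L * N = 2 * (N * (1 + `|a| + `|b|)) by rewrite LE; ring.
  by rewrite -ler_pdivrMl// .
have DX : `|D| <= `|D - X| + `|X| by rewrite -{1}(subrK X D) ler_normD.
have L0 : 0 <= L by rewrite LE mulr_ge0// !addr_ge0.
have DN : `|D| <= (2 * L + 1) * N.
  have : 2 * (e' * (N + `|D|)) <= 2^-1 * (N + `|D|).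
    by rewrite mulrA ler_wpM2r ?addr_ge0//; move: e'4; lra.
  by move: X1 XL DX => m1 m2 m3 m4; rewrite mulrDl mul1r -mulrA; move: (L * N) m2 m1 m3 m4 => l; lra.
apply: le_trans X1 _; apply: le_trans (_ : e' * (4 * L + 4) * N <= _); last exact: ler_wpM2r.
rewrite mulrCA -mulrA ler_wpM2l ?(ltW e'0)//.
have -> : (4 * L + 4) * N = 2 * (N + ((2 * L + 1) * N)) by ring.
by rewrite ler_wpM2l// lerD2l.
Qed.

Section Implicit.
Context {R : realType} (t0 x0 k0 : R) (f : R * R * R -> R) (r d : R).
Implicit Types (p z v : R * R * R).
Let u0 := f (t0, x0, k0).
Let U : set (R * R * R) := [set z | `|z - (t0, x0, k0)| < r].
Let W : set (R * R * R) := [set p | `|p - (t0, x0, u0)| < d].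
Context (r0 : 0 < r) (d0 : 0 < d) (dr : d <= r) (Cf : forall n, class_C n U f)
  (duf : forall z, U z -> 2^-1 <= du f z)
  (lo : forall t x, `|t - t0| < d -> `|x - x0| < d -> f (t, x, k0 - r / 2) <= u0 - d)
  (hi : forall t x, `|t - t0| < d -> `|x - x0| < d -> u0 + d <= f (t, x, k0 + r / 2)).

Let inU z : U z <-> [/\ `|z.1.1 - t0| < r, `|z.1.2 - x0| < r & `|z.2 - k0| < r].
Proof. exact: ball3E. Qed.
Let inW p : W p <-> [/\ `|p.1.1 - t0| < d, `|p.1.2 - x0| < d & `|p.2 - u0| < d].
Proof. exact: ball3E. Qed.

Let df z : U z -> differentiable f z.
Proof. by have [df _] := Cf 1%N; exact: df. Qed.

Lemma slice_is_derive t x (k : R) : differentiable f (t, x, k) ->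
  is_derive k 1 (fun k => f (t, x, k)) (du f (t, x, k)).
Proof.
move=> dfk; apply: (is_derive_curve (c := fun k => (t, x, k))) => //.
exact: is_derive_pair (is_derive_cst (t, x) k 1) (is_derive_id k 1).
Qed.

(** The lower bound 1/2 on [du f] makes the inverse of each slice Lipschitz with constant 2.
    Uniqueness of the implicit value and its first continuity estimate both come from this. *)
Lemma implicit_mono t x k k' : `|t - t0| < r -> `|x - x0| < r ->
  `|k - k0| < r -> `|k' - k0| < r -> `|k' - k| <= 2 * `|f (t, x, k') - f (t, x, k)|.
Proof.
move=> tr xr; wlog kk' : k k' / k <= k'.
  move=> H kr k'r; have [kk'|/ltW kk'] := leP k k'; first exact: H.
  by rewrite distrC [X in 2 * X]distrC; exact: H.
move=> kr k'r.
have Us s : k <= s <= k' -> U (t, x, s).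
  move=> /andP[ks sk']; apply/inU; split => //=.
  move: kr k'r; rewrite !ltr_norml => /andP[? ?] /andP[? ?].
  by apply/andP; split; move: ks sk'; lra.
have [s sk E] := MVT_is_derive kk' (fun s sk => slice_is_derive (df (Us s sk))).
rewrite E normrM; have duge := duf (Us s sk).
rewrite -{1}[`|k' - k|]mul1r mulrA ler_wpM2r//.
rewrite -(ler_pM2l (_ : 0 < 2^-1 :> R)) ?invr_gt0// mulr1 mulrA mulVf ?pnatr_eq0// mul1r.
exact: le_trans (ler_norm _).
Qed.

Definition implicit p : R := xget k0 [set k | `|k - k0| <= r / 2 /\ f (p.1, k) = p.2].
Let g := implicit.

Let rr : r / 2 < r. Proof. by move: r0; lra. Qed.

Lemma implicitP p : W p -> `|g p - k0| <= r / 2 /\ f (p.1, g p) = p.2.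
Proof.
move=> /inW[]; case: p => -[t x] u /= td xd ud.
rewrite /g /implicit; case: xgetP => [k _ []//|/= H]; exfalso.
have tr := lt_le_trans td dr; have xr := lt_le_trans xd dr.
have le12 : k0 - r / 2 <= k0 + r / 2 by move: r0; lra.
have Us s : k0 - r / 2 <= s <= k0 + r / 2 -> `|s - k0| <= r / 2.
  by move=> /andP[s1 s2]; rewrite ler_norml; apply/andP; split; move: s1 s2; lra.
have c : {within `[k0 - r / 2, k0 + r / 2], continuous (fun k => f (t, x, k))}.
  apply: derivable_within_continuous => s; rewrite in_itv /= => /Us sr.
  have [] // := @slice_is_derive t x s; apply: df; apply/inU; split => //=.
  exact: le_lt_trans rr.
have [|k] := @IVT R (fun k => f (t, x, k)) _ _ u le12 c.
  have h1 := lo td xd; have h2 := hi td xd.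
  rewrite ge_min le_max; move: ud; rewrite ltr_norml => /andP[u1 u2].
  apply/andP; split; apply/orP; [left|right].
    by apply: le_trans h1 _; move: u1; lra.
  by apply: le_trans h2; move: u2; lra.
rewrite in_itv /= => /Us kr fk.
exact: (H k (conj kr fk)).
Qed.

Lemma implicit_in p : W p -> U (p.1, g p).
Proof.
move=> Wp; have [gr _] := implicitP Wp; have /inW[h1 h2 _] := Wp.
by apply/inU; split => /=; [exact: lt_le_trans dr|exact: lt_le_trans dr|exact: le_lt_trans rr].
Qed.

Lemma implicitK z : W (z.1, f z) -> `|z.2 - k0| < r -> g (z.1, f z) = z.2.
Proof.
case: z => -[t x] k Wz kr; have [gr ge] := implicitP Wz; have /inW[/= h1 h2 _] := Wz.
apply/eqP; rewrite -subr_eq0 -normr_le0.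
have := @implicit_mono t x k (g (t, x, f (t, x, k))); rewrite ge /= subrr normr0 mulr0.
apply => //; [exact: lt_le_trans dr|exact: lt_le_trans dr|exact: le_lt_trans rr].
Qed.

Lemma implicit_differentiable p : W p -> differentiable g p /\
  forall v, 'D_v g p = lin3 (- dt f (p.1, g p) / du f (p.1, g p))
    (- dx f (p.1, g p) / du f (p.1, g p)) (du f (p.1, g p))^-1 v.
Proof.
move=> Wp; apply: differentiable3 => e e0.
have Uz := implicit_in Wp; have dfz := df Uz; set z := (p.1, g p) in Uz dfz *.
pose L := 2 * (1 + `|dt f z| + `|dx f z|).
have L0 : 0 <= L by rewrite mulr_ge0// !addr_ge0.
have L4 : 0 < 4 * L + 4 by rewrite ltr_wpDl// mulr_ge0.
pose e' := Num.min (1 / 4) (e / (4 * L + 4)).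
have e'0 : 0 < e' by rewrite lt_min !divr_gt0.
have e'4 : e' <= 1 / 4 by rewrite ge_min lexx.
have e'e : e' * (4 * L + 4) <= e by rewrite -ler_pdivlMr// ge_min lexx orbT.
have [w w0 wP] := iffLR (nbhs_normlP _ _) (differentiable_epsilon dfz e'0).
have oW : open W by exact: open_norm_lt.
have [w' w'0 w'P] := open_normlP oW Wp.
have cz := differentiable_continuous dfz.
have w4 : 0 < w / 8 by rewrite divr_gt0.
have [w2 w20 w2P] : exists2 w2 : R, 0 < w2 & forall q : R * R,
    `|q - p.1| < w2 -> `|f (q, g p) - f z| < w / 8.
  have cq : {for p.1, continuous (fun q => f (q, g p))}.
    apply: (@continuous_comp _ _ _ (fun q => (q, g p)) f) => //.
    by apply: differentiable_continuous; have [] := is_diff_pairl (g p) p.1.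
  have /cvgrPdist_lt/(_ _ w4) h := cq.
  have [w2 w20 w2P] := iffLR (nbhs_normlP _ _) h.
  by exists w2 => // q /w2P; rewrite distrC.
apply: (iffRL (nbhs_normlP (0 : R * R * R) _)).
exists (Num.min (Num.min w' w2) (w / 8)).
  by rewrite !lt_min w'0 w20.
move=> h; rewrite subr0 !lt_min => /andP[/andP[hw' hw2] hw4].
have Wh : W (h + p) by apply: w'P; rewrite addrK.
have [gr ge] := implicitP Wh; have [gr0 ge0] := implicitP Wp.
have [n1 n2 n3] := norm3_le h.
pose D := g (h + p) - g p.
have hw : w / 8 < w by move: w0; lra.
(* The inverse Lipschitz bound controls [D] by twice the change of [f], at most [w / 2]; so the
   increment [(h.1, D)] falls where the expansion of [f] is valid. *)
have D2 : `|D| < w.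
  have /inW[a1 a2 _] := Wh.
  have := @implicit_mono (h + p).1.1 (h + p).1.2 (g p) (g (h + p)).
  rewrite -surjective_pairing ge => H; apply: le_lt_trans (H _ _ _ _) _.
  - exact: lt_le_trans dr.
  - exact: lt_le_trans dr.
  - exact: le_lt_trans gr0 rr.
  - exact: le_lt_trans gr rr.
  have m1 : `|f ((h + p).1, g p) - f z| < w / 8.
    by apply: w2P; rewrite -[(h + p).1]/(h.1 + p.1) addrK; apply: le_lt_trans hw2; exact: ler_norm_fst.
  have m2 : `|(h + p).2 - f z| < w / 8.
    by rewrite /z ge0 -[(h + p).2]/(h.2 + p.2) addrK; exact: le_lt_trans hw4.
  rewrite -(subrKA (f z)); apply: le_lt_trans (_ : 2 * (w / 8 + w / 8) < w); last by move: w0; lra.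
  rewrite ler_wpM2l//; apply: le_trans (ler_normD _ _) _; apply: lerD; first exact: ltW.
  by rewrite distrC ltW.
pose v : R * R * R := (h.1, D).
have vw : `|v - 0| < w.
  rewrite subr0 normr_pair_lt D2 andbT; apply: le_lt_trans (ler_norm_fst h) _.
  exact: lt_trans hw.
have := wP v vw.
have -> : v + z = ((h + p).1, g (h + p)).
  by rewrite -[v + z]/(h.1 + p.1, D + g p) /D subrK.
rewrite ge /z ge0 -[(h + p).2]/(h.2 + p.2) addrK -/z derive3E// => H.
rewrite -/D; apply: (implicit_increment_bound (duf Uz) n1 n2 n3 erefl e'0 e'4 e'e).
apply: le_trans H _; rewrite ler_wpM2l ?(ltW e'0)//.
rewrite /v normr_pairE ge_max; apply/andP; split.
  by apply: le_trans (ler_norm_fst h) _; rewrite lerDl.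
by rewrite lerDr.
Qed.

(** The first derivatives of [g] are quotients of derivatives of [f] at [(p.1, g p)], so the
    regularity of [g] raises itself by one. *)
Lemma class_C_implicit n : class_C n W g.
Proof.
have oW : open W by exact: open_norm_lt.
have dg p : W p -> differentiable g p by move=> /implicit_differentiable[].
elim: n => [|n IH]; first by move=> z /dg; exact: differentiable_continuous.
split => // v.
have C1 : class_C n W (fun z => z.1.1) by apply: class_C_linear => // p; exact: is_diff_comp.
have C2 : class_C n W (fun z => z.1.2) by apply: class_C_linear => // p; exact: is_diff_comp.
have CG (G : R * R * R -> R) : class_C n U G -> class_C n W (fun p => G (p.1, g p)).
  move=> CG; apply: eq_class_C (class_C_triple oW _ C1 C2 IH CG) => //.
    by move=> z _; rewrite -surjective_pairing.
  by move=> z /implicit_in; rewrite [X in U (X, _)]surjective_pairing.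
have CD e : class_C n U ('D_e f) by have [_ /(_ e)] := Cf n.+1.
have Cu := CG _ (CD (0, 0, 1)).
have CV : class_C n W (fun p => (du f (p.1, g p))^-1).
  apply: class_CV => // p /implicit_in/duf h.
  by rewrite gt_eqF// (lt_le_trans _ h)// invr_gt0.
have Ct := class_CM oW (class_CN oW (CG _ (CD (1, 0, 0)))) CV.
have Cx := class_CM oW (class_CN oW (CG _ (CD (0, 1, 0)))) CV.
apply: eq_class_C (class_CD oW (class_CD oW (class_CM oW (class_C_cst n W v.1.1) Ct)
  (class_CM oW (class_C_cst n W v.1.2) Cx)) (class_CM oW (class_C_cst n W v.2) CV)) => //.
by move=> p /implicit_differentiable[_ ->].
Qed.

End Implicit.

(** With derivative 1 at the base point, [du f >= 1/2] nearby and [f] is increasing in the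
    parameter; any nonzero derivative is brought to this case by scaling [f]. *)
Lemma smooth_implicit_unit (R : realType) (f : R * R * R -> R) (q0 : R * R) (k0 : R) :
  smooth_near f (q0, k0) -> du f (q0, k0) = 1 ->
  exists g : R * R * R -> R, [/\ smooth_near g (q0, f (q0, k0)),
    \forall p \near (q0, f (q0, k0)), f (p.1, g p) = p.2 &
    \forall z \near (q0, k0), g (z.1, f z) = z.2].
Proof.
case: q0 => t0 x0 sf fu1; have [X [oX Xp] Cf] := sf.
have cu : {for (t0, x0, k0), continuous (du f)} by exact: (smooth_continuous (smooth_derive _ sf)).
have h1 : 2^-1 < du f (t0, x0, k0) by rewrite fu1 invf_lt1// ltr1n.
have nu : \forall z \near (t0, x0, k0), 2^-1 < du f z by exact: (cvgr_gt _ cu _ h1).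
have [r r0 rP] := iffLR (nbhs_normlP _ _) (filterI nu (open_nbhs_nbhs (conj oX Xp))).
pose U := [set z : R * R * R | `|z - (t0, x0, k0)| < r].
have CfU n : class_C n U f by apply: class_C_subset (Cf n) => z /rP[].
have duf z : U z -> 2^-1 <= du f z by move=> /rP[/ltW].
have rr : r / 2 < r by move: r0; lra.
have r20 : 0 <= r / 2 by move: r0; lra.
have Us k : `|k - k0| <= r / 2 -> U (t0, x0, k).
  move=> kr; apply/ball3E; rewrite /= !subrr normr0; split => //.
  exact: le_lt_trans rr.
have dfU z : U z -> differentiable f z by have [df _] := CfU 1%N; exact: df.
have step k k' : k <= k' -> `|k - k0| <= r / 2 -> `|k' - k0| <= r / 2 ->
    (k' - k) / 2 <= f (t0, x0, k') - f (t0, x0, k).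
  move=> kk' kr k'r.
  have Us' s : k <= s <= k' -> U (t0, x0, s).
    move=> /andP[ks sk']; apply: Us; move: kr k'r.
    rewrite !ler_norml => /andP[? ?] /andP[? ?]; apply/andP; split; move: ks sk'; lra.
  have [s sk ->] := MVT_is_derive kk' (fun s sk => slice_is_derive (dfU _ (Us' s sk))).
  rewrite mulrC ler_wpM2r ?subr_ge0//; apply: duf; exact: Us'.
have n0 : `|k0 - k0| <= r / 2 by rewrite subrr normr0.
have n1 : `|k0 + r / 2 - k0| <= r / 2 by rewrite addrAC subrr add0r ger0_norm.
have n2 : `|k0 - r / 2 - k0| <= r / 2 by rewrite addrAC subrr add0r normrN ger0_norm.
have l1 : k0 <= k0 + r / 2 by rewrite lerDl.
have l2 : k0 - r / 2 <= k0 by rewrite gerBl.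
(* Slope at least 1/2 over the length [r / 2] separates the values at [k0 - r / 2], [k0],
   [k0 + r / 2] by at least [r / 4]; a margin of [r / 8] survives when the base point moves a
   little. *)
have s1 := step _ _ l1 n0 n1; have s2 := step _ _ l2 n2 n0.
have cslice k : `|k - k0| <= r / 2 -> {for (t0, x0), continuous (fun q => f (q, k))}.
  move=> /Us/dfU/differentiable_continuous c.
  apply: (@continuous_comp _ _ _ (fun q => (q, k)) f) => //.
  by apply: differentiable_continuous; have [] := is_diff_pairl k (t0, x0).
pose u0 := f (t0, x0, k0).
have nhi : \forall q \near (t0, x0), u0 + r / 8 < f (q, k0 + r / 2).
  apply: (cvgr_gt _ (cslice _ n1)).
  by move: s1 r0; rewrite /u0; move: (f _) (f _) => a b; lra.
have nlo : \forall q \near (t0, x0), f (q, k0 - r / 2) < u0 - r / 8.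
  apply: (cvgr_lt _ (cslice _ n2)).
  by move: s2 r0; rewrite /u0; move: (f _) (f _) => a b; lra.
have [d' d'0 d'P] := iffLR (nbhs_normlP _ _) (filterI nhi nlo).
pose d := Num.min d' (r / 8).
have d0 : 0 < d by rewrite lt_min d'0 divr_gt0.
have dr8 : d <= r / 8 by rewrite ge_min lexx orbT.
have dr : d <= r by apply: le_trans dr8 _; move: r0; lra.
have dd' : d <= d' by rewrite ge_min lexx.
have near' t x : `|t - t0| < d -> `|x - x0| < d -> `|(t, x) - (t0, x0)| < d'.
  move=> td xd; rewrite -[_ - _]/(t - t0, x - x0) normr_pair_lt.
  by apply/andP; split; exact: lt_le_trans dd'.
have lo t x : `|t - t0| < d -> `|x - x0| < d -> f (t, x, k0 - r / 2) <= u0 - d.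
  move=> td xd; have [_ h] := d'P _ (near' t x td xd).
  by apply: le_trans (ltW h) _; rewrite lerB.
have hi t x : `|t - t0| < d -> `|x - x0| < d -> u0 + d <= f (t, x, k0 + r / 2).
  move=> td xd; have [h _] := d'P _ (near' t x td xd).
  by apply: le_trans (ltW h); rewrite lerD2l.
pose W := [set p : R * R * R | `|p - (t0, x0, u0)| < d].
have oW : open W by exact: open_norm_lt.
have Wp : W (t0, x0, u0) by rewrite /W /= subrr normr0.
exists (implicit k0 f r); split.
- exists W; first by split.
  exact: (class_C_implicit r0 dr CfU duf lo hi).
- apply: filterS (open_nbhs_nbhs (conj oW Wp)) => p Wp'.
  by have [] := implicitP r0 dr CfU lo hi Wp'.
- have cg : {for (t0, x0, k0), continuous (fun z : R * R * R => (z.1, f z))}.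
    apply: differentiable_continuous; apply: differentiable_pair => //.
    exact: smooth_differentiable.
  have nW : \forall z \near (t0, x0, k0), W (z.1, f z) := cg _ (open_nbhs_nbhs (conj oW Wp)).
  have nr : \forall z \near (t0, x0, k0), `|z - (t0, x0, k0)| < r.
    by apply: (iffRL (nbhs_normlP _ _)); exists r.
  apply: filterS (filterI nW nr) => z [Wz zr].
  apply: (implicitK r0 dr CfU duf lo hi Wz).
  exact: le_lt_trans (ler_norm_snd (z - (t0, x0, k0))) zr.
Qed.

Lemma smooth_implicit (R : realType) (f : R * R * R -> R) (q0 : R * R) (k0 : R) :
  smooth_near f (q0, k0) -> du f (q0, k0) != 0 ->
  exists g : R * R * R -> R, [/\ smooth_near g (q0, f (q0, k0)),
    \forall p \near (q0, f (q0, k0)), f (p.1, g p) = p.2 &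
    \forall z \near (q0, k0), g (z.1, f z) = z.2].
Proof.
move=> sf; set a := du f _ => a0; have ia0 : a^-1 != 0 by rewrite invr_eq0.
pose F z := a^-1 * f z.
have sF : smooth_near F (q0, k0) by apply: smoothM => //; exact: smooth_cst.
have dF : du F (q0, k0) = 1.
  have [_ E] := is_derive_mulf (is_derive_cst a^-1 (q0, k0) (0, 0, 1)) (smooth_is_derive ((0, 0, 1) : R * R * R) sf).
  by rewrite /du E mulr0 addr0 mulVf.
have [G [sG GK KG]] := smooth_implicit_unit sF dF.
have cp : {for (q0, f (q0, k0)), continuous (fun p : R * R * R => (p.1, a^-1 * p.2))}.
  by apply: differentiable_continuous; apply: differentiable_pair => //; apply: differentiableM.
exists (fun p => G (p.1, a^-1 * p.2)); split.
- have h := @smooth_triple R _ G (fun p : R * R * R => p.1.1) (fun p => p.1.2)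
    (fun p => a^-1 * p.2) (q0, f (q0, k0)).
  have E : (fun p : R * R * R => G (p.1, a^-1 * p.2)) =
    (fun p => G (p.1.1, p.1.2, a^-1 * p.2)) by apply/funext => p; rewrite -surjective_pairing.
  rewrite E; apply: h.
  + exact: smooth_t.
  + exact: smooth_x.
  + by apply: smoothM; [exact: smooth_cst|exact: smooth_u].
  + by rewrite -surjective_pairing.
- have h : \forall p \near (q0, f (q0, k0)), F (p.1, G (p.1, a^-1 * p.2)) = a^-1 * p.2 := cp _ GK.
  by apply: filterS h => p; rewrite /F => /(mulfI ia0).
- exact: KG.
Qed.

(** * Characteristics of symmetries *)

Section GraphCalculus.
Context {R : realType}.
Implicit Types (f G : R * R * R -> R) (F : R * R -> R) (z p v : R * R * R).

Lemma smooth_base F z : smooth_near F z.1 -> smooth_near (fun z : R * R * R => F z.1) z.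
Proof. by move=> sF; exact: (smooth_fst (F := F)). Qed.

Lemma smooth_time (F : R -> R) z :
  smooth_near F z.1.1 -> smooth_near (fun z : R * R * R => F z.1.1) z.
Proof. by move=> sF; apply: (smooth_comp (F := F)) => //; exact: smooth_t. Qed.

Lemma smooth_graph G f z : smooth_near f z -> smooth_near G (z.1, f z) ->
  smooth_near (fun z => G (z.1, f z)) z.
Proof.
move=> sf sG; have E : (fun z => G (z.1, f z)) = (fun z => G (z.1.1, z.1.2, f z)).
  by apply/funext => z'; rewrite -surjective_pairing.
rewrite E; apply: smooth_triple => //; [exact: smooth_t|exact: smooth_x|].
by rewrite -surjective_pairing.
Qed.

Lemma is_derive_t z v : is_derive z v (fun z : R * R * R => z.1.1) v.1.1.
Proof.
have d : is_diff z (fun z : R * R * R => z.1.1) (fun z => z.1.1) by exact: is_diff_comp.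
have [dz dE] := d; split; first exact: diff_derivable.
by rewrite deriveE// dE.
Qed.

Lemma is_derive_x z v : is_derive z v (fun z : R * R * R => z.1.2) v.1.2.
Proof.
have d : is_diff z (fun z : R * R * R => z.1.2) (fun z => z.1.2) by exact: is_diff_comp.
have [dz dE] := d; split; first exact: diff_derivable.
by rewrite deriveE// dE.
Qed.

Lemma is_derive_u z v : is_derive z v (fun z : R * R * R => z.2) v.2.
Proof.
have [dz dE] := is_diff_snd z; split; first exact: diff_derivable.
by rewrite deriveE// dE.
Qed.

Lemma is_derive_graph G f z v : smooth_near f z -> smooth_near G (z.1, f z) ->
  is_derive z v (fun z => G (z.1, f z))
    (v.1.1 * dt G (z.1, f z) + v.1.2 * dx G (z.1, f z) + 'D_v f z * du G (z.1, f z)).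
Proof.
move=> sf sG; have E : (fun z => G (z.1, f z)) = (fun z => G (z.1.1, z.1.2, f z)).
  by apply/funext => z'; rewrite -surjective_pairing.
have sG' : smooth_near G (z.1.1, z.1.2, f z) by rewrite -surjective_pairing.
have := is_derive_triple (smooth_t z) (smooth_x z) sf sG' (is_derive_t z v)
  (is_derive_x z v) (smooth_is_derive v sf).
by rewrite -E -surjective_pairing.
Qed.

Lemma is_derive_base F z v : smooth_near F z.1 ->
  is_derive z v (fun z : R * R * R => F z.1) ('D_(v.1) F z.1).
Proof.
move=> sF; apply: is_derive_eq (smooth_is_derive v (smooth_base sF)) _.
by apply: (derive_affine (G := fst) (l := fst)) => //; exact: smooth_differentiable.
Qed.

Lemma is_derive_time (F : R -> R) z v : smooth_near F z.1.1 ->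
  is_derive z v (fun z : R * R * R => F z.1.1) (v.1.1 * derive1 F z.1.1).
Proof.
move=> sF; apply: is_derive_eq (smooth_is_derive v (smooth_time sF)) _.
have dF := smooth_differentiable sF.
have -> : 'D_v (fun z : R * R * R => F z.1.1) z = 'D_(v.1.1) F z.1.1.
  apply: (derive_affine (G := fun z : R * R * R => z.1.1) (l := fun z => z.1.1)) => //.
have -> : 'D_(v.1.1) F z.1.1 = 'D_(v.1.1 *: (1 : R)) F z.1.1.
  by rewrite /GRing.scale /= mulr1.
rewrite (deriveZv _ _ dF) derive1E; exact: erefl.
Qed.

(** Both sides are limits of the same difference quotients, so the equality holds at every point and
    can be iterated as an equality of functions. *)
Lemma derive_slice f (k : R) (v q : R * R) :
  'D_v (fun q => f (q, k)) q = 'D_((v, 0) : R * R * R) f (q, k).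
Proof.
rewrite /derive; set g1 := (X in lim (X @ _) = _); set g2 := (X in _ = lim (X @ _)).
suff -> : g1 = g2 by [].
apply/funext => h; rewrite /g1 /g2 /=.
by rewrite -[h *: ((v, 0) : R * R * R) + (q, k)]/(h *: v + q, h *: (0 : R) + k) scaler0 add0r.
Qed.

Lemma pt_slice f (k : R) : pt (fun q => f (q, k)) = fun q => dt f (q, k).
Proof. by apply/funext => q; exact: derive_slice. Qed.

Lemma px_slice f (k : R) : px (fun q => f (q, k)) = fun q => dx f (q, k).
Proof. by apply/funext => q; exact: derive_slice. Qed.

Lemma solves_atE (L : evolution_eq R) f z : solves_at L (fun q => f (q, z.2)) z.1 <->
  dt f z = Acoef L z.1 * dx (dx f) z + Bcoef L z.1 * dx f z + Ccoef L z.1 * f z.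
Proof.
by rewrite /solves_at pt_slice px_slice (px_slice (dx f)) -surjective_pairing.
Qed.

End GraphCalculus.

Lemma de0_algebra (R : realFieldType)
    (A Ax B Bx C Cx u e et ex eu exx exu euu Be : R) : Be = B * ex + e * Bx ->
  et = A * (exx + 2 * e * exu + e ^+ 2 * euu) + Ax * (ex + e * eu) + Be
     + C * (e - u * eu) + Cx * u <->
  et + (A * (ex + e * eu) + B * e + C * u) * eu =
    A * (exx + (e * exu + eu * ex)) + (ex + e * eu) * Ax + (B * ex + e * Bx)
      + (C * 0 + u * Cx)
    + e * (A * (exu + (e * euu + eu * eu)) + (ex + e * eu) * 0 + (B * eu + e * 0)
      + (C * 1 + u * 0)).
Proof.
move=> ->; split=> [->|H]; first by ring.
by apply/eqP; rewrite -subr_eq0; move/eqP: H; rewrite -subr_eq0 => /eqP <-; apply/eqP; ring.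
Qed.

Lemma characteristic_algebra (R : realFieldType)
  (z1 z1x z0 z0x t x xx f ft fx fxx fxt e et ex eu : R) : fx = e ->
  fxx = ex + e * eu -> fxt = et + ft * eu ->
  z1 * fx + f * z1x + z0x - (t * fxt + ft * 0) - (x * fxx + fx * xx)
    - eu * (z1 * f + z0 - t * ft - x * fx) =
  (z1 - xx) * e + z1x * f + z0x - (t * et + x * ex + (z1 * f + z0) * eu).
Proof. by move=> -> -> ->; ring. Qed.

Section Characteristic.
Context {R : realType}.
Implicit Types (L : evolution_eq R) (Q : operator R).
Implicit Types (f eta : R * R * R -> R) (z p v : R * R * R).

Let et : R * R * R := (1, 0, 0).
Let ex : R * R * R := (0, 1, 0).
Let eu : R * R * R := (0, 0, 1).

Lemma smooth_ut_of L eta p : smooth_near (Acoef L) p.1 -> smooth_near (Bcoef L) p.1 ->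
  smooth_near (Ccoef L) p.1 -> smooth_near eta p -> smooth_near (ut_of L eta) p.
Proof.
move=> sA sB sC se; apply: smoothD; first apply: smoothD.
- apply: smoothM; first exact: smooth_base.
  apply: smoothD; first exact: smooth_derive.
  by apply: smoothM => //; exact: smooth_derive.
- by apply: smoothM => //; exact: smooth_base.
- by apply: smoothM; [exact: smooth_base|exact: smooth_u].
Qed.

Lemma DE0_compatE L eta p : smooth_near (Acoef L) p.1 -> smooth_near (Bcoef L) p.1 ->
  smooth_near (Ccoef L) p.1 -> smooth_near eta p ->
  DE0_at L eta p <->
  dt eta p + ut_of L eta p * du eta p =
    dx (ut_of L eta) p + eta p * du (ut_of L eta) p.
Proof.
move=> sA sB sC se.
have sx : smooth_near (dx eta) p by exact: smooth_derive.
have su : smooth_near (du eta) p by exact: smooth_derive.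
have dB v := is_derive_mulf (is_derive_base v sB) (smooth_is_derive v se).
have dH v := is_derive_addf (is_derive_addf (is_derive_mulf (is_derive_base v sA)
    (is_derive_addf (smooth_is_derive v sx) (is_derive_mulf (smooth_is_derive v se) (smooth_is_derive v su))))
  (dB v)) (is_derive_mulf (is_derive_base v sC) (is_derive_u p v)).
have [_ Hx] := dH ex; have [_ Hu] := dH eu; have [_ BxE] := dB ex.
have sch : dx (du eta) p = du (dx eta) p by exact: smooth_schwarz.
rewrite /= !derive0 in Hx Hu.
have Hx' : dx (ut_of L eta) p = _ := Hx; have Hu' : du (ut_of L eta) p = _ := Hu.
rewrite Hx' Hu' -/(dx eta p) -/(du eta p) -/(dx (du eta) p) sch.
exact: de0_algebra.
Qed.

Definition characteristic Q f z : R :=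
  op_u Q (z.1, f z) - tau Q z.1.1 * dt f z - xi Q z.1 * dx f z.

Lemma characteristic_derive Q f z v : smooth_op z.1 Q -> smooth_near f z ->
  is_derive z v (characteristic Q f)
   (zeta1 Q z.1 * 'D_v f z + f z * 'D_(v.1) (zeta1 Q) z.1 + 'D_(v.1) (zeta0 Q) z.1
    - (tau Q z.1.1 * 'D_v (dt f) z + dt f z * (v.1.1 * derive1 (tau Q) z.1.1))
    - (xi Q z.1 * 'D_v (dx f) z + dx f z * 'D_(v.1) (xi Q) z.1)).
Proof.
move=> [st sx s1 s0] sf.
have sft : smooth_near (dt f) z by exact: smooth_derive.
have sfx : smooth_near (dx f) z by exact: smooth_derive.
exact: (is_derive_subf (is_derive_subf (is_derive_addf (is_derive_mulf (is_derive_base v s1) (smooth_is_derive v sf))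
    (is_derive_base v s0)) (is_derive_mulf (is_derive_time v st) (smooth_is_derive v sft)))
    (is_derive_mulf (is_derive_base v sx) (smooth_is_derive v sfx))).
Qed.

(** In the derivative of the characteristic, [f_xt] becomes [eta_t + f_t eta_u] and [f_xx] becomes
    [eta_x + eta eta_u]. Subtracting [eta_u W] removes every term with [f_t], and what remains is an
    expression in eta on the graph. *)
Lemma characteristic_defect Q f eta z : smooth_op z.1 Q -> smooth_near f z ->
  smooth_near eta (z.1, f z) -> (\forall z' \near z, dx f z' = eta (z'.1, f z')) ->
  dx (characteristic Q f) z - du eta (z.1, f z) * characteristic Q f z =
  c_eta (induced_op Q) (z.1, f z) (eta (z.1, f z))
   - (tau Q z.1.1 * dt eta (z.1, f z) + xi Q z.1 * dx eta (z.1, f z)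
      + op_u Q (z.1, f z) * du eta (z.1, f z)).
Proof.
move=> sQ sf se fe.
have E v : 'D_v (dx f) z = v.1.1 * dt eta (z.1, f z) + v.1.2 * dx eta (z.1, f z)
    + 'D_v f z * du eta (z.1, f z).
  rewrite (near_eq_derive v fe); have [_ ->] // := is_derive_graph v sf se.
have [_ Wx] := characteristic_derive ex sQ sf.
rewrite [dx (characteristic Q f) z]Wx /characteristic /op_u /= mul0r.
apply: characteristic_algebra.
- exact: nbhs_singleton fe.
- have fx : 'D_ex f z = eta (z.1, f z) := nbhs_singleton fe.
  by rewrite [LHS]E /= mul0r add0r mul1r fx.
- by rewrite [LHS](smooth_schwarz et ex sf) [LHS]E /= mul0r mul1r addr0.
Qed.

End Characteristic.

Lemma symmetry_algebra (R : realFieldType)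
  (A At Ax B Bt Bx C Ct Cx t t' x xt xx xxx z1 z1t z1x z1xx z0 z0t z0x z0xx : R)
  (f ft fx fxx fxt ftx ftt fxxx fxxt ftxx w wt wx wxx : R) :
  wt = z1 * ft + f * z1t + z0t - (t * ftt + ft * (1 * t')) - (x * ftx + fx * xt) ->
  wxx = z1 * fxx + fx * z1x + (f * z1xx + z1x * fx) + z0xx
       - (t * fxxt + fxt * (0 * t')) - (x * fxxx + fxx * xx) - (fx * xxx + xx * fxx) ->
  wx = z1 * fx + f * z1x + z0x - t * fxt - x * fxx - fx * xx ->
  w = z1 * f + z0 - t * ft - x * fx ->
  z1t * f + z0t + (z1 - t') * ft - xt * fx =
    (t * At + x * Ax) * fxx
    + A * (z1xx * f + z0xx + (2 * z1x - xxx) * fx + (z1 - 2 * xx) * fxx)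
    + (t * Bt + x * Bx) * fx + B * (z1x * f + z0x + (z1 - xx) * fx)
    + (t * Ct + x * Cx) * f + C * (z1 * f + z0) ->
  ftt = A * ftxx + fxx * At + (B * ftx + fx * Bt) + (C * ft + f * Ct) ->
  fxt = A * fxxx + fxx * Ax + (B * fxx + fx * Bx) + (C * fx + f * Cx) ->
  ftx = fxt -> ftxx = fxxt ->
  wt = A * wxx + B * wx + C * w.
Proof.
move=> -> -> -> ->; set S := (X in _ = X -> _) => LS.
(* The invariance criterion is solved for [z0t], which occurs in it with coefficient one; a
   polynomial identity is left. *)
have {LS} -> : z0t = S - z1t * f - (z1 - t') * ft + xt * fx by rewrite -LS; ring.
by move=> -> + -> -> => ->; rewrite /S; ring.
Qed.

Lemma drop_time_term (R : realFieldType) (a b c d e t : R) :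
  a - (b + c * (0 * t)) - (d + e) = a - b - d - e.
Proof. by ring. Qed.

(** * Characteristics of symmetries as solutions of the equation *)

Section Symmetry.
Context {R : realType}.
Implicit Types (L : evolution_eq R) (Q : operator R).
Implicit Types (f eta : R * R * R -> R) (z p v : R * R * R).

Let et : R * R * R := (1, 0, 0).
Let ex : R * R * R := (0, 1, 0).

Lemma near_fst (P : set (R * R)) z : (\forall q \near z.1, P q) -> \forall z' \near z, P z'.1.
Proof.
move=> h; have c : {for z, continuous (fst : R * R * R -> R * R)} by exact: differentiable_continuous.
exact: c. Qed.

Lemma near_fst2 (P : set R) z : (\forall t \near z.1.1, P t) -> \forall z' \near z, P z'.1.1.
Proof.
move=> h; apply: (@near_fst (fun q => P q.1)).
have c : {for z.1, continuous (fst : R * R -> R)} by exact: differentiable_continuous.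
exact: c.
Qed.

Lemma smooth_op_near Q z : smooth_op z.1 Q -> \forall z' \near z, smooth_op z'.1 Q.
Proof.
move=> [/smooth_nearW/near_fst2 h1 /smooth_nearW/near_fst h2 /smooth_nearW/near_fst h3
  /smooth_nearW/near_fst h4].
apply: filterS (filterI (filterI h1 h2) (filterI h3 h4)).
by move=> z' [] [] a1 a2 [] a3 a4.
Qed.

Lemma characteristic_dx_near Q f z : smooth_op z.1 Q -> smooth_near f z ->
  \forall z' \near z, dx (characteristic Q f) z' =
    zeta1 Q z'.1 * dx f z' + f z' * px (zeta1 Q) z'.1 + px (zeta0 Q) z'.1
    - tau Q z'.1.1 * dx (dt f) z' - xi Q z'.1 * dx (dx f) z' - dx f z' * px (xi Q) z'.1.
Proof.
move=> /smooth_op_near sQ /smooth_nearW sf.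
apply: filterS2 sQ sf => z' sQ sf; have [_ E] := characteristic_derive ex sQ sf.
exact: (etrans E (drop_time_term _ _ _ _ _ _)).
Qed.

(** The criterion is evaluated on the jet of [f]. As the equation holds in a neighbourhood it can be
    differentiated in [t] and [x]; these two relations, weighted by [tau] and [xi], account for the
    terms with derivatives of [f_t] and [f_x]. *)
Lemma symmetry_characteristic L Q f z :
  smooth_near (Acoef L) z.1 -> smooth_near (Bcoef L) z.1 -> smooth_near (Ccoef L) z.1 ->
  smooth_op z.1 Q -> smooth_near f z ->
  (forall u ux uxx ut : R,
    ut = Acoef L z.1 * uxx + Bcoef L z.1 * ux + Ccoef L z.1 * u ->
    pr_t Q z.1 u ux ut
    = op_act Q (Acoef L) z.1 * uxx + Acoef L z.1 * pr_xx Q z.1 u ux uxx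
      + op_act Q (Bcoef L) z.1 * ux + Bcoef L z.1 * pr_x Q z.1 u ux
      + op_act Q (Ccoef L) z.1 * u + Ccoef L z.1 * op_u Q (z.1, u)) ->
  (\forall z' \near z, dt f z' =
     Acoef L z'.1 * dx (dx f) z' + Bcoef L z'.1 * dx f z' + Ccoef L z'.1 * f z') ->
  dt (characteristic Q f) z = Acoef L z.1 * dx (dx (characteristic Q f)) z
    + Bcoef L z.1 * dx (characteristic Q f) z + Ccoef L z.1 * characteristic Q f z.
Proof.
move=> sA sB sC sQ sf sym sol; have [st sx s1 s0] := sQ.
have sfx : smooth_near (dx f) z by exact: smooth_derive.
have sft : smooth_near (dt f) z by exact: smooth_derive.
have sfxx : smooth_near (dx (dx f)) z by exact: smooth_derive.
have sftx : smooth_near (dx (dt f)) z by exact: smooth_derive.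
have s1x : smooth_near (px (zeta1 Q)) z.1 by exact: smooth_derive.
have s0x : smooth_near (px (zeta0 Q)) z.1 by exact: smooth_derive.
have sxx : smooth_near (px (xi Q)) z.1 by exact: smooth_derive.
have dE v := is_derive_addf (is_derive_addf (is_derive_mulf (is_derive_base v sA) (smooth_is_derive v sfxx))
  (is_derive_mulf (is_derive_base v sB) (smooth_is_derive v sfx)))
  (is_derive_mulf (is_derive_base v sC) (smooth_is_derive v sf)).
have Ev v : 'D_v (dt f) z = _ := etrans (near_eq_derive v sol) (@derive_val _ _ _ _ _ _ _ (dE v)).
have dW := is_derive_subf (is_derive_subf (is_derive_subf (is_derive_addf (is_derive_addf
    (is_derive_mulf (is_derive_base ex s1) (smooth_is_derive ex sfx))
    (is_derive_mulf (smooth_is_derive ex sf) (is_derive_base ex s1x)))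
    (is_derive_base ex s0x)) (is_derive_mulf (is_derive_time ex st) (smooth_is_derive ex sftx)))
  (is_derive_mulf (is_derive_base ex sx) (smooth_is_derive ex sfxx)))
  (is_derive_mulf (smooth_is_derive ex sfx) (is_derive_base ex sxx)).
have near_wx := characteristic_dx_near sQ sf.
have wxx : dx (dx (characteristic Q f)) z = _ :=
  etrans (near_eq_derive ex near_wx) (@derive_val _ _ _ _ _ _ _ dW).
have wx := nbhs_singleton near_wx.
have [_ wt] := characteristic_derive et sQ sf.
have fxt : 'D_et (dx f) z = dx (dt f) z by exact: smooth_schwarz.
have fxxt : 'D_et (dx (dx f)) z = 'D_ex (dx (dt f)) z.
  rewrite [LHS](smooth_schwarz ex et sfx); apply: near_eq_derive.
  by apply: filterS (smooth_nearW sf) => z' sf'; exact: smooth_schwarz.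
have ls := sym (f z) (dx f z) (dx (dx f) z) (dt f z) (nbhs_singleton sol).
have Et := Ev et; have Ex : dx (dt f) z = _ := Ev ex.
exact: (symmetry_algebra wt wxx wx erefl ls Et Ex fxt fxxt).
Qed.

End Symmetry.

Lemma select_t (R : realFieldType) (a b c : R) : 1 * a + 0 * b + c = a + c.
Proof. by ring. Qed.

Lemma select_x (R : realFieldType) (a b c : R) : 0 * a + 1 * b + c = b + c.
Proof. by ring. Qed.

Lemma select_u (R : realFieldType) (a b c : R) : 0 * a + 0 * b + c = c.
Proof. by ring. Qed.

Lemma gradient_algebra (R : realFieldType) (A B C e eu exu euu w wx wt wxx : R) :
  wx = eu * w -> wxx = eu * wx + w * (exu + e * euu) -> wt = A * wxx + B * wx + C * w ->
  wt = (A * (exu + (e * euu + eu * eu)) + B * eu + C) * w.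
Proof. by move=> -> -> ->; ring. Qed.

Lemma ut_of_du_algebra (R : realFieldType) (A B C e eu exu euu s u : R) :
  A * (exu + (e * euu + eu * eu)) + s * 0 + (B * eu + e * 0) + (C * 1 + u * 0) =
  A * (exu + (e * euu + eu * eu)) + B * eu + C.
Proof. by ring. Qed.

Lemma quotient_rule_zero (R : realFieldType) (h v w : R) : v != 0 ->
  w * (- (v * h) / v ^+ 2) + v^-1 * (h * w) = 0.
Proof. by move=> v0; field. Qed.

Lemma nbhsI (T : topologicalType) (x : T) (P Q : set T) :
  nbhs x P -> nbhs x Q -> nbhs x (P `&` Q).
Proof. exact: filterI. Qed.

(** * The linear system shared by characteristics and by [f_kappa] *)

Section FamilyGradient.
Context {R : realType}.
Implicit Types (L : evolution_eq R) (Q : operator R).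
Implicit Types (f eta r : R * R * R -> R) (z p v : R * R * R).

Let et : R * R * R := (1, 0, 0).
Let ex : R * R * R := (0, 1, 0).
Let eu : R * R * R := (0, 0, 1).

Lemma near_graph f z (P : set (R * R * R)) : smooth_near f z ->
  (\forall p \near (z.1, f z), P p) -> \forall z' \near z, P (z'.1, f z').
Proof.
move=> sf h; have c : {for z, continuous (fun z' : R * R * R => (z'.1, f z'))}.
  apply: differentiable_continuous; apply: differentiable_pair => //.
  exact: smooth_differentiable.
exact: c.
Qed.

Lemma derive_graph_eq f (g G : R * R * R -> R) z v : smooth_near f z ->
  smooth_near G (z.1, f z) -> (\forall z' \near z, g z' = G (z'.1, f z')) ->
  'D_v g z = v.1.1 * dt G (z.1, f z) + v.1.2 * dx G (z.1, f z) + 'D_v f z * du G (z.1, f z).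
Proof.
move=> sf sG gG; rewrite (near_eq_derive v gG); have [_ -> //] := is_derive_graph v sf sG.
Qed.

Lemma dx_graph_eq f (g G : R * R * R -> R) z : smooth_near f z ->
  smooth_near G (z.1, f z) -> (\forall z' \near z, g z' = G (z'.1, f z')) ->
  dx g z = dx G (z.1, f z) + dx f z * du G (z.1, f z).
Proof.
move=> sf sG gG; have E := derive_graph_eq ex sf sG gG.
exact: etrans E (select_x _ _ _).
Qed.

Lemma dt_graph_eq f (g G : R * R * R -> R) z : smooth_near f z ->
  smooth_near G (z.1, f z) -> (\forall z' \near z, g z' = G (z'.1, f z')) ->
  dt g z = dt G (z.1, f z) + dt f z * du G (z.1, f z).
Proof.
move=> sf sG gG; have E := derive_graph_eq et sf sG gG.
exact: etrans E (select_t _ _ _).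
Qed.

Lemma du_graph_eq f (g G : R * R * R -> R) z : smooth_near f z ->
  smooth_near G (z.1, f z) -> (\forall z' \near z, g z' = G (z'.1, f z')) ->
  du g z = du f z * du G (z.1, f z).
Proof.
move=> sf sG gG; have E := derive_graph_eq eu sf sG gG.
exact: etrans E (select_u _ _ _).
Qed.

Lemma solution_gradientE L f eta z : smooth_near f z -> smooth_near eta (z.1, f z) ->
  (\forall z' \near z, dx f z' = eta (z'.1, f z')) ->
  (dt f z = Acoef L z.1 * dx (dx f) z + Bcoef L z.1 * dx f z + Ccoef L z.1 * f z <->
   dt f z = ut_of L eta (z.1, f z)).
Proof.
by move=> sf se fx; rewrite (dx_graph_eq sf se fx) (nbhs_singleton fx).
Qed.

Lemma du_ut_of L eta p : smooth_near (Acoef L) p.1 -> smooth_near (Bcoef L) p.1 ->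
  smooth_near (Ccoef L) p.1 -> smooth_near eta p ->
  du (ut_of L eta) p = Acoef L p.1 * (dx (du eta) p
     + (eta p * du (du eta) p + du eta p * du eta p))
     + Bcoef L p.1 * du eta p + Ccoef L p.1.
Proof.
move=> sA sB sC se.
have sx : smooth_near (dx eta) p by exact: smooth_derive.
have su : smooth_near (du eta) p by exact: smooth_derive.
have [_ Hu] := is_derive_addf (is_derive_addf (is_derive_mulf (is_derive_base eu sA)
    (is_derive_addf (smooth_is_derive eu sx) (is_derive_mulf (smooth_is_derive eu se) (smooth_is_derive eu su))))
  (is_derive_mulf (is_derive_base eu sB) (smooth_is_derive eu se)))
  (is_derive_mulf (is_derive_base eu sC) (is_derive_u p eu)).
have sch : dx (du eta) p = du (dx eta) p by exact: smooth_schwarz.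
rewrite /= !derive0 in Hu; rewrite sch.
exact: (etrans Hu (ut_of_du_algebra _ _ _ _ _ _ _ _ _)).
Qed.

Lemma kappa_gradient f eta H z : smooth_near f z -> smooth_near eta (z.1, f z) ->
  smooth_near H (z.1, f z) -> (\forall z' \near z, dx f z' = eta (z'.1, f z')) ->
  (\forall z' \near z, dt f z' = H (z'.1, f z')) ->
  dx (du f) z = du f z * du eta (z.1, f z) /\ dt (du f) z = du f z * du H (z.1, f z).
Proof.
move=> sf se sH fx ft; split.
  by rewrite -(du_graph_eq sf se fx); exact: smooth_schwarz.
by rewrite -(du_graph_eq sf sH ft); exact: smooth_schwarz.
Qed.

Lemma characteristic_dx_invariant Q f eta z : smooth_op z.1 Q -> smooth_near f z ->
  smooth_near eta (z.1, f z) -> (\forall z' \near z, dx f z' = eta (z'.1, f z')) ->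
  tau Q z.1.1 * dt eta (z.1, f z) + xi Q z.1 * dx eta (z.1, f z)
      + op_u Q (z.1, f z) * du eta (z.1, f z)
    = c_eta (induced_op Q) (z.1, f z) (eta (z.1, f z)) <->
  dx (characteristic Q f) z = du eta (z.1, f z) * characteristic Q f z.
Proof.
move=> sQ sf se fx; have E := characteristic_defect sQ sf se fx; split=> h.
  by apply/eqP; rewrite -subr_eq0 E h subrr.
by apply/esym/eqP; rewrite -subr_eq0 -E h subrr.
Qed.

Lemma smooth_characteristic Q f z : smooth_op z.1 Q -> smooth_near f z ->
  smooth_near (characteristic Q f) z.
Proof.
move=> [st sx s1 s0] sf.
have st' := smooth_time st; have sx' := smooth_base sx.
have s1' := smooth_base s1; have s0' := smooth_base s0.
apply: smoothB; first apply: smoothB.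
- by apply: smoothD => //; exact: smoothM.
- by apply: smoothM => //; exact: smooth_derive.
- by apply: smoothM => //; exact: smooth_derive.
Qed.

(** Using [W_x = eta_u W] twice, the right-hand side [A W_xx + B W_x + C W] becomes a multiple of
    [W], and by [du_ut_of] its coefficient is the derivative of [ut_of L eta] in [u]. *)
Lemma characteristic_gradient L Q f eta z :
  smooth_near (Acoef L) z.1 -> smooth_near (Bcoef L) z.1 -> smooth_near (Ccoef L) z.1 ->
  smooth_op z.1 Q -> smooth_near f z -> smooth_near eta (z.1, f z) ->
  lie_symmetry L z.1 Q -> invariant0_near (z.1, f z) (induced_op Q) eta ->
  (\forall z' \near z, dx f z' = eta (z'.1, f z')) ->
  (\forall z' \near z, dt f z' = ut_of L eta (z'.1, f z')) ->
  dx (characteristic Q f) z = du eta (z.1, f z) * characteristic Q f z /\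
  dt (characteristic Q f) z = du (ut_of L eta) (z.1, f z) * characteristic Q f z.
Proof.
move=> sA sB sC sQ sf se sym inv fx ft.
have sdu : smooth_near (du eta) (z.1, f z) by exact: smooth_derive.
have sW := smooth_characteristic sQ sf.
have nse := near_graph sf (smooth_nearW se).
have ninv := near_graph sf inv.
have nWx : \forall z' \near z,
    dx (characteristic Q f) z' = du eta (z'.1, f z') * characteristic Q f z'.
  have nn := nbhsI (nbhsI (smooth_op_near sQ) (smooth_nearW sf))
    (nbhsI (nbhsI nse ninv) (near_join fx)).
  apply: filterS nn => z' [] [] sQ' sf' [] [] se' inv' fx'.
  by apply/(characteristic_dx_invariant sQ' sf' se' fx').
have Wx := nbhs_singleton nWx; split => //.
have nsol : \forall z' \near z, dt f z' =
   Acoef L z'.1 * dx (dx f) z' + Bcoef L z'.1 * dx f z' + Ccoef L z'.1 * f z'.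
  apply: filterS (nbhsI (nbhsI (smooth_nearW sf) nse) (nbhsI ft (near_join fx))).
  by move=> z' [] [] sf' se' [] ft' fx'; apply/(solution_gradientE L sf' se' fx').
have W := symmetry_characteristic sA sB sC sQ sf (nbhs_singleton sym) nsol.
have Wxx : dx (dx (characteristic Q f)) z = _ :=
  etrans (near_eq_derive ex nWx)
   (@derive_val _ _ _ _ _ _ _ (is_derive_mulf (smooth_is_derive ex (smooth_graph sf sdu)) (smooth_is_derive ex sW))).
have [_ duux0] := is_derive_graph ex sf sdu.
have duux := etrans duux0 (select_x _ _ _).
rewrite du_ut_of//; apply: (gradient_algebra Wx _ W).
apply: etrans Wxx _; congr (_ + _ * _).
by apply: etrans duux _; congr (_ + _ * _); exact: (nbhs_singleton fx).
Qed.

(** The mean value theorem is applied on horizontal segments, which stay in a ball of the maximum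
    norm; the dependence on the last coordinate remains free. *)
Lemma flat_constant r z0 :
  (\forall z \near z0, [/\ differentiable r z, dt r z = 0 & dx r z = 0]) ->
  \forall z \near z0, r z = r (z0.1, z.2).
Proof.
move=> h; have [d d0 dP] := iffLR (nbhs_normlP _ _) h.
apply: (iffRL (nbhs_normlP _ _)); exists d => // z zd.
pose v : R * R * R := (z.1 - z0.1, 0).
pose y : R * R * R := (z0.1, z.2).
have yv : y + v = z.
  rewrite -[y + v]/(z0.1 + (z.1 - z0.1), z.2 + 0) addr0 addrC subrK.
  by rewrite -surjective_pairing.
have inball (s : R) : 0 <= s <= 1 -> `|y + s *: v - z0| < d.
  move=> /andP[s0 s1].
  have -> : y + s *: v - z0 = (s *: (z.1 - z0.1), z.2 - z0.2).
    rewrite -[LHS]/(z0.1 + s *: (z.1 - z0.1) - z0.1, z.2 + s *: (0 : R) - z0.2).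
    by rewrite scaler0 addr0 addrAC subrr add0r.
  rewrite normr_pair_lt; apply/andP; split.
    rewrite normrZ ger0_norm//; apply: le_lt_trans (le_lt_trans (ler_norm_fst (z - z0)) zd).
    by apply: ler_piMl => //; exact: normr_ge0.
  exact: le_lt_trans (ler_norm_snd (z - z0)) zd.
have [|s s01 E] := @MVT_line _ _ r y v.
  by move=> s /inball/dP[].
move: E; rewrite yv => E.
have [dr tr xr] := dP _ (inball s s01).
apply/eqP; rewrite -subr_eq0; apply/eqP; rewrite [LHS]E derive3E// tr xr /lin3 /=.
by rewrite !mulr0 mul0r !addr0.
Qed.

Lemma characteristic_family L Q f eta z0 :
  smooth_near (Acoef L) z0.1 -> smooth_near (Bcoef L) z0.1 -> smooth_near (Ccoef L) z0.1 ->
  smooth_op z0.1 Q -> smooth_near f z0 -> smooth_near eta (z0.1, f z0) ->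
  lie_symmetry L z0.1 Q -> invariant0_near (z0.1, f z0) (induced_op Q) eta ->
  (\forall z \near z0, [/\ dt f z = ut_of L eta (z.1, f z), dx f z = eta (z.1, f z) &
     0 < du f z]) ->
  \forall z \near z0, characteristic Q f z =
    characteristic Q f (z0.1, z.2) / du f (z0.1, z.2) * du f z.
Proof.
move=> sA sB sC sQ sf se sym inv grad.
pose r z := characteristic Q f z * (du f z)^-1.
have n1 := nbhsI (nbhsI (near_fst (smooth_nearW sA)) (near_fst (smooth_nearW sB)))
  (near_fst (smooth_nearW sC)).
have n2 := nbhsI (nbhsI (smooth_op_near sQ) (smooth_nearW sf))
  (nbhsI (near_graph sf (smooth_nearW se)) (near_fst (near_join sym))).
have n3 := nbhsI (near_graph sf (near_join inv)) (near_join grad).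
have flat : \forall z \near z0, [/\ differentiable r z, dt r z = 0 & dx r z = 0].
  apply: filterS (nbhsI (nbhsI n1 n2) n3) => z [] [] [] [] sA' sB' sC' [] [] sQ' sf' [] se' sym'.
  move=> [] inv' grad'.
  have fx : \forall z' \near z, dx f z' = eta (z'.1, f z').
    by apply: filterS grad' => z' [].
  have ft : \forall z' \near z, dt f z' = ut_of L eta (z'.1, f z').
    by apply: filterS grad' => z' [].
  have [_ _ v0] := nbhs_singleton grad'.
  have vn : du f z != 0 by rewrite gt_eqF.
  have sv : smooth_near (du f) z by exact: smooth_derive.
  have sW := smooth_characteristic sQ' sf'.
  have [Wx Wt] := characteristic_gradient sA' sB' sC' sQ' sf' se' sym' inv' fx ft.
  have sH : smooth_near (ut_of L eta) (z.1, f z) by exact: smooth_ut_of.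
  have [vx vt] := kappa_gradient sf' se' sH fx ft.
  have dr v := is_derive_mulf (smooth_is_derive v sW) (is_derive_invf vn (smooth_is_derive v sv)).
  split.
  - by apply: smooth_differentiable; apply: smoothM => //; exact: smoothV.
  - have [_ E] := dr et; apply: etrans E _.
    have -> : 'D_et (characteristic Q f) z = _ := Wt.
    have -> : 'D_et (du f) z = _ := vt.
    exact: quotient_rule_zero.
  - have [_ E] := dr ex; apply: etrans E _.
    have -> : 'D_ex (characteristic Q f) z = _ := Wx.
    have -> : 'D_ex (du f) z = _ := vx.
    exact: quotient_rule_zero.
apply: filterS (nbhsI (flat_constant flat) grad) => z [] E [] _ _ v0.
have vn : du f z != 0 by rewrite gt_eqF.
rewrite -[_ / _]/(r (z0.1, z.2)) -E /r divfK//.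
Qed.

End FamilyGradient.

(** * Ranks and bases of operators *)

Lemma nbhs_all (T : topologicalType) (x : T) (P : set T) : (forall y, P y) -> nbhs x P.
Proof. by move=> h; exact: filterE. Qed.

(** A vector orthogonal to the rows [(0, 1, e)] and [(1, 0, h)] is a multiple of [(- h, - e, 1)],
    and its product with row [i] is the quantity assumed nonzero. So only 0 is orthogonal to all
    rows. *)
Lemma rank_transversal (R : realFieldType) (M : 'M[R]_(4, 3)) (i : 'I_4) (e h : R) :
  M (inord 2) 0 = 0 -> M (inord 2) 1 = 1 -> M (inord 2) (inord 2) = e ->
  M (inord 3) 0 = 1 -> M (inord 3) 1 = 0 -> M (inord 3) (inord 2) = h ->
  M i (inord 2) - M i 0 * h - M i 1 * e != 0 -> \rank M = 3%N.
Proof.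
move=> h20 h21 h22 h30 h31 h32 W; rewrite -mxrank_tr; apply/eqP.
apply: inj_row_free => v /rowP v0.
have o2 : inord 2 = lift ord0 (lift ord0 ord0) :> 'I_3 by apply/val_inj; rewrite /= inordK.
have o1 : 1 = lift ord0 ord0 :> 'I_3 by apply/val_inj.
have vE k : v 0 0 * M k 0 + v 0 1 * M k 1 + v 0 (inord 2) * M k (inord 2) = 0.
  have := v0 k; rewrite !mxE !big_ord_recl big_ord0 addr0 !mxE -o2 -o1 addrA.
  exact.
have E3 := vE (inord 2); have E2 := vE (inord 3); have E1 := vE i.
rewrite h20 h21 h22 mulr0 mulr1 add0r in E3.
rewrite h30 h31 h32 mulr0 mulr1 addr0 in E2.
have a0 : v 0 0 = - (v 0 (inord 2) * h) by apply/eqP; rewrite -addr_eq0 E2.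
have a1 : v 0 1 = - (v 0 (inord 2) * e) by apply/eqP; rewrite -addr_eq0 E3.
have /eqP : v 0 (inord 2) * (M i (inord 2) - M i 0 * h - M i 1 * e) = 0.
  by rewrite -[RHS]E1 a0 a1; ring.
rewrite mulf_eq0 (negPf W) orbF => /eqP a2.
apply/rowP => k; rewrite mxE.
case: k => -[|[|[|//]]] kP.
- by rewrite (_ : Ordinal kP = 0) ?a0 ?a2 ?mul0r ?oppr0//; exact/val_inj.
- by rewrite (_ : Ordinal kP = 1) ?a1 ?a2 ?mul0r ?oppr0//; exact/val_inj.
- by rewrite (_ : Ordinal kP = inord 2) ?a2//; apply/val_inj; rewrite /= inordK.
Qed.

(** Rows 3 and 2 restricted to the first two columns form the identity matrix, so each row is a
    combination of these two, with its own first two entries as coefficients. *)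
Lemma rank_tangent (R : realFieldType) (M : 'M[R]_(4, 3)) (e h : R) :
  M (inord 2) 0 = 0 -> M (inord 2) 1 = 1 -> M (inord 3) 0 = 1 -> M (inord 3) 1 = 0 ->
  (forall i, M i (inord 2) = M i 0 * h + M i 1 * e) -> \rank M = 2%N.
Proof.
move=> h20 h21 h30 h31 W.
pose K : 'M[R]_(2, 3) := \matrix_(i, j) M (if i == 0 then inord 3 else inord 2) j.
pose N : 'M[R]_(4, 2) := \matrix_(i, j) M i (if j == 0 then 0 else 1).
have o2 : inord 2 = lift ord0 (lift ord0 ord0) :> 'I_3 by apply/val_inj; rewrite /= inordK.
have o1 : 1 = lift ord0 ord0 :> 'I_3 by apply/val_inj.
have o1' : 1 = lift ord0 ord0 :> 'I_2 by apply/val_inj.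
have MNK : M = N *m K.
  apply/matrixP => i j; rewrite mxE !big_ord_recl big_ord0 addr0 !mxE /= -?o1'.
  case: j => -[|[|[|//]]] jP.
  - by rewrite (_ : Ordinal jP = 0) ?h20 ?h30 ?mulr0 ?mulr1 ?addr0//; exact/val_inj.
  - by rewrite (_ : Ordinal jP = 1) ?h21 ?h31 ?mulr0 ?mulr1 ?add0r//; exact/val_inj.
  - have -> : Ordinal jP = inord 2 by apply/val_inj; rewrite /= inordK.
    rewrite W (W (inord 3)) (W (inord 2)) h20 h21 h30 h31.
    by rewrite !mul1r !mul0r addr0 add0r.
apply/eqP; rewrite eqn_leq; apply/andP; split.
  by rewrite MNK (leq_trans (mxrankM_maxr _ _))// rank_leq_row.
have rK : \rank K = 2%N.
  apply/eqP/inj_row_free => v /rowP v0.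
  have vE k : v 0 0 * M (inord 3) k + v 0 1 * M (inord 2) k = 0.
    have := v0 k; rewrite !mxE !big_ord_recl big_ord0 addr0 !mxE /= -?o1'.
    exact.
  have := vE 0; have := vE 1; rewrite h20 h21 h30 h31 !mulr0 !mulr1 addr0 add0r => a1 a0.
  apply/rowP => k; rewrite mxE; case: k => -[|[|//]] kP.
  - by rewrite (_ : Ordinal kP = 0) ?a0//; exact/val_inj.
  - by rewrite (_ : Ordinal kP = 1) ?a1//; exact/val_inj.
have KE : K = rowsub (fun i : 'I_2 => if i == 0 then inord 3 else inord 2) M.
  by apply/matrixP => i j; rewrite !mxE.
apply: (@leq_trans (\rank K)); first by rewrite rK.
by rewrite KE; exact/mxrankS/rowsub_sub.
Qed.

Section Span.
Context {R : realType}.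
Implicit Types (L : evolution_eq R) (P Q S : operator R) (g : set (operator R)).
Implicit Types (f eta : R * R * R -> R) (z p : R * R * R).

(** The form [du - H dt - eta dx] evaluated on [Q]. It is the characteristic on the leaf through
    [p], but as a function of the point alone, and it vanishes exactly when [Q] is tangent to that
    leaf. *)
Definition transversal L eta Q p : R :=
  op_u Q p - tau Q p.1.1 * ut_of L eta p - xi Q p.1 * eta p.

Lemma characteristicE L eta Q f z : dt f z = ut_of L eta (z.1, f z) ->
  dx f z = eta (z.1, f z) -> characteristic Q f z = transversal L eta Q (z.1, f z).
Proof. by move=> ft fx; rewrite /characteristic ft fx. Qed.

Definition graph_mx L eta P Q p : 'M[R]_(4, 3) :=
  rows_mx 4 3 [:: coefs3 (induced_op P) p (eta p); coefs3 (induced_op Q) p (eta p);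
    [:: 0; 1; eta p]; [:: 1; 0; ut_of L eta p]].

(** Only the ranks 2 and 3 occur. Local constancy thus means that either both operators are tangent
    to the leaves throughout a neighbourhood, or at each nearby point one of them is transversal. *)
Lemma rank_graph_mx L eta P Q p : \rank (graph_mx L eta P Q p) =
  if (transversal L eta P p == 0) && (transversal L eta Q p == 0) then 2%N else 3%N.
Proof.
have i2 : (inord 2 : 'I_3) = 2%N :> nat by rewrite inordK.
have k2 : (inord 2 : 'I_4) = 2%N :> nat by rewrite inordK.
have k3 : (inord 3 : 'I_4) = 3%N :> nat by rewrite inordK.
have mP : graph_mx L eta P Q p 0 (inord 2) - graph_mx L eta P Q p 0 0 * ut_of L eta p
    - graph_mx L eta P Q p 0 1 * eta p = transversal L eta P p.
  by rewrite /graph_mx /rows_mx !mxE i2.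
have mQ : graph_mx L eta P Q p 1 (inord 2) - graph_mx L eta P Q p 1 0 * ut_of L eta p
    - graph_mx L eta P Q p 1 1 * eta p = transversal L eta Q p.
  by rewrite /graph_mx /rows_mx !mxE i2.
have [/andP[/eqP tP /eqP tQ]|] := ifPn.
  apply: (@rank_tangent _ _ (eta p) (ut_of L eta p)); try by rewrite !mxE ?k2 ?k3.
  move=> i; apply/eqP; rewrite -subr_eq0 opprD addrA; apply/eqP.
  case: i => -[|[|[|[|//]]]] iP.
  - by rewrite (_ : Ordinal iP = 0) ?mP ?tP//; exact/val_inj.
  - by rewrite (_ : Ordinal iP = 1) ?mQ ?tQ//; exact/val_inj.
  - by rewrite !mxE i2 /= mul0r mul1r subr0 subrr.
  - by rewrite !mxE i2 /= mul0r mul1r subrr subr0.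
rewrite negb_and => /orP[tP|tQ].
  apply: (@rank_transversal _ _ 0 (eta p) (ut_of L eta p));
    first [by rewrite mP|by rewrite !mxE ?k2 ?k3 ?i2].
apply: (@rank_transversal _ _ 1 (eta p) (ut_of L eta p));
  first [by rewrite mQ|by rewrite !mxE ?k2 ?k3 ?i2].
Qed.

Lemma transversal_lincomb L eta a P b Q S p :
  [/\ tau S p.1.1 = tau (lincomb a P b Q) p.1.1, xi S p.1 = xi (lincomb a P b Q) p.1,
      zeta1 S p.1 = zeta1 (lincomb a P b Q) p.1 & zeta0 S p.1 = zeta0 (lincomb a P b Q) p.1] ->
  transversal L eta S p = a * transversal L eta P p + b * transversal L eta Q p.
Proof. by rewrite /transversal /op_u => -[-> -> -> ->] /=; ring. Qed.

Lemma characteristic_lincomb a P b Q S f z :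
  [/\ tau S z.1.1 = tau (lincomb a P b Q) z.1.1, xi S z.1 = xi (lincomb a P b Q) z.1,
      zeta1 S z.1 = zeta1 (lincomb a P b Q) z.1 & zeta0 S z.1 = zeta0 (lincomb a P b Q) z.1] ->
  characteristic S f z = a * characteristic P f z + b * characteristic Q f z.
Proof. by rewrite /characteristic /op_u => -[-> -> -> ->] /=; ring. Qed.

Lemma op_eq_refl q0 S : op_eq_near q0 S S.
Proof. by apply: nbhs_all => q; split. Qed.

Lemma op_eq_sym q0 P Q : op_eq_near q0 P Q -> op_eq_near q0 Q P.
Proof. by apply: filterS => q [-> -> -> ->]. Qed.

Lemma op_eq_trans q0 P Q S : op_eq_near q0 P Q -> op_eq_near q0 Q S -> op_eq_near q0 P S.
Proof. by apply: filterS2 => q [-> -> -> ->]. Qed.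

Lemma op_eq_lincomb q0 a b P P' Q Q' : op_eq_near q0 P P' -> op_eq_near q0 Q Q' ->
  op_eq_near q0 (lincomb a P b Q) (lincomb a P' b Q').
Proof. by apply: filterS2 => q [/= -> -> -> ->] [-> -> -> ->]. Qed.

Lemma lincomb_lincomb q0 a b c d c' d' P Q :
  op_eq_near q0 (lincomb a (lincomb c P d Q) b (lincomb c' P d' Q))
    (lincomb (a * c + b * c') P (a * d + b * d') Q).
Proof. by apply: nbhs_all => q /=; split; ring. Qed.

(* Cramer's rule. *)
Lemma independent_basis q0 g P Q S T : op_basis q0 g P Q -> g S -> g T ->
  independent q0 S T -> op_basis q0 g S T.
Proof.
move=> [indPQ gE]; rewrite gE => -[a [b SE]] [c [d TE]] indST.
split => //.
have detE : a * d - b * c != 0.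
  apply/eqP => det0.
  have comb x y : op_eq_near q0 (lincomb x S y T)
      (lincomb (x * a + y * c) P (x * b + y * d) Q).
    exact: op_eq_trans (op_eq_lincomb x y SE TE) (lincomb_lincomb q0 x y a b c d P Q).
  have zero x y : x * a + y * c = 0 -> x * b + y * d = 0 -> x = 0 /\ y = 0.
    move=> h1 h2; apply: indST; apply: op_eq_trans (comb x y) _.
    by rewrite h1 h2; apply: nbhs_all => q /=; rewrite !mul0r addr0.
  have [d0 b0] : d = 0 /\ - b = 0 by apply: zero; [move: det0 => <-; ring|ring].
  have [c0 a0] : - c = 0 /\ a = 0 by apply: zero; [ring|move: det0 => <-; ring].
  have b1 : b = 0 by apply/eqP; rewrite -oppr_eq0 b0.
  have [/eqP] : (1 : R) = 0 /\ (0 : R) = 0.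
    by apply: zero; rewrite ?a0 ?b1 mulr0 mul0r addr0.
  by rewrite oner_eq0.
apply/seteqP; split => X; last first.
  move=> [x [y XE]]; exists (x * a + y * c), (x * b + y * d).
  apply: op_eq_trans XE _.
  exact: op_eq_trans (op_eq_lincomb x y SE TE) (lincomb_lincomb q0 x y a b c d P Q).
move=> [x [y XE]].
pose D := a * d - b * c.
exists ((x * d - y * c) / D), ((y * a - x * b) / D).
apply: op_eq_trans XE _; apply: op_eq_sym.
apply: op_eq_trans (op_eq_lincomb _ _ SE TE) _.
apply: op_eq_trans (lincomb_lincomb q0 _ _ a b c d P Q) _.
have -> : (x * d - y * c) / D * a + (y * a - x * b) / D * c = x by rewrite /D; field.
have -> : (x * d - y * c) / D * b + (y * a - x * b) / D * d = y by rewrite /D; field.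
exact: op_eq_refl.
Qed.

End Span.

(** * Flows and orbits *)

Section Flows.
Context {R : realType}.
Implicit Types (Q : operator R) (p : R * R * R) (s : R).

Lemma smooth_scalar_bounds (G : R * R * R -> R) (c1 c2 c3 : R) :
  smooth_near G (c1, c2, c3) ->
  exists r M : R, [/\ 0 < r, 1 <= M,
    (forall p, `|p - (c1, c2, c3)| < r -> `|G p| <= M),
    (forall p, `|p - (c1, c2, c3)| < r -> {for p, continuous G}) &
    (forall a b y y', `|(a, b, y) - (c1, c2, c3)| < r ->
      `|(a, b, y') - (c1, c2, c3)| < r ->
      `|G (a, b, y) - G (a, b, y')| <= M * `|y - y'|)].
Proof.
move=> sG; have [M M1 bG] := smooth_jet_bounded sG; have [U [oU Up] CU] := sG.
have h : \forall q \near (c1, c2, c3), [/\ `|G q| <= M, `|dt G q| <= M, `|dx G q| <= M & `|du G q| <= M] /\ U q.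
  by apply: filterS2 bG (open_nbhs_nbhs (conj oU Up)).
have [r r0 rP] := iffLR (nbhs_normlP _ _) h.
have CGr n : class_C n [set p | `|p - (c1, c2, c3)| < r] G.
  by apply: class_C_subset (CU n) => p /rP[].
exists r, M; split => //.
- by move=> p /rP[[]].
- by move=> p pr; apply: (class_C_continuous (CGr 0%N)).
- move=> a b y y' h1 h2; apply: (leaf_lip CGr) => // p /rP[] [] //.
Qed.

(** Two arguments of the field are prescribed curves. Since [tau] depends on [t] and [xi] on
    [(t, x)], a flow is obtained from three such scalar equations; the growth bound in the
    conclusion lets each solution serve as a prescribed curve in the next one. *)
Lemma picard_smooth (G : R * R * R -> R) (c1 c2 c3 : R) :
  smooth_near G (c1, c2, c3) ->
  exists r e0 M : R, [/\ 0 < r, 0 < e0, 0 < M &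
    forall (e : R) (a b : R -> R) (y0 : R), 0 < e -> e <= e0 ->
      (forall s, `|s| <= e -> [/\ {for s, continuous a}, {for s, continuous b},
         `|a s - c1| < r & `|b s - c2| < r]) ->
      `|y0 - c3| < r ->
      exists y : R -> R, [/\ y 0 = y0,
        forall s, `|s| < e -> is_derive s 1 y (G (a s, b s, y s)) &
        forall s, `|s| < e -> `|y s - c3| <= `|y0 - c3| + M * `|s|]].
Proof.
move=> /smooth_scalar_bounds[r [M [r0 M1 bG cG lG]]].
have M0 : 0 < M by exact: lt_le_trans M1.
have r4 : 0 < r / 4 by rewrite divr_gt0.
(* [1 / (2 * M)] makes the iteration contract, and with [|y0 - c3| < r / 4] the time bound
   [r / (4 * M)] keeps the solution within [r / 2] of [c3]. *)
exists (r / 4), (Num.min (1 / (2 * M)) (r / (4 * M))), M; split => //.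
  by rewrite lt_min !divr_gt0// mulr_gt0.
move=> e a b y0 e0; rewrite le_min => /andP[e1 e2] ab y0r.
have rr : r / 4 < r by move: r0; lra.
have rh : r / 2 < r by move: r0; lra.
have inb s y : `|s| <= e -> `|y - c3| <= r / 2 -> `|(a s, b s, y) - (c1, c2, c3)| < r.
  move=> se yr; have [_ _ h1 h2] := ab s se; apply/ball3E.
  by split => /=; [exact: lt_trans rr|exact: lt_trans rr|exact: le_lt_trans rh].
have h1 : e * M <= 2^-1.
  have : e * (2 * M) <= 1 by rewrite -ler_pdivlMr// mulr_gt0.
  by move: (e * M) (mulrCA e 2 M) => x ->; lra.
have h2 : M * e <= r / 4.
  have : e * (4 * M) <= r by rewrite -ler_pdivlMr// mulr_gt0.
  by rewrite mulrCA mulrC [e * M]mulrC; move: (M * e) => x; lra.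
have h3 : `|y0 - c3| + M * e <= r / 2 by move: h2 y0r; lra.
have [] := @picard R (fun s y => G (a s, b s, y)) c3 y0 (r / 2) M M e e0.
- by move: r0; lra.
- exact: ltW.
- exact: ltW.
- exact: h1.
- exact: h3.
- move=> s y se yr; have [ca cb _ _] := ab s se.
  have c : {for s, continuous (fun s => (a s, b s, y))}.
    exact: (cvg_pair (cvg_pair ca cb) (cvg_cst y)).
  by apply: (@continuous_comp _ _ _ (fun s => (a s, b s, y)) G) => //; apply/cG/inb.
- by move=> s y se yr; apply/bG/inb.
- by move=> s y y' se yr y'r; apply: lG; exact: inb.
move=> y [y00 dy yb]; exists y; split => // s /yb[_ h].
rewrite -(subrKA y0) addrC; apply: le_trans (ler_normD _ _) _.
by rewrite lerD2l.
Qed.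

(** Smoothness is a bootstrap on the equation: if [theta] is of class C^n, then so is [c \o theta],
    which is its derivative. *)
Lemma smooth_autonomous_ode (c : R -> R) (k0 : R) : smooth_near c k0 ->
  exists theta : R -> R, [/\ smooth_near theta 0, theta 0 = k0 &
    \forall s \near (0 : R), is_derive (s : R) 1 theta (c (theta s))].
Proof.
move=> sc; have sG : smooth_near (fun p : R * R * R => c p.2) (0, 0, k0) by exact: smooth_snd.
have [r [e0 [M [r0 e00 M0 P]]]] := picard_smooth sG.
have [|| y [y0 dy yb]] := P e0 (fun=> 0) (fun=> 0) k0 e00 (lexx _).
- by move=> s _; split; rewrite ?subrr ?normr0//; exact: cvg_cst.
- by rewrite subrr normr0.
have [U [oU Up] CU] := sc.
have ns : \forall s \near (0 : R), `|s| < e0.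
  by apply: (iffRL (nbhs_normlP _ _)); exists e0 => // s; rewrite subr0.
have nU : \forall s \near (0 : R), U (y s).
  have c0 : {for (0 : R), continuous y}.
    have d0 : is_derive (0 : R) 1 y (c (y 0)) by apply: dy; rewrite normr0.
    exact: is_derive_continuous d0.
  by apply: c0; rewrite y0; exact: open_nbhs_nbhs (conj oU Up).
exists y; split => //; last by apply: filterS ns.
have [d d0 dP] := iffLR (nbhs_normlP _ _) (nbhsI ns nU).
have oW : open [set s : R | `|s - 0| < d] by exact: open_norm_lt.
exists [set s : R | `|s - 0| < d]; first by split => //=; rewrite subr0 normr0.
elim=> [|n IH]; first by move=> s /dP[/dy/is_derive_continuous].
split=> [s /dP[/dy[]]|v]; first by move=> /derivable1_diffP.
have Cc : class_C n [set s : R | `|s - 0| < d] (fun s => c (y s)).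
  have CU' : class_C n [set p : R * R * R | U p.2] (c \o snd).
    apply: (class_C_affine (l := snd) (U' := U)) => //.
    by apply: open_comp => // p _; apply: differentiable_continuous.
  apply: (class_C_triple oW _ (class_C_cst n _ 0) (class_C_cst n _ 0) IH CU').
  by move=> s /dP[].
apply: eq_class_C (class_CM oW (class_C_cst n _ v) Cc) => // s /dP[sd _].
have [/derivable1_diffP df dE] := dy s sd.
have -> : 'D_v y s = 'D_(v *: (1 : R)) y s by rewrite /GRing.scale /= mulr1.
by rewrite deriveZv// dE.
Qed.

Lemma flow_curve Q p0 : smooth_op p0.1 Q -> exists d e : R, [/\ 0 < d, 0 < e &
  forall p, `|p - p0| < d -> exists gam : R -> R * R * R, gam 0 = p /\
    forall s, `|s| < e -> is_derive s 1 gam (vector_at Q (gam s))].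
Proof.
case: p0 => -[t0 x0] u0 [/= st sx s1 s0].
have sG1 : smooth_near (fun p : R * R * R => tau Q p.2) (0, 0, t0) by exact: smooth_snd.
have sG2 : smooth_near (fun p : R * R * R => xi Q (p.1.1, p.2)) (t0, 0, x0).
  have d p : is_diff p (fun p : R * R * R => (p.1.1, p.2)) (fun p => (p.1.1, p.2)).
    by apply: is_diff_pair; exact: is_diff_comp.
  exact: (smooth_affine (F := xi Q) (G := fun p : R * R * R => (p.1.1, p.2)) d).
have sG3 : smooth_near (op_u Q) (t0, x0, u0).
  apply: smoothD; last exact: smooth_base.
  by apply: smoothM; [exact: smooth_base|exact: smooth_u].
have [r1 [e1 [M1 [r10 e10 M10 P1]]]] := picard_smooth sG1.
have [r2 [e2 [M2 [r20 e20 M20 P2]]]] := picard_smooth sG2.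
have [r3 [e3 [M3 [r30 e30 M30 P3]]]] := picard_smooth sG3.
(* The times shrink from [e1] to [ex] to [eu], so that the components already found stay within the
   radius that the next equation allows for its prescribed curves. *)
pose ex := Num.min e2 (Num.min (e1 / 2) (r2 / (2 * M1))).
have ex0 : 0 < ex by rewrite !lt_min e20 !divr_gt0// mulr_gt0.
pose eu := Num.min (Num.min e3 (ex / 2)) (Num.min (r3 / (2 * M1)) (r3 / (2 * M2))).
have eu0 : 0 < eu by rewrite !lt_min e30 !divr_gt0// mulr_gt0.
pose d := Num.min (Num.min r1 (r2 / 2)) (r3 / 2).
have d0 : 0 < d by rewrite !lt_min r10 !divr_gt0.
have ex1 : ex < e1.
  by apply: (@le_lt_trans _ _ (e1 / 2)); [rewrite !ge_min lexx orbT|move: e10; lra].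
have euex : eu < ex.
  by apply: (@le_lt_trans _ _ (ex / 2)); [rewrite !ge_min lexx !orbT|move: ex0; lra].
have small (r M x s : R) : 0 < M -> `|x| < r / 2 -> `|s| <= r / (2 * M) -> `|x| + M * `|s| < r.
  move=> M0 xr; rewrite ler_pdivlMr ?mulr_gt0// => h.
  by move: xr h; rewrite mulrCA [`|s| * M]mulrC; move: (M * `|s|) => y; lra.
exists d, eu; split => // -[[t x] u] /ball3E[/=]; rewrite !lt_min.
move=> /andP[/andP[t1 t2] t3] /andP[/andP[x1 x2] x3] /andP[/andP[u1 u2] u3].
have r3h : r3 / 2 < r3 by move: r30; lra.
have r2h : r2 / 2 < r2 by move: r20; lra.
have [|| T [T0 dT bT]] := P1 e1 (fun=> 0) (fun=> 0) t e10 (lexx _).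
- by move=> s _; split; rewrite ?subrr ?normr0//; exact: cvg_cst.
- exact: t1.
have [||| X [X0 dX bX]] := P2 ex T (fun=> 0) x ex0.
- by rewrite !ge_min lexx.
- move=> s sex; have se1 := le_lt_trans sex ex1; split.
  + exact: is_derive_continuous (dT s se1).
  + exact: cvg_cst.
  + apply: le_lt_trans (bT s se1) _; apply: small => //.
    by apply: le_trans sex _; rewrite !ge_min lexx !orbT.
  + by rewrite subrr normr0.
- exact: lt_trans r2h.
have [||| Y [Y0 dY _]] := P3 eu T X u eu0.
- by rewrite !ge_min lexx.
- move=> s seu; have sex := le_lt_trans seu euex; have se1 := lt_trans sex ex1; split.
  + exact: is_derive_continuous (dT s se1).
  + exact: is_derive_continuous (dX s sex).
  + apply: le_lt_trans (bT s se1) _; apply: small => //.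
    by apply: le_trans seu _; rewrite !ge_min lexx !orbT.
  + apply: le_lt_trans (bX s sex) _; apply: small => //.
    by apply: le_trans seu _; rewrite !ge_min lexx !orbT.
- exact: lt_trans r3h.
exists (fun s => (T s, X s, Y s)); split; first by rewrite T0 X0 Y0.
move=> s seu; have sex := lt_trans seu euex; have se1 := lt_trans sex ex1.
exact: is_derive_pair (is_derive_pair (dT s se1) (dX s sex)) (dY s seu).
Qed.

(** The curves are chosen point by point. No regularity in the starting point is claimed; what is
    needed of it follows later from confinement and uniqueness. *)
Lemma local_flow_exists Q p0 : smooth_op p0.1 Q -> exists Psi, local_flow Q p0 Psi.
Proof.
move=> /flow_curve[d [e [d0 e0 H]]].
have H' p : exists g : R -> R * R * R, `|p - p0| < d ->
    g 0 = p /\ forall s, `|s| < e -> is_derive s 1 g (vector_at Q (g s)).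
  have [/H[g gP]|np] := boolP (`|p - p0| < d); first by exists g.
  by exists (fun=> p) => h; case/negP: np.
have [gam gamP] := choice H'.
exists (fun s p => gam p s); split.
  by apply: (iffRL (nbhs_normlP _ _)); exists d => // p /gamP[].
apply: (iffRL (nbhs_normlP _ _)); exists (Num.min d e); first by rewrite lt_min d0.
move=> [s p]; rewrite -[_ - _]/(s - 0, p - p0) subr0 normr_pair_lt !lt_min.
by move=> /andP[/andP[_ se] /andP[pd _]]; have [_] := gamP p pd; apply.
Qed.

End Flows.

(** * Confinement of integral curves *)

Section FlowProperties.
Context {R : realType}.
Implicit Types (Q : operator R) (p : R * R * R) (s t : R).

(** Serves to run curves backwards and to rescale a time interval of either sign to [[0, 1]]. *)
Lemma is_derive_affine_curve (V : normedModType R) (gam : R -> V) (g' : V) (a b t : R) :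
  is_derive (a + b * t) 1 gam g' -> is_derive t 1 (fun s => gam (a + b * s)) (b *: g').
Proof.
move=> dg; have [/derivable1_diffP dfg gE] := dg.
have dl : is_diff t (fun s : R => a + b * s) ( *%R b).
  rewrite [X in is_diff _ _ X](_ : _ = (0 : R -> R) + (fun s => b *: s)); last first.
    by apply/funext => s; rewrite /= add0r.
  exact: is_diffD.
have dlf := @ex_diff _ _ _ _ _ _ _ dl.
have dc : differentiable (gam \o (fun s => a + b * s)) t by exact: differentiable_comp.
apply: DeriveDef; first exact/derivable1_diffP.
rewrite (deriveE _ dc) (diff_comp dlf dfg) /= [in X in 'd gam _ X](@diff_val _ _ _ _ _ _ _ dl).
rewrite mulr1; have -> : 'd gam (a + b * t) b = b *: 'd gam (a + b * t) 1.
  by rewrite -linearZ; congr ('d gam _ _); rewrite /GRing.scale /= mulr1.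
by rewrite -(deriveE _ dfg) gE.
Qed.

Lemma MVT_open (f f' : R -> R) (a b : R) : a < b ->
  (forall t, a <= t <= b -> is_derive t 1 f (f' t)) ->
  exists2 t, a < t < b & f b - f a = f' t * (b - a).
Proof.
move=> ab df; have [||t tab tE] := @MVT R f f' a b ab.
- by move=> t /subset_itv_oo_cc; rewrite in_itv; exact: df.
- apply: derivable_within_continuous => t; rewrite in_itv => tab.
  by have [] := df t tab.
by exists t => //; move: tab; rewrite in_itv.
Qed.

(* First exit time: the curve cannot reach distance [r] before time [b] at speed at most [M]. *)
Lemma curve_confined (gam gam' : R -> R * R * R) p (r M b : R) : 0 <= M ->
  (forall t, 0 <= t <= b -> is_derive t 1 gam (gam' t)) ->
  (forall t, 0 <= t <= b -> `|gam t - p| < r -> `|gam' t| <= M) ->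
  `|gam 0 - p| + M * b < r -> forall t, 0 <= t <= b -> `|gam t - p| < r.
Proof.
move=> M0 dg bg g0 t1 /andP[t10 t1b]; have [//|rt1] := ltP `|gam t1 - p| r; exfalso.
pose E := [set t : R | 0 <= t <= t1 /\ r <= `|gam t - p|].
have Et1 : E t1 by split => //; rewrite t10 lexx.
have iE : has_inf E by split; [exists t1|exists 0 => t [/andP[]]].
pose T := inf E.
have T0 : 0 <= T by apply: lb_le_inf; [exists t1|move=> t [/andP[]]].
have Tt1 : T <= t1 by apply: (ge_inf (proj2 iE)).
have Tb : 0 <= T <= b by rewrite T0 (le_trans Tt1).
have early t : 0 <= t -> t < T -> `|gam t - p| < r.
  move=> t0 tT; have [//|rt] := ltP `|gam t - p| r; exfalso.
  have Et : E t by split => //; rewrite t0 (le_trans (ltW tT)).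
  by have := ge_inf (proj2 iE) Et; rewrite leNgt tT.
have cn : {for T, continuous (fun t => `|gam t - p|)}.
  have [/derivable1_diffP/differentiable_continuous c _] := dg T Tb.
  apply: (@continuous_comp _ _ _ (fun t => gam t - p) (fun q => `|q|)); last exact: norm_continuous.
  by apply: cvgB => //; exact: cvg_cst.
have late : r <= `|gam T - p|.
  have [//|Tr] := leP r `|gam T - p|; exfalso.
  have h : \forall t \near T, `|gam t - p| < r by exact: (cvgr_lt _ cn _ Tr).
  have [e e0 eP] := iffLR (nbhs_normlP _ _) h.
  have [t Et tT] := inf_adherent e0 iE; have Tle := ge_inf (proj2 iE) Et.
  have [_ rt] := Et; have /(le_lt_trans rt) : `|gam t - p| < r.
    by apply: eP; rewrite ger0_norm ?subr_ge0// ltrBlDl.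
  by rewrite ltxx.
have T_gt0 : 0 < T.
  rewrite lt_neqAle T0 andbT; apply/eqP => T0E; move: late; rewrite -T0E leNgt.
  by rewrite (le_lt_trans _ g0)// lerDl mulr_ge0// (le_trans t10).
have MT : M * T <= M * b by rewrite ler_wpM2l// (le_trans Tt1).
have sub t : 0 <= t <= T -> 0 <= t <= b.
  by move=> /andP[-> tT]; rewrite (le_trans tT)// (le_trans Tt1).
have comp (l : R * R * R -> R) : (forall q, is_diff q l l) -> (forall q, `|l q| <= `|q|) ->
    (forall q q', l (q - q') = l q - l q') -> `|l (gam T - p)| < r.
  move=> dl lb lB; have [t /andP[t0 tT] tE] := MVT_open T_gt0 (fun t tT =>
    is_derive_curve (dg t (sub t tT)) (@ex_diff _ _ _ _ _ _ _ (dl (gam t)))).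
  have t0b : 0 <= t <= b by apply: sub; rewrite (ltW t0) (ltW tT).
  have bt := bg t t0b (early t (ltW t0) tT).
  have -> : l (gam T - p) = (l (gam T) - l (gam 0)) + l (gam 0 - p) by rewrite !lB subrKA.
  apply: le_lt_trans g0; rewrite addrC; apply: le_trans (ler_normD _ _) _; apply: lerD => //.
  rewrite tE subr0 normrM (ger0_norm T0); apply: le_trans MT.
  rewrite ler_wpM2r// (@deriveE _ _ _ l); last by have [] := dl (gam t).
  by have [_ ->] := dl (gam t); exact: le_trans bt.
have h1 : `|(gam T - p).1.1| < r.
  apply: (comp (fun q => q.1.1)) => //; by move=> q; have [] := norm3_le q.
have h2 : `|(gam T - p).1.2| < r.
  apply: (comp (fun q => q.1.2)) => //; by move=> q; have [] := norm3_le q.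
have h3 : `|(gam T - p).2| < r.
  by apply: (comp (fun q => q.2)) => // q; have [] := norm3_le q.
move: late; rewrite leNgt [gam T - p]surjective_pairing [(_ - _).1]surjective_pairing.
by rewrite !normr_pair_lt h1 h2 h3.
Qed.

Lemma vector_at_bounded Q p0 : smooth_op p0.1 Q ->
  exists2 M : R, 0 <= M & \forall p \near p0, `|vector_at Q p| <= M.
Proof.
move=> [st sx s1 s0].
have su : smooth_near (op_u Q) p0.
  apply: smoothD; last exact: smooth_base.
  by apply: smoothM; [exact: smooth_base|exact: smooth_u].
have h1 := smooth_bounded (smooth_time st); have h2 := smooth_bounded (smooth_base sx).
have h3 := smooth_bounded su.
have [M [m1 m2 m3 m4]] := exists_max4 (`|tau Q p0.1.1| + 1) (`|xi Q p0.1| + 1) (`|op_u Q p0| + 1) 0.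
exists M => //; apply: filterS (nbhsI h1 (nbhsI h2 h3)) => p [] k1 [] k2 k3.
rewrite /vector_at !normr_pair_le (le_trans k1 m1) (le_trans k2 m2) (le_trans k3 m3).
by [].
Qed.

(** Plays the part of continuity of the flow at [(0, p0)]: the speed of the curves is bounded near
    [p0], so short curves starting nearby remain in the given neighbourhood. *)
Lemma local_flow_confined Q p0 Psi (P : set (R * R * R)) : smooth_op p0.1 Q ->
  local_flow Q p0 Psi -> nbhs p0 P -> \forall z \near ((0 : R), p0), P (Psi z.1 z.2).
Proof.
move=> sQ [F0 dF] nP; have [M M0 bM] := vector_at_bounded sQ.
have [r r0 rP] := iffLR (nbhs_normlP _ _) (nbhsI nP bM).
have [d1 d10 dP1] := iffLR (nbhs_normlP _ _) F0.
have [d2 d20 dP2] := iffLR (nbhs_normlP _ _) dF.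
pose d := Num.min (Num.min d1 d2) (Num.min (r / 2) (r / (2 * (M + 1)))).
have M1 : 0 < M + 1 by rewrite ltr_wpDl.
have d0 : 0 < d by rewrite !lt_min d10 d20 !divr_gt0// mulr_gt0.
apply: (iffRL (nbhs_normlP _ _)); exists d => // -[s p].
rewrite -[_ - _]/(s - 0, p - p0) subr0 normr_pair_lt => /andP[+ +] /=.
rewrite !lt_min => /andP[/andP[_ s2] /andP[_ s3]] /andP[/andP[p1 p2] /andP[p3 _]].
have [h0 _] : P p0 /\ True by split => //; exact: nbhs_singleton nP.
have start := dP1 p p1.
have bs : `|p - p0| + M * `|s| < r.
  have : `|s| * (2 * (M + 1)) < r by rewrite -ltr_pdivlMr// mulr_gt0.
  have := normr_ge0 s; move: p3 M0; move: `|s| `|p - p0| => a b; clear; nra.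
have dfl t : `|t| <= `|s| -> is_derive t 1 (fun s => Psi s p) (vector_at Q (Psi t p)).
  move=> ts; apply: (dP2 (t, p)); rewrite -[_ - _]/(t - 0, p - p0) subr0 normr_pair_lt p2 andbT.
  exact: le_lt_trans s2.
have bnd q : `|q - p0| < r -> `|vector_at Q q| <= M by move=> /rP[].
suff : `|Psi s p - p0| < r by move=> /rP[].
have [s0|s0] := leP 0 s.
  apply: (@curve_confined (fun s => Psi s p) (fun t => vector_at Q (Psi t p)) p0 r M s) => //.
  - by move=> t /andP[t0 ts]; apply: dfl; rewrite !ger0_norm.
  - by move=> t _; exact: bnd.
  - by rewrite start -(ger0_norm s0).
  - by rewrite s0 lexx.
have ns0 : 0 <= - s by rewrite oppr_ge0 ltW.
(* For negative [s] the curve is run backwards, with velocity [- vector_at Q], over the interval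
   [[0, - s]]. *)
rewrite -[s]opprK; apply: (@curve_confined (fun s => Psi (- s) p)
  (fun t => - vector_at Q (Psi (- t) p)) p0 r M (- s)) => //.
- move=> t /andP[t0 ts]; have dP : is_derive (- t) 1 (fun s => Psi s p) (vector_at Q (Psi (- t) p)).
    by apply: dfl; rewrite normrN ger0_norm// ltr0_norm.
  have <- : (fun s : R => Psi (0 + -1 * s) p) = fun s => Psi (- s) p.
    by apply/funext => s'; rewrite add0r mulN1r.
  rewrite -[- vector_at _ _]scaleN1r; apply: (@is_derive_affine_curve _ (fun s => Psi s p)).
  by rewrite add0r mulN1r.
- by move=> t _ /bnd; rewrite normrN.
- by rewrite oppr0 start -(ltr0_norm s0).
- by rewrite ns0 lexx.
Qed.

End FlowProperties.

Lemma lin3_bound (R : realFieldType) (x y z a b c N M : R) :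
  `|a| <= M -> `|b| <= M -> `|c| <= M -> `|x| <= N -> `|y| <= N -> `|z| <= N ->
  `|x * a + y * b + z * c| <= (M + M + M) * N.
Proof.
have B u v : `|u| <= M -> `|v| <= N -> `|v * u| <= M * N.
  by move=> uM vN; rewrite normrM mulrC; exact: ler_pM.
move=> aM bM cM xN yN zN; rewrite !mulrDl; apply: le_trans (ler_normD _ _) _.
by apply: lerD; [apply: le_trans (ler_normD _ _) _; apply: lerD|]; exact: B.
Qed.

Section CurveUniqueness.
Context {R : realType}.
Implicit Types (Q : operator R) (p : R * R * R) (s t : R).

Lemma smooth_lipschitz (f : R * R * R -> R) p0 : smooth_near f p0 ->
  exists r M : R, [/\ 0 < r, 0 <= M & forall p p', `|p - p0| < r -> `|p' - p0| < r ->
    `|f p - f p'| <= M * `|p - p'|].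
Proof.
move=> sf; have [M M1 bM] := smooth_jet_bounded sf.
have [r r0 rP] := iffLR (nbhs_normlP _ _) (nbhsI bM (smooth_nearW sf)).
exists r, (M + M + M); split => //; first by move: M1; lra.
move=> p p' pr p'r.
have seg (t : R) : 0 <= t <= 1 -> `|p' + t *: (p - p') - p0| < r.
  move=> /andP[t0 t1].
  have -> : p' + t *: (p - p') - p0 = t *: (p - p0) + (1 - t) *: (p' - p0).
    rewrite scalerBl scale1r addrCA -scalerBr addrAC; congr (_ + _ *: _).
    by rewrite opprB addrA subrK.
  apply: le_lt_trans (ler_normD _ _) _; rewrite !normrZ (ger0_norm t0) ger0_norm ?subr_ge0//.
  by apply: (@le_lt_trans _ _ (`|t * `|p - p0| + (1 - t) * `|p' - p0| |));
    [exact: ler_norm|apply: convex_norm_lt; rewrite ?normr_id// t0].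
have [t t01] := MVT_line (fun t t01 => smooth_differentiable (proj2 (rP _ (seg t t01)))).
rewrite subrKC => ->; have [[_ b1 b2 b3] s1] := rP _ (seg t t01).
rewrite (derive3E _ (smooth_differentiable s1)); have [n1 n2 n3] := norm3_le (p - p').
move: b1 b2 b3 n1 n2 n3; rewrite /lin3.
move: (p - p').1.1 (p - p').1.2 (p - p').2 (dt f _) (dx f _) (du f _) `|p - p'|.
by move=> x y z a b c N; exact: lin3_bound.
Qed.

(** Uniqueness goes through [t], then [x], then [u], each equation involving only coordinates
    already identified. The first conclusion compares curves of different heights above the same
    base point; the factor [c] allows for rescaled time. *)
Lemma integral_curve_unique Q p0 : smooth_op p0.1 Q -> exists2 r : R, 0 < r &
  forall (c : R) (g1 g2 : R -> R * R * R),
    (forall t, 0 <= t <= 1 -> [/\ is_derive t 1 g1 (c *: vector_at Q (g1 t)),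
       is_derive t 1 g2 (c *: vector_at Q (g2 t)), `|g1 t - p0| < r & `|g2 t - p0| < r]) ->
  ((g1 0).1 = (g2 0).1 -> (g1 1).1 = (g2 1).1) /\ (g1 0 = g2 0 -> g1 1 = g2 1).
Proof.
case: p0 => -[t0 x0] u0 [/= st sx s1 s0].
have su : smooth_near (op_u Q) (t0, x0, u0).
  by apply: smoothD; [apply: smoothM; [exact: smooth_base|exact: smooth_u]|exact: smooth_base].
have [r1 [M1 [r10 M10 L1]]] := smooth_lipschitz (smooth_time st (z := (t0, x0, u0))).
have [r2 [M2 [r20 M20 L2]]] := smooth_lipschitz (smooth_base sx (z := (t0, x0, u0))).
have [r3 [M3 [r30 M30 L3]]] := smooth_lipschitz su.
pose r := Num.min r1 (Num.min r2 r3); exists r; first by rewrite !lt_min r10 r20.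
have rr1 (x : R) : x < r -> x < r1 by rewrite lt_min => /andP[].
have rr2 (x : R) : x < r -> x < r2 by rewrite !lt_min => /andP[_ /andP[]].
have rr3 (x : R) : x < r -> x < r3 by rewrite !lt_min => /andP[_ /andP[]].
move=> c g1 g2 H.
have sub (b t : R) : b <= 1 -> 0 <= t <= b -> 0 <= t <= 1.
  by move=> b1 /andP[-> tb]; exact: le_trans b1.
have D (l : R * R * R -> R) : (forall q, is_diff q l l) ->
    (forall (a : R) q, l (a *: q) = a * l q) -> forall t, 0 <= t <= 1 ->
    is_derive t 1 (fun t => l (g1 t)) (c * l (vector_at Q (g1 t))) /\
    is_derive t 1 (fun t => l (g2 t)) (c * l (vector_at Q (g2 t))).
  move=> dl lZ t /H[d1 d2 _ _]; have [e1 v1] := dl (g1 t); have [e2 v2] := dl (g2 t).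
  have := is_derive_curve d1 e1; rewrite (deriveE _ e1) v1 lZ.
  by have := is_derive_curve d2 e2; rewrite (deriveE _ e2) v2 lZ.
have Dt := D (fun q => q.1.1) (fun q => ltac:(exact: is_diff_comp)) (fun a q => erefl).
have Dx := D (fun q => q.1.2) (fun q => ltac:(exact: is_diff_comp)) (fun a q => erefl).
have Du := D (fun q => q.2) (fun q => ltac:(exact: is_diff_snd)) (fun a q => erefl).
have scale (f y y' M : R) : `|f| <= M * `|y - y'| -> `|c * f| <= `|c| * M * `|y - y'|.
  by move=> fM; rewrite normrM -mulrA ler_wpM2l.
have cM (M : R) : 0 <= M -> 0 <= `|c| * M by move=> M0; rewrite mulr_ge0.
have N1 (a a' b y : R) : `|(a, b, y) - (a', b, y)| = `|a - a'|.
  rewrite -[_ - _]/(a - a', b - b, y - y) !normr_pairE !subrr normr0.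
  by rewrite (max_l (normr_ge0 _)) (max_l (normr_ge0 _)).
have N2 (a b b' y : R) : `|(a, b, y) - (a, b', y)| = `|b - b'|.
  rewrite -[_ - _]/(a - a, b - b', y - y) !normr_pairE !subrr normr0.
  by rewrite (max_r (normr_ge0 _)) (max_l (normr_ge0 _)).
have N3 (a b y y' : R) : `|(a, b, y) - (a, b, y')| = `|y - y'|.
  rewrite -[_ - _]/(a - a, b - b, y - y') !normr_pairE !subrr normr0.
  by rewrite (max_l (lexx _)) (max_r (normr_ge0 _)).
have B t : 0 <= t <= 1 -> [/\ `|(g1 t).1.1 - t0| < r, `|(g1 t).1.2 - x0| < r & `|(g1 t).2 - u0| < r]
    /\ [/\ `|(g2 t).1.1 - t0| < r, `|(g2 t).1.2 - x0| < r & `|(g2 t).2 - u0| < r].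
  by move=> /H[_ _ k1 k2]; split; apply/ball3E.
have tE : (g1 0).1 = (g2 0).1 -> forall t, 0 <= t <= 1 -> (g1 t).1.1 = (g2 t).1.1.
  move=> g0 b /andP[b0 b1]; have := @ode_unique R (fun _ y => c * tau Q y)
    (fun t => (g1 t).1.1) (fun t => (g2 t).1.1) (`|c| * M1) b b0 (cM _ M10)
    (fun t tb => proj1 (Dt t (sub b t b1 tb))) (fun t tb => proj2 (Dt t (sub b t b1 tb))).
  apply; last by rewrite g0.
  move=> t /(sub b t b1)/B[[k1 k2 k3] [m1 m2 m3]]; rewrite -mulrBr; apply: scale.
  rewrite -(N1 _ _ (g1 t).1.2 (g1 t).2).
  by apply: (L1 ((g1 t).1.1, _, _) ((g2 t).1.1, _, _)); apply: rr1; apply/ball3E.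
have qE : (g1 0).1 = (g2 0).1 -> forall t, 0 <= t <= 1 -> (g1 t).1 = (g2 t).1.
  move=> g0 b /andP[b0 b1]; rewrite [LHS]surjective_pairing [RHS]surjective_pairing.
  rewrite (tE g0 b) ?b0//; congr pair.
  have := @ode_unique R (fun t y => c * xi Q ((g2 t).1.1, y))
    (fun t => (g1 t).1.2) (fun t => (g2 t).1.2) (`|c| * M2) b b0 (cM _ M20).
  apply; last by rewrite g0.
  - move=> t /(sub b t b1) tb; rewrite -(tE g0 t tb) -surjective_pairing.
    exact: (proj1 (Dx t tb)).
  - move=> t /(sub b t b1) tb; rewrite -surjective_pairing; exact: (proj2 (Dx t tb)).
  - move=> t /(sub b t b1)/B[[k1 k2 k3] [m1 m2 m3]]; rewrite -mulrBr; apply: scale.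
    rewrite -(N2 (g2 t).1.1 _ _ (g1 t).2).
    by apply: (L2 (_, (g1 t).1.2, _) (_, (g2 t).1.2, _)); apply: rr2; apply/ball3E.
have one : 0 <= (1 : R) <= 1 by rewrite ler01 lexx.
split=> g0; first exact: qE.
have q0 : (g1 0).1 = (g2 0).1 by rewrite g0.
rewrite [LHS]surjective_pairing [RHS]surjective_pairing (qE q0 1 one); congr pair.
have := @ode_unique R (fun t y => c * op_u Q ((g2 t).1, y))
  (fun t => (g1 t).2) (fun t => (g2 t).2) (`|c| * M3) 1 ler01 (cM _ M30).
apply; last by rewrite g0.
- move=> t tb; rewrite -(qE q0 t tb) -surjective_pairing; exact: (proj1 (Du t tb)).
- move=> t tb; rewrite -surjective_pairing; exact: (proj2 (Du t tb)).
- move=> t /B[[k1 k2 k3] [m1 m2 m3]]; rewrite -mulrBr; apply: scale.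
  rewrite -(N3 (g2 t).1.1 (g2 t).1.2).
  by apply: (L3 (_, (g1 t).2) (_, (g2 t).2)); apply: rr3; apply/ball3E.
Qed.

End CurveUniqueness.

(** * Graphs moved by a flow *)

Section Orbits.
Context {R : realType}.
Implicit Types (Q : operator R) (p : R * R * R) (q : R * R) (s t : R) (f : R * R * R -> R).

Lemma local_flow_ball Q p0 Psi (r : R) : smooth_op p0.1 Q -> local_flow Q p0 Psi -> 0 < r ->
  exists2 d : R, 0 < d & forall s p, `|s| < d -> `|p - p0| < d ->
    [/\ Psi 0 p = p, is_derive s 1 (fun s => Psi s p) (vector_at Q (Psi s p)) &
        `|Psi s p - p0| < r].
Proof.
move=> sQ fP r0; have nr : \forall p \near p0, `|p - p0| < r.
  by apply: (iffRL (nbhs_normlP _ _)); exists r.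
have [d1 d10 P1] := iffLR (nbhs_normlP _ _) (nbhsI (proj2 fP) (local_flow_confined sQ fP nr)).
have [d2 d20 P2] := iffLR (nbhs_normlP _ _) (proj1 fP).
exists (Num.min d1 d2); first by rewrite lt_min d10.
move=> s p; rewrite !lt_min => /andP[s1 s2] /andP[p1 p2].
have [] := P1 (s, p) _; last by move=> k1 k2; split; [exact: P2|exact: k1|exact: k2].
by rewrite -[_ - _]/(s - 0, p - p0) subr0 normr_pair_lt s1 p1.
Qed.

Lemma flow_curve_scaled Q p Psi a c t :
  is_derive (a + c * t) 1 (fun s => Psi s p) (vector_at Q (Psi (a + c * t) p)) ->
  is_derive t 1 (fun t => Psi (a + c * t) p) (c *: vector_at Q (Psi (a + c * t) p)).
Proof. exact: (@is_derive_affine_curve _ _ (fun s => Psi s p)). Qed.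

Lemma scaled_time_lt (s t d : R) : 0 <= t <= 1 -> `|s| < d -> `|0 + s * t| < d /\ `|- s + s * t| < d.
Proof.
move=> /andP[t0 t1] sd; rewrite add0r (_ : - s + s * t = - s * (1 - t)); last by ring.
have t'0 : 0 <= 1 - t by rewrite subr_ge0.
rewrite !normrM normrN (ger0_norm t0) (ger0_norm t'0).
have := normr_ge0 s; move: sd t0 t1; move: `|s| => a; clear; nra.
Qed.

(** The starting point is found by flowing [(q', u0)] back for time [s] and replacing the height by
    that of the graph of [v]. Flowing forward again ends above [q'], because the base coordinates
    move independently of [u]. *)
Lemma flow_reaches Q q0 u0 Psi (v : R * R -> R) (P : set (R * R)) : smooth_op q0 Q ->
  local_flow Q (q0, u0) Psi -> {for q0, continuous v} -> v q0 = u0 -> nbhs q0 P ->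
  \forall z \near (q0, (0 : R)), exists2 q, P q & (Psi z.2 (q, v q)).1 = z.1.
Proof.
move=> sQ fP cv v0 nP; have [r r0 uniq] := @integral_curve_unique R Q (q0, u0) sQ.
have [d d0 dP] := @local_flow_ball Q (q0, u0) Psi r sQ fP r0.
have n1 : \forall q \near q0, P q /\ `|(q, v q) - (q0, u0)| < d.
  have nd : \forall q \near q0, `|q - q0| < d.
    by apply: (iffRL (nbhs_normlP _ _)); exists d.
  have nv : \forall q \near q0, `|v q - v q0| < d.
    exact: (cvgr_distC_lt _ _ cv _ d0).
  apply: filterS (nbhsI nP (nbhsI nd nv)) => q [Pq [/= k1 k2]]; split=> //.
  by rewrite -[_ - _]/(q - q0, v q - u0) normr_pair_lt -v0 k1.
have n2 := @local_flow_confined R Q (q0, u0) Psi _ sQ fP (near_fst (z := (q0, u0)) n1).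
have [d' d'0 d'P] := iffLR (nbhs_normlP _ _) n2.
apply: (iffRL (nbhs_normlP _ _)); exists (Num.min d d'); first by rewrite lt_min d0.
move=> [q' s]; rewrite -[_ - _]/(q' - q0, s - 0) subr0 normr_pair_lt !lt_min.
move=> /andP[/andP[q1 q2] /andP[s1 s2]] /=.
have qd : `|(q', u0) - (q0, u0)| < d.
  by rewrite -[_ - _]/(q' - q0, u0 - u0) subrr normr_pair_lt q1 normr0.
have [] : P (Psi (- s) (q', u0)).1 /\ `|((Psi (- s) (q', u0)).1, v (Psi (- s) (q', u0)).1) - (q0, u0)| < d.
  apply: (d'P (- s, (q', u0))).
  rewrite -[_ - _]/(- s - 0, (q' - q0, u0 - u0)) subr0 subrr normr_pair_lt normrN s2.
  by rewrite normr_pair_lt q2 normr0.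
set q := (Psi (- s) (q', u0)).1 => Pq qv; exists q => //.
pose g1 t := Psi (0 + s * t) (q, v q); pose g2 t := Psi (- s + s * t) (q', u0).
have [|+ _] := uniq s g1 g2.
  move=> t t01; have [t1 t2] := scaled_time_lt t01 s1.
  have [_ D1 B1] := dP _ _ t1 qv; have [_ D2 B2] := dP _ _ t2 qd.
  by split; [exact: flow_curve_scaled|exact: flow_curve_scaled|exact: B1|exact: B2].
have s0 : `|0 : R| < d by rewrite normr0.
have [E1 _ _] := dP _ _ s0 qv; have [E2 _ _] := dP _ _ s0 qd.
by rewrite /g1 /g2 !mulr0 !addr0 !mulr1 add0r addNr E1 E2; apply.
Qed.

Lemma is_derive_base_curve (gam : R -> R * R * R) (th : R -> R) (w : R * R * R) (b t : R) :
  is_derive t 1 gam w -> is_derive t 1 th b ->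
  is_derive t 1 (fun t => ((gam t).1, th t)) (w.1, b) /\
  is_derive t 1 (fun t => (gam t).2) w.2.
Proof.
move=> dg dth; have D (l : R * R * R -> R) : (forall p, is_diff p l l) ->
    is_derive t 1 (fun t => l (gam t)) (l w).
  move=> dl; have [e1 v1] := dl (gam t).
  by have := is_derive_curve dg e1; rewrite (deriveE _ e1) v1.
split; last by apply: (D (fun p => p.2)) => p; exact: is_diff_snd.
have -> : (fun t => ((gam t).1, th t)) = (fun t => ((gam t).1.1, (gam t).1.2, th t)).
  by apply/funext => s; case: (gam s) => -[].
have -> : (w.1, b) = (w.1.1, w.1.2, b) by case: (w) => -[].
apply: is_derive_pair => //; apply: is_derive_pair.
  by apply: (D (fun p => p.1.1)) => p; exact: is_diff_comp.
by apply: (D (fun p => p.1.2)) => p; exact: is_diff_comp.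
Qed.

Lemma transport_solved (F : realFieldType) (a b c w : F) :
  a + b + 1 * c = w -> w - a - b = c.
Proof. by move=> <-; ring. Qed.

Lemma transport_scaled (F : realFieldType) (s a b c d x y w : F) : w - a * x - b * y = c * d ->
  s * a * x + s * b * y + s * c * d = s * w.
Proof. by move=> E; rewrite -!mulrA -!mulrDr -E; congr (_ * _); ring. Qed.

(** Differentiating [f ((Psi s p).1, s) = (Psi s p).2] in [s] gives the identity at the points
    [((Psi s p).1, s)] with [p] on the graph of [v], and by [flow_reaches] these cover a
    neighbourhood of [(q0, 0)]. *)
Lemma orbit_characteristic Q q0 u0 Psi (v : R * R -> R) f : smooth_op q0 Q ->
  local_flow Q (q0, u0) Psi -> {for q0, continuous v} -> v q0 = u0 ->
  smooth_near f (q0, 0) ->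
  (\forall z \near ((0 : R), q0), let p := Psi z.1 (z.2, v z.2) in f (p.1, z.1) = p.2) ->
  \forall z \near (q0, (0 : R)), characteristic Q f z = du f z.
Proof.
move=> sQ fP cv v0 sf nf; have [r r0 rP] := iffLR (nbhs_normlP _ _) (smooth_nearW sf).
have [d d0 dP] := @local_flow_ball Q (q0, u0) Psi r sQ fP r0.
have [e e0 eP] := iffLR (nbhs_normlP _ _) nf.
pose m := Num.min (Num.min d r) e; have m0 : 0 < m by rewrite !lt_min d0 r0.
have nq : \forall q \near q0, `|q - q0| < m.
  by apply: (iffRL (nbhs_normlP _ _)); exists m.
have nv : \forall q \near q0, `|v q - v q0| < d by exact: (cvgr_distC_lt _ _ cv _ d0).
have ns : \forall z \near (q0, (0 : R)), `|z.2| < m.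
  apply: (iffRL (nbhs_normlP _ _)); exists m => // -[q s].
  by rewrite -[_ - _]/(q - q0, s - 0) subr0 normr_pair_lt => /andP[].
apply: filterS (nbhsI ns (flow_reaches sQ fP cv v0 (nbhsI nq nv))).
move=> [q' s] [/= + [q [/=]]]; rewrite /m !lt_min => /andP[/andP[s1 s2] s3].
move=> /andP[/andP[q1 q2] q3] vq <-.
have pd : `|(q, v q) - (q0, u0)| < d.
  by rewrite -[_ - _]/(q - q0, v q - u0) normr_pair_lt -v0 q1.
have [_ ds B] := dP s (q, v q) s1 pd.
have fE t : `|t| < e -> f ((Psi t (q, v q)).1, t) = (Psi t (q, v q)).2.
  move=> te; apply: (eP (t, q)).
  by rewrite -[_ - _]/(t - 0, q - q0) subr0 normr_pair_lt te.
have sfz : smooth_near f ((Psi s (q, v q)).1, s).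
  apply: rP; rewrite -[_ - _]/((Psi s (q, v q)).1 - q0, s - 0) subr0 normr_pair_lt s2 andbT.
  by apply: le_lt_trans B; apply: (ler_norm_fst (Psi s (q, v q) - (q0, u0))).
have [dg d2] := is_derive_base_curve ds (is_derive_id s 1).
have [_ v1] := is_derive_curve dg (smooth_differentiable sfz).
have nE : \forall t \near s, (f \o (fun t => ((Psi t (q, v q)).1, t))) t = (Psi t (q, v q)).2.
  have : \forall t \near s, `|t| < e by exact: (cvgr_lt _ (@norm_continuous _ R^o s) _ s3).
  by apply: filterS => t /fE.
have E := etrans (esym v1) (etrans (near_eq_derive _ nE) (@derive_val _ _ _ _ _ _ _ d2)).
have E' := etrans (esym (derive3E _ (smooth_differentiable sfz))) E.
have opE : op_u Q ((Psi s (q, v q)).1, f ((Psi s (q, v q)).1, s)) = op_u Q (Psi s (q, v q)).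
  by rewrite (fE s s3) -surjective_pairing.
rewrite /characteristic opE; exact: (transport_solved E').
Qed.

(** Above a base trajectory, the height [f (., theta s)] has velocity
    [tau f_t + xi f_x + c f_kappa], which the hypothesis on the characteristic identifies with
    [op_u]. So it traces an integral curve of [Q], and uniqueness makes it the flow. *)
Lemma group_orbit_family Q q0 k0 f (c theta : R -> R) : smooth_op q0 Q ->
  smooth_near f (q0, k0) -> theta 0 = k0 -> {for 0, continuous theta} ->
  (\forall z \near (q0, k0), characteristic Q f z = c z.2 * du f z) ->
  (\forall s \near (0 : R), is_derive (s : R) 1 theta (c (theta s))) ->
  group_orbit Q q0 (fun q => f (q, k0)) (fun z => f (z.1, theta z.2)).
Proof.
move=> sQ sf th0 cth nW nth; set u0 := f (q0, k0).
have cv : {for q0, continuous (fun q => f (q, k0))}.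
  exact: smooth_continuous (smooth_slicel sf).
have cf := smooth_continuous sf.
have [Psi fP] := @local_flow_exists R Q (q0, u0) sQ; exists Psi; split => //.
have [r r0 uniq] := @integral_curve_unique R Q (q0, u0) sQ.
have nf : \forall z \near (q0, k0), `|f z - u0| < r by exact: (cvgr_distC_lt _ _ cf _ r0).
have [e e0 eP] := iffLR (nbhs_normlP _ _) (nbhsI nW (nbhsI nf (smooth_nearW sf))).
have nt : \forall s \near (0 : R), `|theta s - theta 0| < e.
  exact: (cvgr_distC_lt _ _ cth _ e0).
have [m m0 mP'] := iffLR (nbhs_normlP _ _) (nbhsI nt nth).
have mP t : `|t| < m -> `|theta t - theta 0| < e /\ is_derive t 1 theta (c (theta t)).
  by move=> tm; apply: mP'; rewrite subr0.
have re0 : 0 < Num.min r e by rewrite lt_min r0.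
have [d d0 dP] := @local_flow_ball Q (q0, u0) Psi _ sQ fP re0.
have nd : \forall q \near q0, `|q - q0| < d by apply: (iffRL (nbhs_normlP _ _)); exists d.
have nv : \forall q \near q0, `|f (q, k0) - u0| < d by exact: (cvgr_distC_lt _ _ cv _ d0).
have [d' d'0 d'P] := iffLR (nbhs_normlP _ _) (nbhsI nd nv).
apply: (iffRL (nbhs_normlP _ _)); exists (Num.min d' (Num.min d m)).
  by rewrite !lt_min d'0 d0.
move=> [s q]; rewrite -[_ - _]/(s - 0, q - q0) subr0 normr_pair_lt !lt_min.
move=> /andP[/andP[_ /andP[sd sm]] /andP[qd' _]] /=; have [q1 q2] := d'P q qd'.
set p := (q, f (q, k0)).
have pd : `|p - (q0, u0)| < d.
  by rewrite -[_ - _]/(q - q0, f (q, k0) - u0) normr_pair_lt q1.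
(* Time is rescaled so that [t] runs through [[0, 1]] for either sign of [s]. *)
pose g1 t := Psi (0 + s * t) p; pose z t := ((g1 t).1, theta (0 + s * t)).
pose g2 t := ((g1 t).1, f (z t)).
have D1 t : 0 <= t <= 1 -> is_derive t 1 g1 (s *: vector_at Q (g1 t)).
  move=> t01; have [t1 _] := scaled_time_lt t01 sd.
  by have [_ k _] := dP _ _ t1 pd; exact: flow_curve_scaled.
have B1 t : 0 <= t <= 1 -> `|g1 t - (q0, u0)| < Num.min r e.
  by move=> t01; have [t1 _] := scaled_time_lt t01 sd; have [_ _] := dP _ _ t1 pd.
have B2 t : 0 <= t <= 1 -> `|z t - (q0, k0)| < e.
  move=> t01; have [t1 _] := scaled_time_lt t01 sm; have [+ _] := mP _ t1.
  move=> th; rewrite -[z t - _]/((g1 t).1 - q0, theta (0 + s * t) - k0) normr_pair_lt.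
  rewrite -th0 th andbT.
  have := B1 t t01; rewrite lt_min => /andP[_]; apply: le_lt_trans.
  exact: (ler_norm_fst (g1 t - (q0, u0))).
have [|_] := uniq s g1 g2; last first.
  have s0 : `|0 : R| < d by rewrite normr0.
  have [E1 _ _] := dP _ _ s0 pd.
  rewrite /g2 /z /g1 !mulr0 !mulr1 !addr0 !add0r E1 th0 => /(_ erefl) E.
  by rewrite [in RHS]E.
move=> t t01; have [t1 _] := scaled_time_lt t01 sm.
have [_ dth] := mP _ t1; have [W [bf sfz]] := eP _ (B2 t t01).
have := B1 t t01; rewrite lt_min => /andP[b1 _].
split; [exact: D1| |exact: b1|]; last first.
  rewrite -[_ - _]/((g1 t).1 - q0, f (z t) - u0) normr_pair_lt bf andbT.
  by apply: le_lt_trans b1; exact: (ler_norm_fst (g1 t - (q0, u0))).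
have dth' := @is_derive_affine_curve _ _ theta _ 0 s t dth.
have [dz _] := is_derive_base_curve (D1 t t01) dth'.
have [] := is_derive_base_curve (D1 t t01) (is_derive_curve dz (smooth_differentiable sfz)).
move=> D2 _; move: D2; rewrite (derive3E _ (smooth_differentiable sfz)).
by rewrite [lin3 _ _ _ _](transport_scaled s W).
Qed.

End Orbits.

(** * From invariant solutions of the determining equation to families *)

Lemma line_field_lipschitz (F : realFieldType) (a b x x' y y' M N n d : F) :
  `|a| <= n -> `|b| <= n -> `|x - x'| <= M * d -> `|y - y'| <= N * d ->
  `|a * x + b * y - (a * x' + b * y')| <= n * (M + N) * d.
Proof.
move=> an bn xM yN; have -> : a * x + b * y - (a * x' + b * y') = a * (x - x') + b * (y - y') by ring.
apply: le_trans (ler_normD _ _) _; rewrite !normrM -mulrA mulrDl mulrDr.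
by apply: lerD; exact: ler_pM.
Qed.

Section Leaves.
Context {R : realType}.
Implicit Types (L : evolution_eq R) (q : R * R) (v : R * R -> R).
Implicit Types (f eta H : R * R * R -> R).

Lemma derive2E v q (w : R * R) : differentiable v q -> 'D_w v q = w.1 * pt v q + w.2 * px v q.
Proof.
move=> dv; rewrite [w in LHS](_ : w = w.1 *: ((1, 0) : R * R) + w.2 *: ((0, 1) : R * R)).
  by rewrite deriveDv// !deriveZv.
case: w => a b; rewrite -[RHS]/(a * 1 + b * 0, a * 0 + b * 1).
by rewrite !mulr1 !mulr0 addr0 add0r.
Qed.

Definition leaf_at H eta v q :=
  [/\ differentiable v q, pt v q = H (q, v q) & px v q = eta (q, v q)].

(** Along a segment from [q0] both functions satisfy the same scalar equation. The radius [r]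
    depends on [H] and [eta] only, while [e] may be shrunk for the particular [v1] and [v2]. *)
Lemma leaf_unique H eta q0 u0 : smooth_near H (q0, u0) -> smooth_near eta (q0, u0) ->
  exists2 r : R, 0 < r & forall v1 v2 (e : R), e <= r -> v1 q0 = v2 q0 ->
    (forall q, `|q - q0| < e -> leaf_at H eta v1 q /\ leaf_at H eta v2 q) ->
    (forall q, `|q - q0| < e -> `|v1 q - u0| < r /\ `|v2 q - u0| < r) ->
    forall q, `|q - q0| < e -> v1 q = v2 q.
Proof.
move=> sH se; have [r1 [M1 [r10 M10 L1]]] := smooth_lipschitz sH.
have [r2 [M2 [r20 M20 L2]]] := smooth_lipschitz se.
exists (Num.min r1 r2); first by rewrite lt_min r10.
move=> v1 v2 e er v0 lv vr q qe; rewrite le_min in er; have /andP[er1 er2] := er.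
pose h := q - q0; pose c (s : R) := q0 + s *: h.
have cin (s : R) : 0 <= s <= 1 -> `|c s - q0| < e.
  move=> /andP[s0 s1]; rewrite addrAC subrr add0r normrZ ger0_norm//.
  by apply: le_lt_trans qe; rewrite ler_piMl.
pose F (s y : R) := h.1 * H (c s, y) + h.2 * eta (c s, y).
have D v (s : R) : leaf_at H eta v (c s) -> is_derive s 1 (v \o c) (F s (v (c s))).
  move=> [dv vt vx]; rewrite /F -vt -vx -(derive2E h dv).
  by apply: is_derive_curve => //; exact: is_derive_line.
have nh : 0 <= `|h| * (M1 + M2) by rewrite mulr_ge0// addr_ge0.
have := @ode_unique R F (v1 \o c) (v2 \o c) (`|h| * (M1 + M2)) 1 ler01 nh
  (fun s s01 => D v1 s (proj1 (lv _ (cin s s01)))) (fun s s01 => D v2 s (proj2 (lv _ (cin s s01)))).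
rewrite /= /c !scale0r !scale1r !addr0 /h subrKC; apply => //.
move=> s s01; have ce := cin s s01; have [k1 k2] := vr _ ce; move: k1 k2.
rewrite !lt_min => /andP[a1 a2] /andP[b1 b2].
have E (w : R * R) (y y' : R) : `|(w, y) - (w, y')| = `|y - y'|.
  by rewrite -[_ - _]/(w - w, y - y') subrr normr_pairE normr0 (max_r (normr_ge0 _)).
have B (x : R) (r : R) : `|x - u0| < r -> e <= r -> `|(c s, x) - (q0, u0)| < r.
  move=> xr er'; rewrite -[_ - _]/(c s - q0, x - u0) normr_pair_lt xr andbT.
  exact: lt_le_trans er'.
rewrite -[`|v1 _ - v2 _|](E (c s)); apply: line_field_lipschitz.
- exact: ler_norm_fst.
- exact: ler_norm_snd.
- by apply: L1; exact: B.
- by apply: L2; exact: B.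
Qed.

Lemma leaf_at_slice H eta f (k : R) q : smooth_near f (q, k) -> dt f (q, k) = H (q, f (q, k)) ->
  dx f (q, k) = eta (q, f (q, k)) -> leaf_at H eta (fun q => f (q, k)) q.
Proof.
move=> sf ft fx; split; [exact: smooth_differentiable (smooth_slicel sf)|..].
  by rewrite pt_slice.
by rewrite px_slice.
Qed.

Lemma leaf_at_solution L eta v q : smooth_near v q -> smooth_near eta (q, v q) ->
  solves_at L v q -> (\forall q \near q, px v q = eta (q, v q)) ->
  leaf_at (ut_of L eta) eta v q.
Proof.
move=> sv se sol vx; split; [exact: smooth_differentiable| |exact: nbhs_singleton vx].
(* A single solution is treated as a family that is constant in the parameter. *)
pose f (z : R * R * R) := v z.1.
have sf : smooth_near f (q, 0) by exact: smooth_base.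
have fxE z : dx f z = px v z.1.
  by case: z => q' k; have := px_slice f k; rewrite /f /= => /(congr1 (@^~ q')) <-.
have ftE z : dt f z = pt v z.1.
  by case: z => q' k; have := pt_slice f k; rewrite /f /= => /(congr1 (@^~ q')) <-.
have fx : \forall z \near (q, (0 : R)), dx f z = eta (z.1, f z).
  by apply: filterS (near_fst (z := (q, 0)) vx) => z; rewrite fxE.
by have /(solution_gradientE L sf se fx) := iffLR (solves_atE L f (q, 0)) sol; rewrite ftE.
Qed.

End Leaves.

Section Reduction.
Context {R : realType}.
Implicit Types (L : evolution_eq R) (q : R * R) (v : R * R -> R) (Q P : operator R).
Implicit Types (f eta H : R * R * R -> R) (k : R).

Lemma near_pair_ball (V W : normedModType R) (a : V) (b : W) (P : V * W -> Prop) :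
  (\forall z \near (a, b), P z) ->
  exists2 e : R, 0 < e & forall x y, `|x - a| < e -> `|y - b| < e -> P (x, y).
Proof.
move=> /(iffLR (nbhs_normlP _ _))[e e0 eP]; exists e => // x y xe ye; apply: eP.
by rewrite -[_ - _]/(x - a, y - b) normr_pair_lt xe.
Qed.

Lemma near_ball (V : normedModType R) (a : V) (e : R) : 0 < e -> \forall x \near a, `|x - a| < e.
Proof. by move=> e0; apply: (iffRL (nbhs_normlP _ _)); exists e. Qed.

Lemma near_dist_lt (V : normedModType R) (f : V -> R) (a : V) (b e : R) :
  {for a, continuous f} -> `|f a - b| < e -> \forall x \near a, `|f x - b| < e.
Proof.
move=> cf fe; have cn : {for a, continuous (fun x => `|f x - b|)}.
  apply: (@continuous_comp _ _ _ (fun x => f x - b) (fun y => `|y|)); last exact: norm_continuous.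
  by apply: cvgB => //; exact: cvg_cst.
exact: (cvgr_lt _ cn _ fe).
Qed.

Lemma solution_family_leaf L eta f z0 : smooth_near f z0 -> smooth_near eta (z0.1, f z0) ->
  (\forall z \near z0, dx f z = eta (z.1, f z)) ->
  (\forall z \near z0, dt f z = ut_of L eta (z.1, f z)) <->
  (\forall z \near z0, solves_at L (fun q => f (q, z.2)) z.1).
Proof.
move=> sf se fx; have n := nbhsI (nbhsI (smooth_nearW sf) (near_graph sf (smooth_nearW se)))
  (near_join fx).
split=> h; apply: filterS (nbhsI n h) => z [] [] [] sf' se' fx' h'.
  by apply/solves_atE/(solution_gradientE L sf' se' fx').
by apply/(solution_gradientE L sf' se' fx')/solves_atE.
Qed.

Variables (L : evolution_eq R) (eta f : R * R * R -> R) (q0 : R * R) (u0 : R).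
Hypotheses (sA : smooth_near (Acoef L) q0) (sB : smooth_near (Bcoef L) q0)
  (sC : smooth_near (Ccoef L) q0) (se : smooth_near eta (q0, u0)) (sf : smooth_near f (q0, u0)).
Hypothesis f0 : \forall k \near u0, f (q0, k) = k.
Hypothesis df : \forall z \near (q0, u0), [/\ dt f z = ut_of L eta (z.1, f z),
  dx f z = eta (z.1, f z) & 0 < du f z].

(** A solution with [v_x = eta] is a leaf, and the leaf of value [y] at [q0] is [f (., y)]; the
    parameter to be found is therefore [y] itself. *)
Lemma leaf_reduction : reduction_family L q0 u0 eta f.
Proof.
have fu : f (q0, u0) = u0 by exact: nbhs_singleton f0.
have fx : \forall z \near (q0, u0), dx f z = eta (z.1, f z) by apply: filterS df => z [].
have ft : \forall z \near (q0, u0), dt f z = ut_of L eta (z.1, f z) by apply: filterS df => z [].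
have se' : smooth_near eta ((q0, u0).1, f (q0, u0)) by rewrite fu.
have sH : smooth_near (ut_of L eta) (q0, u0) by exact: smooth_ut_of.
split.
- split=> //; first exact/(solution_family_leaf L sf se' fx).
  by apply: filterS df => z [_ _ h]; rewrite gt_eqF.
- exact: fx.
move=> K nK; have [r r0 uniq] := leaf_unique sH se.
have fr : `|f (q0, u0) - u0| < r by rewrite fu subrr normr0.
have [e e0 eP] := near_pair_ball (nbhsI (nbhsI df (smooth_nearW sf))
  (near_dist_lt (smooth_continuous sf) fr)).
have [e' e'0 e'P] := near_pair_ball (smooth_nearW se).
pose m := Num.min e (Num.min e' r); have m0 : 0 < m by rewrite !lt_min e0 e'0.
rewrite fu; apply: filterS (nbhsI nK (nbhsI f0 (near_ball u0 m0))) => y [Ky [fy ym]].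
move=> v [sv nv] vx vy; exists y => //.
move: ym; rewrite !lt_min => /andP[ye /andP[ye' yr]].
have vr : `|v q0 - u0| < Num.min r e' by rewrite vy lt_min yr.
have nq := nbhsI (near_dist_lt (smooth_continuous sv) vr)
  (nbhsI (near_join vx) (nbhsI nv (smooth_nearW sv))).
have [d d0 dP] := iffLR (nbhs_normlP _ _) nq.
have e1 : 0 < Num.min m d by rewrite lt_min m0.
apply: filterS (near_ball q0 e1); apply: (uniq v (fun q => f (q, y)) (Num.min m d)).
- by rewrite !ge_min lexx !orbT.
- by rewrite vy fy.
- move=> q; rewrite !lt_min => /andP[/andP[qe /andP[qe' qr]] /dP[vq [vx' [sol sv']]]].
  move: vq; rewrite lt_min => /andP[vr' ve']; have [[[t x _] sf'] _] := eP q y qe ye; split.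
    apply: leaf_at_solution => //; exact: e'P.
  exact: leaf_at_slice.
- move=> q; rewrite !lt_min => /andP[/andP[qe /andP[qe' qr]] /dP[vq _]].
  by have [_ fr'] := eP q y qe ye; move: vq; rewrite lt_min => /andP[].
Qed.

Lemma leaf_reparameterization k1 f1 : f1 (q0, k1) = u0 -> solution_family L q0 k1 f1 ->
  family_invariant q0 k1 eta f1 -> reparameterization q0 u0 f k1 f1.
Proof.
move=> fk [s1 sol1 d1] x1; have s1' : smooth_near eta ((q0, k1).1, f1 (q0, k1)) by rewrite fk.
have t1 := iffRL (solution_family_leaf L s1 s1' x1) sol1.
have fu : f (q0, u0) = u0 by exact: nbhs_singleton f0.
have sH : smooth_near (ut_of L eta) (q0, u0) by exact: smooth_ut_of.
have sth : smooth_near (fun k => f1 (q0, k)) k1 by exact: smooth_slicer.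
(* The member of [f1] with parameter [k] is the leaf labelled by its value at [q0]. *)
exists (fun k => f1 (q0, k)); split => //.
  rewrite derive1E; move: (nbhs_singleton d1) s1; clear.
  case: q0 => t x n s; have [_ ->] := slice_is_derive (smooth_differentiable s).
  exact: n.
have [r r0 uniq] := leaf_unique sH se.
have fr : `|f (q0, u0) - u0| < r by rewrite fu subrr normr0.
have f1r : `|f1 (q0, k1) - u0| < r by rewrite fk subrr normr0.
have [e e0 eP] := near_pair_ball (nbhsI (nbhsI df (smooth_nearW sf))
  (near_dist_lt (smooth_continuous sf) fr)).
have [d d0 dP] := near_pair_ball (nbhsI (nbhsI t1 x1) (nbhsI (smooth_nearW s1)
  (near_dist_lt (smooth_continuous s1) f1r))).
have the : `|(fun k => f1 (q0, k)) k1 - u0| < e by rewrite fk subrr normr0.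
have f0' : \forall k \near f1 (q0, k1), f (q0, k) = k by rewrite fk.
have n0 : \forall k \near k1, f (q0, f1 (q0, k)) = f1 (q0, k).
  exact: ((smooth_continuous sth) _ f0').
have [m m0 mP] := iffLR (nbhs_normlP _ _) (nbhsI n0 (nbhsI
  (near_dist_lt (smooth_continuous sth) the) (near_ball k1 d0))).
pose b := Num.min e (Num.min d r); have b0 : 0 < b by rewrite !lt_min e0 d0.
apply: (iffRL (nbhs_normlP _ _)); exists (Num.min b m); first by rewrite lt_min b0.
move=> [q k]; rewrite -[_ - _]/(q - q0, k - k1) normr_pair_lt !lt_min.
move=> /andP[/andP[qb _] /andP[_ /mP[fk0 [ke kd]]]].
apply: (uniq (fun q => f1 (q, k)) (fun q => f (q, f1 (q0, k))) b) => //.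
- by rewrite !ge_min lexx !orbT.
- move=> q'; rewrite !lt_min => /andP[qe /andP[qd _]].
  have [[[t x _] s] _] := eP q' _ qe ke; have [[t' x'] [s' _]] := dP q' k qd kd.
  split.
    exact: (leaf_at_slice s' t' x').
  exact: (leaf_at_slice s t x).
- move=> q'; rewrite !lt_min => /andP[qe /andP[qd _]].
  by have [_ h] := eP q' _ qe ke; have [_ [_ h']] := dP q' k qd kd; split.
- by rewrite !lt_min.
Qed.

End Reduction.

Lemma vanishing_difference (F : realFieldType) (a b c : F) : a + b = c <-> c - a - b = 0.
Proof.
split=> [<-|/eqP]; first by rewrite -addrA -opprD subrr.
by rewrite -addrA -opprD subr_eq0 => /eqP <-.
Qed.

(** * Families of leaves as families associated with the algebra *)

Section AssociatedLeaf.
Context {R : realType}.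
Implicit Types (L : evolution_eq R) (q : R * R) (v : R * R -> R) (P Q S : operator R).
Implicit Types (f eta : R * R * R -> R) (k : R) (g : set (operator R)).

Lemma invariant_atE Q f z :
  invariant_at Q (fun q => f (q, z.2)) z.1 <-> characteristic Q f z = 0.
Proof.
rewrite /invariant_at pt_slice px_slice -surjective_pairing; exact: vanishing_difference.
Qed.

Lemma independent_sym q0 P Q : independent q0 P Q -> independent q0 Q P.
Proof.
move=> ind a b h; have [] := ind b a; last by [].
by apply: filterS h => q; rewrite /lincomb /= ![b * _ + _]addrC.
Qed.

Lemma op_basis_mem q0 g P Q a b : op_basis q0 g P Q -> g (lincomb a P b Q).
Proof. by move=> [_ ->]; exists a, b; exact: op_eq_refl. Qed.

Lemma op_basis_meml q0 g P Q : op_basis q0 g P Q -> g P.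
Proof.
move=> [_ ->]; exists 1, 0; apply: nbhs_all => q.
by rewrite /lincomb /= !mul1r !mul0r !addr0.
Qed.

Lemma op_basis_memr q0 g P Q : op_basis q0 g P Q -> g Q.
Proof.
move=> [_ ->]; exists 0, 1; apply: nbhs_all => q.
by rewrite /lincomb /= !mul1r !mul0r !add0r.
Qed.

Lemma op_basis_sym q0 g P Q : op_basis q0 g P Q -> op_basis q0 g Q P.
Proof.
move=> b; apply: (independent_basis b (op_basis_memr b) (op_basis_meml b)).
exact: independent_sym (proj1 b).
Qed.

Lemma near_slice (q0 : R * R) (k0 : R) (P : set (R * R * R)) :
  (\forall z \near (q0, k0), P z) -> \forall q \near q0, P (q, k0).
Proof.
move=> /near_pair_ball[e e0 eP]; apply: filterS (near_ball q0 e0) => q qe.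
by apply: eP; rewrite ?subrr ?normr0.
Qed.

Lemma independent_shear q0 P Q (a b : R) : b != 0 -> independent q0 P Q ->
  independent q0 (lincomb a P b Q) P.
Proof.
move=> b0 ind x y h; have E : op_eq_near q0 (lincomb (x * a + y) P (x * b) Q) op_zero.
  apply: filterS h => q; rewrite /lincomb /=.
  have e (p r : R) : x * (a * p + b * r) + y * p = (x * a + y) * p + x * b * r by ring.
  by rewrite !e.
have [+ /eqP] := ind _ _ E; rewrite mulf_eq0 (negPf b0) orbF => + /eqP x0.
by rewrite x0 mul0r add0r.
Qed.

Section Regular.
Variables (L : evolution_eq R) (g : set (operator R)) (f : R * R * R -> R) (q0 : R * R) (u0 : R).
Variables (P1 P2 : operator R) (c1 c2 : R -> R).
Hypotheses (basis : op_basis q0 g P1 P2) (s1 : smooth_op q0 P1) (s2 : smooth_op q0 P2).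
Hypotheses (sol : solution_family L q0 u0 f) (sc : smooth_near c1 u0).
Hypotheses (W1 : \forall z \near (q0, u0), characteristic P1 f z = c1 z.2 * du f z)
  (W2 : \forall z \near (q0, u0), characteristic P2 f z = c2 z.2 * du f z).

Lemma regular_family_of_characteristics : c1 u0 != 0 -> regular_family L g q0 u0 f.
Proof.
move=> c0; have [sf so d0] := sol; have nc0 : - c1 u0 != 0 by rewrite oppr_eq0.
have [theta [st t0 dth]] := smooth_autonomous_ode sc.
(* The coefficients are frozen at [u0], which keeps the combination in [g]. Its characteristic on
   the member [k] is [(c2 u0 * c1 k - c1 u0 * c2 k) f_kappa], zero at [k = u0]. *)
exists (lincomb (c2 u0) P1 (- c1 u0) P2), P1; split.
- exact: (op_basis_mem _ _ basis).
- exact: op_basis_meml basis.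
- exact: independent_shear (proj1 basis).
exists (fun q => f (q, u0)), (fun z => f (z.1, theta z.2)); split.
- split; [exact: smooth_slicel|exact: (near_slice so)].
- apply: filterS (nbhsI (near_slice W1) (near_slice W2)) => q [w1 w2].
  apply/(invariant_atE _ _ (q, u0)).
  rewrite (@characteristic_lincomb _ (c2 u0) P1 (- c1 u0) P2); last by [].
  by rewrite w1 w2 /= mulNr mulrCA subrr.
- move=> /nbhs_singleton/(invariant_atE P1 f (q0, u0)).
  by rewrite (nbhs_singleton W1) => /eqP; rewrite mulf_eq0 (negPf c0) (negPf (nbhs_singleton d0)).
- exact: (group_orbit_family s1 sf t0 (smooth_continuous st) W1 dth).
- exists theta; split => //; last exact: nbhs_all.
  by rewrite derive1E; have [_ ->] := nbhs_singleton dth; rewrite t0.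
Qed.

End Regular.

Lemma leaf_associated L g eta f q0 u0 :
  smooth_near (Acoef L) q0 -> smooth_near (Bcoef L) q0 -> smooth_near (Ccoef L) q0 ->
  lie_invariance_algebra2 L q0 g -> invariant_solution_DE0 L g (q0, u0) eta ->
  nonsingular L g (q0, u0) eta -> f (q0, u0) = u0 -> solution_family L q0 u0 f ->
  (\forall z \near (q0, u0), [/\ dt f z = ut_of L eta (z.1, f z),
     dx f z = eta (z.1, f z) & 0 < du f z]) ->
  associated_family L g q0 u0 f.
Proof.
move=> sA sB sC [[[P1 [P2 basis]] _] gS] [se _ inv] ns fu sol df; split => //.
have [sf _ d0] := sol.
have g1 := op_basis_meml basis; have g2 := op_basis_memr basis.
have [s1 y1] := gS P1 g1; have [s2 y2] := gS P2 g2.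
have se' : smooth_near eta ((q0, u0).1, f (q0, u0)) by rewrite fu.
have i P : g P -> invariant0_near ((q0, u0).1, f (q0, u0)) (induced_op P) eta.
  by move=> gP; rewrite fu; apply: inv; exists P.
have W1 := @characteristic_family _ L P1 f eta (q0, u0) sA sB sC s1 sf se' y1 (i _ g1) df.
have W2 := @characteristic_family _ L P2 f eta (q0, u0) sA sB sC s2 sf se' y2 (i _ g2) df.
pose c P k := characteristic P f (q0, k) / du f (q0, k).
have sc P : smooth_op q0 P -> smooth_near (c P) u0.
  move=> sP; apply: (smooth_slicer (F := fun z => characteristic P f z * (du f z)^-1)).
  apply: smoothM; first exact: (@smooth_characteristic _ P f (q0, u0)).
  apply: smoothV; [exact: (nbhs_singleton d0)|exact: smooth_derive].
have T P : \forall z \near (q0, u0), characteristic P f z = transversal L eta P (z.1, f z).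
  by apply: filterS df => z [t x _]; exact: characteristicE.
have T0 P : characteristic P f (q0, u0) = transversal L eta P (q0, u0).
  by rewrite (nbhs_singleton (T P)) /= fu.
have reg P : transversal L eta P (q0, u0) != 0 ->
    characteristic P f (q0, u0) / du f (q0, u0) != 0.
  by rewrite -T0 => n; rewrite mulf_neq0// invr_eq0; exact: (nbhs_singleton d0).
have [z1|n1] := eqVneq (transversal L eta P1 (q0, u0)) 0; last first.
  right; apply: (regular_family_of_characteristics (c1 := c P1) (c2 := c P2) basis) => //.
    exact: sc.
  exact: (reg _ n1).
have [z2|n2] := eqVneq (transversal L eta P2 (q0, u0)) 0; last first.
  right; apply: (regular_family_of_characteristics (c1 := c P2) (c2 := c P1) (op_basis_sym basis)) => //.
    exact: sc.
  exact: (reg _ n2).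
(* Both operators are tangent to the leaf at [(q0, u0)], so the rank there is 2. Nonsingularity
   carries rank 2, hence tangency, to a neighbourhood and excludes characteristics vanishing on
   isolated members only. *)
left; have r : \forall p \near (q0, u0), transversal L eta P1 p = 0 /\ transversal L eta P2 p = 0.
  apply: filterS (ns _ _ basis) => p.
  rewrite -[rows_mx _ _ _]/(graph_mx L eta P1 P2 p).
  rewrite -[X in _ = \rank X]/(graph_mx L eta P1 P2 (q0, u0)) !rank_graph_mx z1 z2 eqxx /=.
  by case: eqP => [->|]; case: eqP => [->|].
have nr : \forall z \near (q0, u0), transversal L eta P1 (z.1, f z) = 0 /\
    transversal L eta P2 (z.1, f z) = 0.
  apply: (@near_graph _ f (q0, u0) [set p | transversal L eta P1 p = 0 /\ transversal L eta P2 p = 0] sf).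
  by rewrite fu.
move=> Q gQ; have [a [b E]] : exists a b, op_eq_near q0 Q (lincomb a P1 b P2).
  by move: gQ; rewrite (proj2 basis).
apply: filterS (nbhsI nr (nbhsI (near_fst (z := (q0, u0)) E) (nbhsI (T P1) (T P2)))).
move=> z [[r1 r2] [E' [w1 w2]]]; apply/invariant_atE.
by rewrite (characteristic_lincomb f E') w1 w2 r1 r2 !mulr0 addr0.
Qed.

End AssociatedLeaf.

(** * From families to the determining equation *)

Section FamilyEta.
Context {R : realType}.
Implicit Types (L : evolution_eq R) (q : R * R) (Q P : operator R).
Implicit Types (f eta H : R * R * R -> R) (k : R) (z p : R * R * R).

(** Since [du f] does not vanish, the graphs of the members sweep out a neighbourhood. Identities
    along the family become identities in [(t, x, u)]. *)
Lemma near_cover f q0 k0 (P : set (R * R * R)) : smooth_near f (q0, k0) -> du f (q0, k0) != 0 ->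
  (\forall z \near (q0, k0), P (z.1, f z)) -> \forall p \near (q0, f (q0, k0)), P p.
Proof.
move=> sf d0 nP; have [kappa [sk fk kf]] := smooth_implicit sf d0.
have k0E : kappa (q0, f (q0, k0)) = k0 by have := nbhs_singleton kf.
have n := @near_graph _ kappa (q0, f (q0, k0)) [set z | P (z.1, f z)] sk.
rewrite k0E in n; apply: filterS (nbhsI (n nP) fk) => -[q u] [h /= E].
by have h' : P (q, f (q, kappa (q, u))) := h; rewrite E in h'.
Qed.

Lemma family_eta f q0 k0 : smooth_near f (q0, k0) -> du f (q0, k0) != 0 ->
  exists2 eta, smooth_near eta (q0, f (q0, k0)) & family_invariant q0 k0 eta f.
Proof.
move=> sf d0; have [kappa [sk fk kf]] := smooth_implicit sf d0.
have k0E : kappa (q0, f (q0, k0)) = k0 by have := nbhs_singleton kf.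
exists (fun p => dx f (p.1, kappa p)).
  by apply: (smooth_graph (G := dx f)) => //; rewrite k0E; exact: smooth_derive.
by apply: filterS kf => z /= ->; rewrite -surjective_pairing.
Qed.

(** The equality of [f_xt] and [f_tx], read on the graph. *)
Lemma graph_compat H eta f z : smooth_near f z -> smooth_near eta (z.1, f z) ->
  smooth_near H (z.1, f z) -> (\forall z' \near z, dx f z' = eta (z'.1, f z')) ->
  (\forall z' \near z, dt f z' = H (z'.1, f z')) ->
  dt eta (z.1, f z) + H (z.1, f z) * du eta (z.1, f z) =
  dx H (z.1, f z) + eta (z.1, f z) * du H (z.1, f z).
Proof.
move=> sf se sH fx ft; set p := (z.1, f z).
have S : dt (dx f) z = dx (dt f) z := smooth_schwarz _ _ sf.
have Et := etrans (dt_graph_eq sf se fx)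
  (congr1 (fun y => dt eta p + y * du eta p) (nbhs_singleton ft)).
have Ex := etrans (dx_graph_eq sf sH ft)
  (congr1 (fun y => dx H p + y * du H p) (nbhs_singleton fx)).
exact: etrans (esym Et) (etrans S Ex).
Qed.

Variables (L : evolution_eq R) (eta f : R * R * R -> R) (q0 : R * R) (k0 : R).
Hypotheses (sA : smooth_near (Acoef L) q0) (sB : smooth_near (Bcoef L) q0)
  (sC : smooth_near (Ccoef L) q0) (sf : smooth_near f (q0, k0)) (d0 : du f (q0, k0) != 0)
  (se : smooth_near eta (q0, f (q0, k0))) (fx : family_invariant q0 k0 eta f).

Lemma family_DE0 : (\forall z \near (q0, k0), dt f z = ut_of L eta (z.1, f z)) ->
  \forall p \near (q0, f (q0, k0)), DE0_at L eta p.
Proof.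
move=> ft; apply: near_cover => //.
have n1 := nbhsI (nbhsI (near_fst (z := (q0, k0)) (smooth_nearW sA))
  (near_fst (z := (q0, k0)) (smooth_nearW sB))) (near_fst (z := (q0, k0)) (smooth_nearW sC)).
have n2 := nbhsI (smooth_nearW sf) (near_graph sf (smooth_nearW se)).
apply: filterS (nbhsI (nbhsI n1 n2) (nbhsI (near_join fx) (near_join ft))).
move=> z [[[[a b] c] [sf' se']] [fx' ft']]; apply: (iffRL (@DE0_compatE _ L eta (z.1, f z) a b c se')).
by apply: graph_compat => //; exact: smooth_ut_of.
Qed.

Lemma family_eta_unique eta1 : family_invariant q0 k0 eta1 f ->
  \forall p \near (q0, f (q0, k0)), eta1 p = eta p.
Proof.
by move=> fx1; apply: near_cover => //; apply: filterS (nbhsI fx fx1) => z [<- <-].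
Qed.

Lemma family_invariant0 Q : smooth_op q0 Q ->
  (\forall z \near (q0, k0), dx (characteristic Q f) z = du eta (z.1, f z) * characteristic Q f z) ->
  invariant0_near (q0, f (q0, k0)) (induced_op Q) eta.
Proof.
move=> sQ Wx; apply: near_cover => //.
have n := nbhsI (nbhsI (smooth_op_near (z := (q0, k0)) sQ) (smooth_nearW sf))
  (nbhsI (near_graph sf (smooth_nearW se)) (near_join fx)).
apply: filterS (nbhsI n Wx) => z [[[sQ' sf'] [se' fx']] Wx'].
by apply/(characteristic_dx_invariant sQ' sf' se' fx').
Qed.

End FamilyEta.

Lemma orbit_dt_algebra (F : realFieldType) (t t' x xt z zt ot f ft fx ftt fxt fxt' fut : F) :
  fxt' = fxt ->
  z * ft + f * zt + ot - (t * ftt + ft * (1 * t')) - (x * fxt' + fx * xt) = fut ->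
  t * ftt + x * fxt + 1 * fut = z * ft + f * zt + ot - ft * t' - fx * xt.
Proof. by move=> -> <-; ring. Qed.

Lemma orbit_dx_algebra (F : realFieldType) (t t' x xx z zx ox f ft fx ftx ftx' fxx fux : F) :
  ftx' = ftx ->
  z * fx + f * zx + ox - (t * ftx' + ft * (0 * t')) - (x * fxx + fx * xx) = fux ->
  t * ftx + x * fxx + 1 * fux = z * fx + f * zx + ox - fx * xx.
Proof. by move=> -> <-; ring. Qed.

Lemma orbit_du_algebra (F : realFieldType)
    (t t' x z f ft fx fu ftu ftu' fxu fxu' fuu x0 z0 o0 : F) :
  ftu' = ftu -> fxu' = fxu -> x0 = 0 -> z0 = 0 -> o0 = 0 ->
  z * fu + f * z0 + o0 - (t * ftu' + ft * (0 * t')) - (x * fxu' + fx * x0) = fuu ->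
  t * ftu + x * fxu + 1 * fuu = z * fu.
Proof. by move=> -> -> -> -> -> <-; ring. Qed.

(** With [D] the derivative along [tau2 d_t + xi2 d_x + d_s], this reads [D W1 = zeta1_2 * W1 -
    W_[Q1, Q2]]. The hypotheses on [Df], [Dft], [Dfx] give [D] on [f], [f_t], [f_x]. *)
Lemma orbit_bracket_algebra (F : realFieldType)
  (f ft fx Df Dft Dfx t1 t1' x1 x1t x1x z1 z1t z1x o1 o1t o1x
   t2 t2' x2 x2t x2x z2 z2t z2x o2 o2t o2x Dz Do Dx : F) :
  Dz = t2 * z1t + x2 * z1x -> Do = t2 * o1t + x2 * o1x -> Dx = t2 * x1t + x2 * x1x ->
  Df = z2 * f + o2 -> Dft = z2 * ft + f * z2t + o2t - ft * t2' - fx * x2t ->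
  Dfx = z2 * fx + f * z2x + o2x - fx * x2x ->
  z1 * Df + f * Dz + Do - (t1 * Dft + ft * (t2 * t1')) - (x1 * Dfx + fx * Dx) =
  z2 * (z1 * f + o1 - t1 * ft - x1 * fx)
  - ((t1 * z2t + x1 * z2x - (t2 * z1t + x2 * z1x)) * f
     + (t1 * o2t + x1 * o2x + o1 * z2 - (t2 * o1t + x2 * o1x + o2 * z1))
     - (t1 * t2' - t2 * t1') * ft - (t1 * x2t + x1 * x2x - (t2 * x1t + x2 * x1x)) * fx).
Proof. by move=> -> -> -> -> -> ->; ring. Qed.

Lemma orbit_ratio_algebra (F : realFieldType) (W V z a b DW DV : F) : V != 0 ->
  DV = z * V -> DW = z * W - (a * W + b * V) ->
  W * (- DV / V ^+ 2) + V^-1 * DW = - a * (W * V^-1) - b.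
Proof. by move=> V0 -> ->; field. Qed.

Lemma solve_transport (F : realFieldType) (a b c w : F) : w - a - b = c -> a + b + 1 * c = w.
Proof. by move=> <-; ring. Qed.

(** * Differentiation along orbits *)

Section OrbitDerivatives.
Context {R : realType}.
Implicit Types (Q P : operator R) (f : R * R * R -> R) (z : R * R * R).

Let et : R * R * R := (1, 0, 0).
Let ex : R * R * R := (0, 1, 0).
Let eu : R * R * R := (0, 0, 1).

(** The velocity in [(t, x, s)]-space of a point carried by the flow of [Q] with group parameter
    [s]. *)
Definition orbit_direction Q z : R * R * R := (tau Q z.1.1, xi Q z.1, 1).

Lemma derive_orbit Q (F : R * R * R -> R) z : smooth_near F z ->
  'D_(orbit_direction Q z) F z = tau Q z.1.1 * dt F z + xi Q z.1 * dx F z + 1 * du F z.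
Proof. by move=> /smooth_differentiable/derive3E. Qed.

Lemma op_act_derive Q (F : R * R -> R) z : smooth_near F z.1 ->
  'D_((orbit_direction Q z).1) F z.1 = op_act Q F z.1.
Proof. by move=> /smooth_differentiable/derive2E. Qed.

Lemma derive_zero (V : normedModType R) (F : V -> R) p : 'D_0 F p = 0.
Proof.
rewrite /derive (_ : (fun h => _) = cst 0) ?lim_cst//.
by apply/funext => h; rewrite /= scaler0 add0r subrr scaler0.
Qed.

(** Differentiating [W = f_s] in [t], [x] and [s] and exchanging the order of derivatives gives
    these values, free of second derivatives of [f]. *)
Lemma orbit_derivatives Q f z : smooth_op z.1 Q -> smooth_near f z ->
  (\forall z' \near z, characteristic Q f z' = du f z') ->
  let D F := 'D_(orbit_direction Q z) F z in
  [/\ D f = zeta1 Q z.1 * f z + zeta0 Q z.1,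
      D (dt f) = zeta1 Q z.1 * dt f z + f z * pt (zeta1 Q) z.1 + pt (zeta0 Q) z.1
        - dt f z * derive1 (tau Q) z.1.1 - dx f z * pt (xi Q) z.1,
      D (dx f) = zeta1 Q z.1 * dx f z + f z * px (zeta1 Q) z.1 + px (zeta0 Q) z.1
        - dx f z * px (xi Q) z.1 &
      D (du f) = zeta1 Q z.1 * du f z].
Proof.
move=> sQ sf W D.
have sdv v : smooth_near ('D_v f) z by exact: smooth_derive.
have E v : _ = 'D_v (du f) z := etrans (esym (@derive_val _ _ _ _ _ _ _
  (characteristic_derive v sQ sf))) (near_eq_derive v W).
have S v w : 'D_w ('D_v f) z = 'D_v ('D_w f) z := smooth_schwarz v w sf.
split.
- apply: etrans (derive_orbit Q sf) _; apply: solve_transport; exact: nbhs_singleton W.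
- exact: etrans (derive_orbit Q (sdv et)) (orbit_dt_algebra (S ex et) (etrans (E et) (S eu et))).
- exact: etrans (derive_orbit Q (sdv ex)) (orbit_dx_algebra (S et ex) (etrans (E ex) (S eu ex))).
- exact: etrans (derive_orbit Q (sdv eu)) (orbit_du_algebra (S et eu) (S ex eu)
    (derive_zero _ _) (derive_zero _ _) (derive_zero _ _) (E eu)).
Qed.

(** The factor [zeta1] of [Q2] enters the derivatives of [W1] and of [f_s] alike and cancels in the
    quotient; only the coefficients [a], [b] of the bracket remain. *)
Lemma orbit_ratio_derive Q1 Q2 f a b z : smooth_op z.1 Q1 -> smooth_op z.1 Q2 ->
  smooth_near f z -> du f z != 0 -> (\forall z' \near z, characteristic Q2 f z' = du f z') ->
  op_eq_near z.1 (bracket Q1 Q2) (lincomb a Q1 b Q2) ->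
  is_derive z (orbit_direction Q2 z) (fun z => characteristic Q1 f z * (du f z)^-1)
    (- a * (characteristic Q1 f z * (du f z)^-1) - b).
Proof.
move=> s1 s2 sf d0 W B; set v := orbit_direction Q2 z.
have [Df Dft Dfx Dfu] := orbit_derivatives s2 sf W; have [st sx sz so] := s1.
have DW := characteristic_derive v s1 sf.
have DV := smooth_is_derive v (smooth_derive (f := f) eu sf).
have E := orbit_bracket_algebra (tau Q1 z.1.1) (derive1 (tau Q1) z.1.1)
  (xi Q1 z.1) (zeta1 Q1 z.1) (zeta0 Q1 z.1)
  (op_act_derive Q2 sz) (op_act_derive Q2 so) (op_act_derive Q2 sx) Df Dft Dfx.
have WB : characteristic (bracket Q1 Q2) f z = a * characteristic Q1 f z + b * du f z.
  rewrite -(nbhs_singleton W); apply: characteristic_lincomb; exact: nbhs_singleton B.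
have DWE := etrans (@derive_val _ _ _ _ _ _ _ DW)
  (etrans E (congr1 (fun y => zeta1 Q2 z.1 * characteristic Q1 f z - y) WB)).
have DW' := smooth_is_derive v (smooth_characteristic s1 sf).
have D := is_derive_mulf DW' (is_derive_invf d0 DV); rewrite /= in D.
have ratioE := orbit_ratio_algebra d0 Dfu DWE.
by rewrite -ratioE.
Qed.

End OrbitDerivatives.

Section OrbitRatio.
Context {R : realType}.
Implicit Types (Q P : operator R) (f eta : R * R * R -> R) (z p : R * R * R) (q : R * R).

Lemma scaled_value (F : realFieldType) (c w x y : F) : x = y -> c * x + w * 0 = c * y.
Proof. by move=> ->; rewrite mulr0 addr0. Qed.

Lemma affine_field_lipschitz (F : realFieldType) (s a b x y : F) :
  s * (- a * x - b) - s * (- a * y - b) = - (s * a) * (x - y).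
Proof. by ring. Qed.

Lemma orbit_ratio_flat Q1 Q2 f (v : R * R -> R) q0 u0 Psi a b :
  smooth_op q0 Q1 -> smooth_op q0 Q2 -> op_eq_near q0 (bracket Q1 Q2) (lincomb a Q1 b Q2) ->
  local_flow Q2 (q0, u0) Psi -> {for q0, continuous v} -> v q0 = u0 ->
  smooth_near f (q0, 0) -> du f (q0, 0) != 0 ->
  (\forall z \near (q0, (0 : R)), characteristic Q2 f z = du f z) ->
  (\forall q \near q0, characteristic Q1 f (q, 0) = 0) ->
  exists phi : R -> R, \forall z \near (q0, (0 : R)),
    characteristic Q1 f z * (du f z)^-1 = phi z.2.
Proof.
move=> s1 s2 B fP cv v0 sf d0 W2 W1; pose r z := characteristic Q1 f z * (du f z)^-1.
(* [phi] is the ratio along the orbit of the base point. Other orbits are compared with it by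
   uniqueness for the scalar equation, all starting from the value 0. *)
exists (fun s => r ((Psi s (q0, u0)).1, s)).
have sdu : smooth_near (du f) (q0, 0) by exact: smooth_derive.
have nd0 : \forall z \near (q0, (0 : R)), du f z != 0.
  exact: (cvgr_neq0 _ (smooth_continuous sdu)).
have n := nbhsI (nbhsI (smooth_op_near (z := (q0, 0)) s1) (smooth_op_near (z := (q0, 0)) s2))
  (nbhsI (nbhsI (smooth_nearW sf) nd0) (nbhsI (near_join W2) (near_fst (z := (q0, 0)) (near_join B)))).
have [e e0 eP] := near_pair_ball n.
have dr z : `|z.1 - q0| < e -> `|z.2| < e -> differentiable r z /\
    'D_(orbit_direction Q2 z) r z = - a * r z - b.
  case: z => q s qe se; have [|[s1' s2'] [[sf' d'] [W2' B']]] := eP q s qe.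
    by rewrite subr0.
  split; last by have [_ <-] := orbit_ratio_derive s1' s2' sf' d' W2' B'.
  apply: smooth_differentiable; apply: smoothM; first exact: smooth_characteristic.
  by apply: smoothV => //; exact: smooth_derive.
have [d d1 dP] := @local_flow_ball _ Q2 (q0, u0) Psi e s2 fP e0.
pose m := Num.min d e; have m0 : 0 < m by rewrite lt_min d1.
pose y (s : R) q t := r ((Psi (0 + s * t) (q, v q)).1, 0 + s * t).
pose good q := `|(q, v q) - (q0, u0)| < d /\ characteristic Q1 f (q, 0) = 0.
have dy (s : R) q (t : R) : `|s| < m -> good q -> 0 <= t <= 1 ->
    is_derive t 1 (y s q) (s * (- a * y s q t - b)).
  rewrite lt_min => /andP[sd se] [pd _] t01.
  have [t1 _] := scaled_time_lt t01 sd; have [t2 _] := scaled_time_lt t01 se.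
  have [_ k B1] := dP _ _ t1 pd; have D1 := flow_curve_scaled k.
  have D2 := @is_derive_affine_curve _ _ id 1 0 s t (is_derive_id _ _).
  have [D3 _] := is_derive_base_curve D1 D2.
  have [|dz E] := dr ((Psi (0 + s * t) (q, v q)).1, 0 + s * t) _ t2.
    by apply: le_lt_trans B1; exact: (ler_norm_fst (Psi (0 + s * t) (q, v q) - (q0, u0))).
  exact: (eq_ind _ (fun x => is_derive t 1 (y s q) x) (is_derive_curve D3 dz) _
    (etrans (deriveZv s _ dz) (congr1 (fun x => s * x) E))).
have z0 : `|0 : R| < d by rewrite normr0.
have y0 (s : R) q : good q -> y s q 0 = 0.
  move=> [pd w]; have [E _ _] := dP _ _ z0 pd.
  by rewrite /y mulr0 addr0 E /r /= w mul0r.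
have g0 : good q0.
  split; last exact: nbhs_singleton W1.
  by rewrite -[_ - _]/(q0 - q0, v q0 - u0) v0 !subrr normr_pair_lt !normr0 d1.
have yE (s : R) q : `|s| < m -> good q -> y s q 1 = y s q0 1.
  move=> sm gq; apply: (@ode_unique R (fun _ x => s * (- a * x - b)) (y s q) (y s q0) `|s * a|) => //.
  - by move=> t t01; exact: dy.
  - by move=> t t01; exact: dy.
  - by move=> t _; rewrite affine_field_lipschitz normrM normrN.
  - by rewrite !y0.
have nv : \forall q \near q0, `|v q - u0| < d.
  by apply: near_dist_lt => //; rewrite v0 subrr normr0.
have ns : \forall z \near (q0, (0 : R)), `|z.2| < m.
  apply: (iffRL (nbhs_normlP _ _)); exists m => // -[q s].
  by rewrite -[_ - _]/(q - q0, s - 0) subr0 normr_pair_lt => /andP[].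
apply: filterS (nbhsI ns (flow_reaches s2 fP cv v0 (nbhsI (near_ball q0 d1) (nbhsI nv W1)))).
move=> [q' s] [/= sm [q [qd [vd w]] <-]].
have gq : good q by split=> //; rewrite -[_ - _]/(q - q0, v q - u0) normr_pair_lt qd.
by have := yE s q sm gq; rewrite /y !mulr1 !add0r v0.
Qed.

(** The factor [phi] is an arbitrary function, since the differentiation takes place on a slice,
    where [phi] is a constant. *)
Lemma dx_ratio_flat f eta (w : R * R * R -> R) (phi : R -> R) z : smooth_near f z ->
  smooth_near eta (z.1, f z) -> (\forall z' \near z, dx f z' = eta (z'.1, f z')) ->
  (\forall z' \near z, w z' = phi z'.2 * du f z') ->
  dx w z = du eta (z.1, f z) * w z.
Proof.
case: z => q s sf se fx wE; rewrite (nbhs_singleton wE).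
have sd : smooth_near (fun q => du f (q, s)) q.
  by apply: (smooth_slicel (F := du f)); exact: smooth_derive.
have E1 : dx w (q, s) = px (fun q => w (q, s)) q by rewrite px_slice.
have E2 : px (fun q => w (q, s)) q = px (fun q => phi s * du f (q, s)) q.
  by apply: near_eq_derive; exact: (near_slice wE).
have E3 : px (fun q => phi s * du f (q, s)) q = phi s * dx (du f) (q, s).
  have D := is_derive_mulf (is_derive_cst (phi s) q ((0, 1) : R * R)) (smooth_is_derive ((0, 1) : R * R) sd).
  have -> : px (fun q => phi s * du f (q, s)) q = _ := @derive_val _ _ _ _ _ _ _ D.
  exact: scaled_value (derive_slice (du f) s (0, 1) q).
have E4 : dx (du f) (q, s) = _ := etrans (smooth_schwarz _ _ sf) (du_graph_eq sf se fx).
by rewrite E1 E2 E3 E4; ring.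
Qed.

End OrbitRatio.

Lemma ratio_combination (F : realFieldType) (x y w d : F) : d != 0 ->
  x * w + y * d = (x * (w * d^-1) + y) * d.
Proof. by move=> d0; rewrite mulrDl -mulrA divfK. Qed.

(** * Invariance and nonsingularity of the eta of an orbit *)

Section OrbitInvariance.
Context {R : realType}.
Implicit Types (L : evolution_eq R) (Q P : operator R) (f eta : R * R * R -> R) (q : R * R).
Implicit Types (g : set (operator R)) (p z : R * R * R).

Lemma nonsingular_tangent L g eta p0 :
  (forall P, g P -> \forall p \near p0, transversal L eta P p = 0) -> nonsingular L g p0 eta.
Proof.
move=> T P Q b; have n := nbhsI (T _ (op_basis_meml b)) (T _ (op_basis_memr b)).
have [t1 t2] := nbhs_singleton n; apply: filterS n => p [h1 h2].
rewrite -[rows_mx _ _ _]/(graph_mx L eta P Q p).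
by rewrite -[X in _ = \rank X]/(graph_mx L eta P Q p0) !rank_graph_mx t1 t2 h1 h2.
Qed.

Lemma smooth_transversal L eta P p : smooth_op p.1 P -> smooth_near eta p ->
  smooth_near (ut_of L eta) p -> smooth_near (transversal L eta P) p.
Proof.
move=> [st sx s1 s0] se sH; apply: smoothB; last by apply: smoothM => //; exact: smooth_base.
apply: smoothB; last by apply: smoothM => //; exact: smooth_time.
by apply: smoothD; [apply: smoothM; [exact: smooth_base|exact: smooth_u]|exact: smooth_base].
Qed.

(** [P] is a combination of any basis, so some basis operator is transversal at [p0]. It stays so
    nearby by continuity, and the rank is 3 throughout. *)
Lemma nonsingular_transversal L g eta p0 P : (forall Q, g Q -> smooth_op p0.1 Q) ->
  smooth_near eta p0 -> smooth_near (ut_of L eta) p0 -> g P ->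
  transversal L eta P p0 != 0 -> nonsingular L g p0 eta.
Proof.
move=> gS se sH gP TP S Q b; have gSm := op_basis_meml b; have gQ := op_basis_memr b.
have nz X : g X -> transversal L eta X p0 != 0 -> \forall p \near p0, transversal L eta X p != 0.
  move=> gX h; have sT := smooth_transversal (gS X gX) se sH.
  exact: (cvgr_neq0 _ (smooth_continuous sT)).
have [x [y E]] : exists x y, op_eq_near p0.1 P (lincomb x S y Q).
  by move: gP; rewrite (proj2 b).
have TE := transversal_lincomb L eta (nbhs_singleton E).
have : (transversal L eta S p0 != 0) || (transversal L eta Q p0 != 0).
  move: TP; rewrite TE; apply: contraR; rewrite negb_or !negbK => /andP[/eqP-> /eqP->].
  by rewrite !mulr0 addr0.
case/orP => h.
  apply: filterS (nz _ gSm h) => p h'.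
  rewrite -[rows_mx _ _ _]/(graph_mx L eta S Q p).
  rewrite -[X in _ = \rank X]/(graph_mx L eta S Q p0) !rank_graph_mx.
  by rewrite (negPf h) (negPf h').
apply: filterS (nz _ gQ h) => p h'.
rewrite -[rows_mx _ _ _]/(graph_mx L eta S Q p).
rewrite -[X in _ = \rank X]/(graph_mx L eta S Q p0) !rank_graph_mx.
by rewrite (negPf h) (negPf h') !andbF.
Qed.

Lemma near_eq_invariant_at Q (v w : R * R -> R) q : (\forall q \near q, v q = w q) ->
  invariant_at Q v q -> invariant_at Q w q.
Proof.
move=> E; rewrite /invariant_at (nbhs_singleton E).
have -> : pt v q = pt w q by exact: near_eq_derive.
by have -> : px v q = px w q by exact: near_eq_derive.
Qed.

Lemma orbit_initial Q q0 u0 Psi (v : R * R -> R) f : smooth_op q0 Q ->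
  local_flow Q (q0, u0) Psi -> {for q0, continuous v} -> v q0 = u0 ->
  (\forall z \near ((0 : R), q0), let p := Psi z.1 (z.2, v z.2) in f (p.1, z.1) = p.2) ->
  \forall q \near q0, f (q, 0) = v q.
Proof.
move=> sQ fP cv v0 orb; have [d d0 dP] := @local_flow_ball _ Q (q0, u0) Psi 1 sQ fP ltr01.
have [e e0 eP] := near_pair_ball orb.
have z0 (x : R) : 0 < x -> `|0 : R| < x by rewrite normr0.
have vd : `|v q0 - u0| < d by rewrite v0 subrr normr0.
apply: filterS (nbhsI (near_ball q0 e0) (nbhsI (near_ball q0 d0) (near_dist_lt cv vd))).
move=> q [qe [qd vq]]; have pd : `|(q, v q) - (q0, u0)| < d.
  by rewrite -[_ - _]/(q - q0, v q - u0) normr_pair_lt qd.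
have [E _ _] := dP _ _ (z0 _ d0) pd; have se : `|(0 : R) - 0| < e by rewrite subrr; exact: z0.
by have := eP 0 q se qe; rewrite /= E.
Qed.

Lemma orbit_invariance g eta (v : R * R -> R) f q0 u0 Q1 Q2 : lie_algebra2 q0 g ->
  (forall Q, g Q -> smooth_op q0 Q) -> g Q1 -> g Q2 -> independent q0 Q1 Q2 ->
  smooth_near v q0 -> invariant_near q0 Q1 v -> group_orbit Q2 q0 v f ->
  v q0 = u0 -> f (q0, 0) = u0 -> smooth_near f (q0, 0) -> du f (q0, 0) != 0 ->
  smooth_near eta (q0, u0) -> family_invariant q0 0 eta f ->
  (forall P, g P -> invariant0_near (q0, u0) (induced_op P) eta) /\
  characteristic Q2 f (q0, 0) != 0.
Proof.
move=> [[P1 [P2 basis0]] gB] gS g1 g2 ind sv inv [Psi [fP orb]] v0 f0 sf d0 se fx.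
rewrite v0 in fP; have cv := smooth_continuous sv; have s1 := gS _ g1; have s2 := gS _ g2.
have basis := independent_basis basis0 g1 g2 ind.
have W2 := orbit_characteristic s2 fP cv v0 sf orb.
have init := orbit_initial s2 fP cv v0 orb.
have W1 : \forall q \near q0, characteristic Q1 f (q, 0) = 0.
  apply: filterS (nbhsI (near_join init) inv) => q [E i].
  apply/(invariant_atE Q1 f (q, 0)); apply: near_eq_invariant_at i.
  by apply: filterS E => q' ->.
have [a [b B]] : exists a b, op_eq_near q0 (bracket Q1 Q2) (lincomb a Q1 b Q2).
  by have := gB _ _ g1 g2; rewrite [in X in X -> _](proj2 basis).
have [phi flat] := orbit_ratio_flat s1 s2 B fP cv v0 sf d0 W2 W1.
split; last by rewrite (nbhs_singleton W2).
have sdu : smooth_near (du f) (q0, 0) by exact: smooth_derive.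
have nd0 : \forall z \near (q0, (0 : R)), du f z != 0.
  exact: (cvgr_neq0 _ (smooth_continuous sdu)).
move=> P gP; have [x [y E]] : exists x y, op_eq_near q0 P (lincomb x Q1 y Q2).
  by move: gP; rewrite (proj2 basis).
(* By linearity the characteristic of every operator of [g] is again a function of [s] alone times
   [f_s]. *)
have WP : \forall z \near (q0, (0 : R)), characteristic P f z = (x * phi z.2 + y) * du f z.
  apply: filterS (nbhsI (near_fst (z := (q0, 0)) E) (nbhsI W2 (nbhsI flat nd0))).
  move=> z [E' [w [h n]]]; rewrite (characteristic_lincomb f E') w -h.
  exact: ratio_combination.
rewrite -f0 in se *; apply: (family_invariant0 sf d0 se fx (gS _ gP)).
have n := nbhsI (nbhsI (smooth_nearW sf) (near_graph sf (smooth_nearW se)))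
  (nbhsI (near_join fx) (near_join WP)).
apply: filterS n => z [[sf' se'] [fx' W']].
exact: (dx_ratio_flat (phi := fun s => x * phi s + y) sf' se' fx' W').
Qed.

End OrbitInvariance.

Section FamilyToEta.
Context {R : realType}.
Implicit Types (L : evolution_eq R) (Q P : operator R) (f eta : R * R * R -> R) (q : R * R).
Implicit Types (g : set (operator R)) (p z : R * R * R).

Lemma derive_reparameterized f (theta : R -> R) z (w : R * R) :
  'D_((w, 0) : R * R * R) (fun z => f (z.1, theta z.2)) z =
  'D_((w, 0) : R * R * R) f (z.1, theta z.2).
Proof.
case: z => q s; pose F z := f (z.1, theta z.2).
exact: etrans (esym (derive_slice F s w q)) (derive_slice f (theta s) w q).
Qed.

(** Relabelling changes no member of the family, so eta and [H] are unchanged and may be studied on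
    the orbit, where the parameter is that of the group. *)
Lemma reparameterized_family (H eta f f' : R * R * R -> R) q0 (k0 : R) :
  smooth_near f (q0, k0) -> du f (q0, k0) != 0 ->
  (\forall z \near (q0, k0), dx f z = eta (z.1, f z)) ->
  (\forall z \near (q0, k0), dt f z = H (z.1, f z)) ->
  reparameterization q0 k0 f 0 f' ->
  [/\ smooth_near f' (q0, 0), du f' (q0, 0) != 0, f' (q0, 0) = f (q0, k0),
      \forall z \near (q0, (0 : R)), dx f' z = eta (z.1, f' z) &
      \forall z \near (q0, (0 : R)), dt f' z = H (z.1, f' z)].
Proof.
move=> sf d0 fx ft [theta [sth th0 dth E]].
have sT : smooth_near (fun z : R * R * R => theta z.2) (q0, 0) by exact: smooth_snd.
have sf' : smooth_near f ((q0, 0 : R).1, theta (q0, 0 : R).2) by rewrite /= th0.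
have sF := smooth_graph sT sf'.
have s' : smooth_near f' (q0, 0) by apply: smooth_near_eq sF; apply: filterS E => z ->.
have D (K : R * R * R -> R) (w : R * R) :
    (\forall z \near (q0, k0), 'D_((w, 0) : R * R * R) f z = K (z.1, f z)) ->
    \forall z \near (q0, (0 : R)), 'D_((w, 0) : R * R * R) f' z = K (z.1, f' z).
  rewrite -{1}th0 => nK.
  apply: filterS (nbhsI (near_join E) (near_graph (z := (q0, 0)) sT nK)) => z [E' K'].
  have := etrans (near_eq_derive _ E') (etrans (derive_reparameterized f theta z w) K').
  by rewrite (nbhs_singleton E').
split=> //; last 2 first.
- exact: D fx.
- exact: D ft.
- have du' : is_derive (0 : R) 1 (fun s : R => f' (q0, s)) (du f' (q0, 0)).
    by case: q0 s' {sf d0 fx ft E sT sf' sF D} => t x s; apply: slice_is_derive; exact: smooth_differentiable.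
  have dc : is_derive (0 : R) 1 (fun s : R => f (q0, theta s)) (derive1 theta 0 * du f (q0, k0)).
    apply: (@is_derive_comp1 _ (fun k => f (q0, k)) theta).
      move: sf; rewrite th0; clear; case: q0 => t x s.
      by apply: slice_is_derive; exact: smooth_differentiable.
    by rewrite derive1E; exact: smooth_is_derive.
  have nE : \forall s \near (0 : R), f' (q0, s) = f (q0, theta s).
    have [e e0 eP] := near_pair_ball E; apply: filterS (near_ball 0 e0) => s se.
    by apply: eP => //; rewrite subrr normr0.
  have [_ <-] := du'; rewrite (near_eq_derive _ nE); have [_ ->] := dc.
  by rewrite mulf_neq0.
by rewrite (nbhs_singleton E) /= th0.
Qed.

Lemma associated_family_eta L g q0 u0 k0 f :
  smooth_near (Acoef L) q0 -> smooth_near (Bcoef L) q0 -> smooth_near (Ccoef L) q0 ->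
  lie_invariance_algebra2 L q0 g -> f (q0, k0) = u0 -> associated_family L g q0 k0 f ->
  exists eta : R * R * R -> R,
    [/\ invariant_solution_DE0 L g (q0, u0) eta, nonsingular L g (q0, u0) eta,
        family_invariant q0 k0 eta f &
        forall eta1, invariant_solution_DE0 L g (q0, u0) eta1 -> family_invariant q0 k0 eta1 f ->
          \forall p \near (q0, u0), eta1 p = eta p].
Proof.
move=> sA sB sC [alg gSL] fu [[sf sol nd] assoc].
have gS Q : g Q -> smooth_op q0 Q by move=> /gSL[].
have d0 : du f (q0, k0) != 0 by exact: nbhs_singleton nd.
have [eta se fx] := family_eta sf d0; exists eta.
have ft := iffRL (solution_family_leaf L sf se fx) sol.
have DE := family_DE0 sA sB sC sf d0 se fx ft.
have uniq := @family_eta_unique _ _ _ _ _ sf d0 fx.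
rewrite fu in se DE uniq.
have sH : smooth_near (ut_of L eta) (q0, u0) by exact: smooth_ut_of.
suff [inv ns] : (forall P, g P -> invariant0_near (q0, u0) (induced_op P) eta) /\
    nonsingular L g (q0, u0) eta.
  split=> //; last by move=> eta1 _; exact: uniq.
  by split=> // P [Q gQ <-]; exact: inv.
(* For a singular family all characteristics vanish, so all operators are tangent to the leaves and
   the rank is 2. For a regular one [W2 = f_s] does not vanish, so [Q2] is transversal and the rank
   is 3. *)
case: assoc => [sing|[Q1 [Q2 [g1 g2 ind [v [f' [[sv _] iv _ orb rep]]]]]]].
  have W0 P : g P -> \forall z \near (q0, k0), characteristic P f z = 0.
    by move=> /sing; apply: filterS => z /invariant_atE.
  split.
    move=> P gP; rewrite -fu in se *; apply: (family_invariant0 sf d0 se fx (gS _ gP)).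
    have n := nbhsI (nbhsI (smooth_nearW sf) (near_graph sf (smooth_nearW se)))
      (nbhsI (near_join fx) (near_join (W0 _ gP))).
    apply: filterS n => z [[sf' se'] [fx' W']].
    apply: (dx_ratio_flat (phi := fun=> 0) sf' se' fx').
    by apply: filterS W' => z' ->; rewrite mul0r.
  apply: nonsingular_tangent => P gP; rewrite -fu; apply: near_cover => //.
  apply: filterS (nbhsI (W0 _ gP) (nbhsI fx ft)) => z [w [x t]].
  by rewrite -(characteristicE P t x).
have [s' d' f0 fx' ft'] := reparameterized_family sf d0 fx ft rep.
rewrite fu in f0.
(* The orbit starts on the graph of [v], and the change of parameter sends 0 to [k0]; the two
   descriptions of the value at [q0] agree. *)
have v0 : v q0 = u0.
  have [Psi [fP orb']] := orb.
  have := nbhs_singleton (orbit_initial (gS _ g2) fP (smooth_continuous sv) erefl orb').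
  by rewrite f0.
have [inv W] := orbit_invariance alg gS g1 g2 ind sv iv orb v0 f0 s' d' se fx'.
split=> //; apply: (@nonsingular_transversal _ L g eta (q0, u0) Q2 gS se sH g2).
by move: W; rewrite (characteristicE Q2 (nbhs_singleton ft') (nbhs_singleton fx')) /= f0.
Qed.

End FamilyToEta.

(** * The two directions of the correspondence *)

Theorem theorem7 (R : realType) (L : evolution_eq R) (g : set (operator R))
    (q0 : R * R) (u0 : R)
    (hA : analytic_near (Acoef L) q0) (hB : analytic_near (Bcoef L) q0)
    (hC : analytic_near (Ccoef L) q0)
    (hA0 : \forall q \near q0, Acoef L q != 0)
    (hg : lie_invariance_algebra2 L q0 g)
    (hg0 : appropriate_for_reduction g (q0, u0)) :
  (forall eta : R * R * R -> R,
     invariant_solution_DE0 L g (q0, u0) eta ->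
     nonsingular L g (q0, u0) eta ->
     exists (k0 : R) (f : R * R * R -> R),
       [/\ f (q0, k0) = u0,
           reduction_family L q0 k0 eta f,
           associated_family L g q0 k0 f &
           forall (k1 : R) (f1 : R * R * R -> R),
             f1 (q0, k1) = u0 ->
             associated_family L g q0 k1 f1 ->
             family_invariant q0 k1 eta f1 ->
             reparameterization q0 k0 f k1 f1]) /\
  (forall (k0 : R) (f : R * R * R -> R),
     f (q0, k0) = u0 ->
     associated_family L g q0 k0 f ->
     exists eta : R * R * R -> R,
       [/\ invariant_solution_DE0 L g (q0, u0) eta,
           nonsingular L g (q0, u0) eta,
           family_invariant q0 k0 eta f &
           forall eta1 : R * R * R -> R,
             invariant_solution_DE0 L g (q0, u0) eta1 ->
             family_invariant q0 k0 eta1 f ->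
             \forall p \near (q0, u0), eta1 p = eta p]).
Proof.
have [sA sB sC] := And3 (proj1 hA) (proj1 hB) (proj1 hC); split=> [eta inv ns|k0 f fu assoc].
  have [se DE _] := inv; have sH : smooth_near (ut_of L eta) (q0, u0) by exact: smooth_ut_of.
  have compat : \forall p \near (q0, u0),
      dt eta p + ut_of L eta p * du eta p = dx (ut_of L eta) p + eta p * du (ut_of L eta) p.
    have n := nbhsI (nbhsI (near_fst (z := (q0, u0)) (smooth_nearW sA))
      (near_fst (z := (q0, u0)) (smooth_nearW sB)))
      (nbhsI (near_fst (z := (q0, u0)) (smooth_nearW sC)) (smooth_nearW se)).
    apply: filterS (nbhsI n DE) => p [[[a b] [c e]] d].
    exact: (iffLR (@DE0_compatE _ L eta p a b c e)).
  have [f [sf f0 df]] := integral_leaf sH se compat.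
  have fu : f (q0, u0) = u0 := nbhs_singleton f0.
  have red := leaf_reduction sA sB sC se sf f0 df; have [sol _ _] := red.
  (* Leaves are labelled by their value at [q0], so the base parameter is [u0] itself. *)
  exists u0, f; split; [exact: fu|exact: red| |].
    exact: (leaf_associated sA sB sC hg inv ns fu sol df).
  move=> k1 f1 f1u [sol1 _]; exact: (leaf_reparameterization sA sB sC se sf f0 df f1u sol1).
exact: associated_family_eta.
Qed.
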